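(* Let $p \in (1,2]$ and $\epsilon \in (0,1)$. Consider the message passing model on a connected undirected graph $G=(V,E)$ with $m$ vertices and diameter $d$, where player $i$ holds $X_i \in \{0,1,\dots,M\}^n$ and $\mathcal{X} = \sum_{i=1}^m X_i$. There is a (public-coin, randomized) protocol which, with probability at least $3/4$, outputs at a designated vertex a $(1\pm\epsilon)$-approximation of $F_p = \|\mathcal{X}\|_p^p = \sum_{j=1}^n |\mathcal{X}_j|^p$. The protocol uses a total communication of $O\!\left(\frac{m}{\epsilon^2}(\log\log n + \log d + \log(1/\epsilon))\right)$ bits and a max communication of $O\!\left(\frac{1}{\epsilon^2}(\log\log n + \log d + \log(1/\epsilon))\right)$ bits.
   Context: Message passing model: there are $m$ players, one at each vertex of a connected undirected graph $G=(V,E)$ known to all players. Player $i$ receives only its input vector $X_i \in \{0,1,\dots,M\}^n$ (non-negative integer entries). A player may send a message only to a neighbor in $G$, and that message is received only by that neighbor. The players share an arbitrarily long public random string. At termination, a pre-specified player must hold the output. The total communication is the total number of bits sent; the max communication is the maximum number of bits sent across any single edge over the execution. Standing assumption: $m, M = O(n^c)$ for a constant $c$, so $\log(nmM) = O(\log n)$. $d$ denotes the diameter of $G$. *)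

(* Defs.v *)
From mathcomp Require Import all_boot all_order all_algebra.
From mathcomp Require Import reals exp.

Set Implicit Arguments.
Unset Strict Implicit.
Unset Printing Implicit Defensive.

Import Order.TTheory GRing.Theory Num.Theory.
Local Open Scope ring_scope.

Section Graph.
Variables (V : finType) (e : rel V).

Definition connected_graph : Prop :=
  [/\ symmetric e, irreflexive e & forall u v, connect e u v].

Definition walk (k : nat) (u v : V) : bool :=
  [exists s : k.-tuple V, path e u s && (last u s == v)].

(* In a connected graph some k < #|V| works; if there is no walk from u to v
   the value is #|V|. *)
Definition dist (u v : V) : nat :=
  find (fun k => walk k u v) (iota 0 #|V|).

Definition diameter : nat := (\max_(u : V) \max_(v : V) dist u v)%N.

End Graph.

Definition input (n M : nat) := {ffun 'I_n -> 'I_M.+1}.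

(* A public-coin protocol proceeds in synchronous rounds; in each round each
   ordered pair of neighbours (u, v) carries at most one bit, so that messages
   of arbitrary length take several rounds.

   Whether u sends a bit to v in round t is decided by [speaks] from t, the
   public string and the bits already exchanged on the edge {u, v} (first
   those from u to v, then those from v to u), all of which are known to both
   endpoints. Silence and timing therefore carry no information, and every bit
   of communicated information is paid for. The value of the bit is decided by
   [bit] from everything u knows: the public string, its own input, and the
   bits it has received from, and sent to, each vertex (in this order). *)
Record protocol (R : Type) (V : finType) (n M : nat) := Protocol {
  coins : nat;
  rounds : nat;
  speaks : nat -> coins.-tuple bool -> V -> V ->
    seq bool -> seq bool -> bool;
  bit : nat -> coins.-tuple bool -> V -> input n M ->
    (V -> seq bool) -> (V -> seq bool) -> V -> bool;
  decide : coins.-tuple bool -> input n M ->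
    (V -> seq bool) -> (V -> seq bool) -> R
}.

Section Execution.
Variables (R : Type) (V : finType) (e : rel V) (n M : nat).
Variables (P : protocol R V n M).
Variables (r : (coins P).-tuple bool) (X : V -> input n M).

(* [h u v] is the string of bits sent so far from u to v. *)
Definition history := V -> V -> seq bool.

Definition step (t : nat) (h : history) : history := fun u v =>
  if e u v && speaks t r u v (h u v) (h v u)
  then rcons (h u v) (bit t r u (X u) (fun w => h w u) (h u) v)
  else h u v.

(* [iteri] applies [step 0] first and [step (rounds P).-1] last. *)
Definition run : history := iteri (rounds P) step (fun _ _ => [::]).

Definition output (o : V) : R :=
  decide r (X o) (fun w => run w o) (run o).

Definition total_comm : nat := (\sum_(u : V) \sum_(v : V) size (run u v))%N.

Definition max_comm : nat :=
  (\max_(u : V) \max_(v : V) (size (run u v) + size (run v u)))%N.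

End Execution.

Arguments run {R V} e {n M} P r X _ _.
Arguments output {R V} e {n M} P r X o.
Arguments total_comm {R V} e {n M} P r X.
Arguments max_comm {R V} e {n M} P r X.

(* Probability of an event under a uniformly random bit string of length k. *)
Definition coin_prob (R : realType) (k : nat) (A : pred (k.-tuple bool)) : R :=
  #|[set r | A r]|%:R / #|{: k.-tuple bool}|%:R.

Definition moment (R : realType) (V : finType) (n M : nat) (p : R)
    (X : V -> input n M) : R :=
  \sum_(j < n) `| \sum_(i : V) (X i j : nat)%:R | `^ p.

Definition approximates (R : realType) (eps a x : R) : bool :=
  (1 - eps) * x <= a <= (1 + eps) * x.

(* Main.v *)
(** Each of the O(1/eps^2) repetitions is a linear sketch: player [v] computes
    [sum_j X_v(j) W_j] for public independent copies [W_j] of an (approximately)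
    p-stable variable, and the numbers are added up along a breadth-first
    spanning tree.  Since [E cos (theta Y) = exp (- c theta^p F_p)] for the sum
    [Y], empirical means of cosines determine [F_p]; the decoder looks for an
    integer vector whose moment fits these means at all dyadic frequencies
    [theta] at which the exponent is at most 2.

    No p-stable law is constructed: a finite, integer valued law with
    [1 - E cos (t W)] within a factor [1 +- eta] of [kappa t^p], for [t] in a
    prescribed range, is enough.  Such a law puts mass proportional to
    [lambda^(-ip)] on [+- lambda^i], with [lambda] close to 1, and the required
    scaling follows from shifting the index [i].  A sum of [N] independent
    copies then gives the exponential.

    To save bits, every vertex rounds its partial sum at random, without bias,
    to a floating point number with [s] bits of mantissa, so that a message
    costs [s] bits plus the logarithm of the range of the exponent.  The
    rounding errors form a martingale, and by the von Bahr-Esseen inequality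
    their p-th moment is at most [O(2^-s)] times the sum over all vertices [v]
    of the p-th moments of the sketches of the subtrees.  The inputs being
    nonnegative, the moments of the subtrees at a given depth sum up to at most
    [F_p], so it is enough that [2^s] is polynomial in the diameter, [ln n] and
    [1/eps]. *)

Require Import Defs.
From mathcomp Require Import all_boot all_order all_algebra.
From mathcomp Require Import reals topology normedtype sequences derive exp trigo.
From mathcomp Require Import ring lra zify.

Set Implicit Arguments.
Unset Strict Implicit.
Unset Printing Implicit Defensive.

Import Order.TTheory GRing.Theory Num.Theory.
Import numFieldNormedType.Exports.
Local Open Scope ring_scope.

(** * Elementary inequalities *)

(** The number of dyadic frequencies grows with [ln (n * m * M)], yet controlling all of them at
    once costs no extra factor. At a frequency of exponent [Lambda] the mean of [1 - cos] is
    [O(Lambda)], so the observation there has variance [O(Lambda / K)], and the exponents that are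
    at most 2 sum geometrically. Hence [K = O(1 / eps^2)] repetitions suffice.

    The law imitates stability only on a window of frequencies, whose ratio [T] has to be polynomial
    in [n], [m], [M] and [1 / eps]. What matters is that its relative moment, the logarithm of its
    range and its inverse scale are polynomial in [ln T]. The number [N] of copies is fixed up to a
    factor by opposite demands: large enough to keep every relevant frequency below the upper end of
    the window, small enough to keep it above the lower end.

    The numbers of exponents and of mantissas of a message are both polynomial in [ln n], the
    diameter and [1 / eps]. The bracket of the theorem is the logarithm of such a polynomial, so
    degrees and constants need not be optimised. *)

Section Elementary.
Variable R : realType.
Implicit Types (a b p q s t x y : R).

Lemma cos_lip x y : `|cos x - cos y| <= `|x - y|.
Proof.
wlog xy : x y / y <= x => [H|].
  have /orP [/H //|/H] := le_total y x.
  by rewrite -normrN opprB -(normrN (y - x)) opprB.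
have [c _ ->] := @MVT_segment R cos (fun z => - sin z) y x xy
  (fun z _ => is_derive_cos z) (continuous_subspaceT (@continuous_cos R)).
by rewrite normrM normrN ler_piMl // sin_max.
Qed.

Lemma sin_lip x y : `|sin x - sin y| <= `|x - y|.
Proof.
wlog xy : x y / y <= x => [H|].
  have /orP [/H //|/H] := le_total y x.
  by rewrite -normrN opprB -(normrN (y - x)) opprB.
have [c _ ->] := @MVT_segment R sin cos y x xy
  (fun z _ => is_derive_sin z) (continuous_subspaceT (@continuous_sin R)).
by rewrite normrM ler_piMl // cos_max.
Qed.

Lemma normr_sin_le x : `|sin x| <= `|x|.
Proof. by have := sin_lip x 0; rewrite sin0 !subr0. Qed.

Lemma cosB_sin x y : cos x - cos y = 2 * (sin ((x + y) / 2) * sin ((y - x) / 2)).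
Proof.
have ex : x = (x + y) / 2 - (y - x) / 2 by field.
have ey : y = (x + y) / 2 + (y - x) / 2 by field.
rewrite [in LHS]ex [X in _ - cos X]ey cosB cosD; ring.
Qed.

(** For small arguments [cos_lip] is too weak: [kern_lip] has to cancel the singularity of [s^(-p)]
    at 0, which takes a second power. *)
Lemma cosB_le_sqr x y : 0 <= x -> x <= y -> `|cos x - cos y| <= (y ^+ 2 - x ^+ 2) / 2.
Proof.
move=> x0 xy; rewrite cosB_sin !normrM (ger0_norm (ler0n _ 2)).
have -> : (y ^+ 2 - x ^+ 2) / 2 = 2 * ((x + y) / 2 * ((y - x) / 2)) by field.
rewrite ler_pM2l // ler_pM //; (apply: le_trans (normr_sin_le _) _).
  rewrite ger0_norm //; lra.
rewrite ger0_norm //; lra.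
Qed.

Lemma oneBcosE x : 1 - cos x = 2 * sin (x / 2) ^+ 2.
Proof.
have := cosB_sin 0 x; rewrite cos0 add0r subr0 => ->; ring.
Qed.

Lemma oneBcos_ge0 x : 0 <= 1 - cos x.
Proof. by rewrite subr_ge0 cos_le1. Qed.

Lemma oneBcos_le2 x : 1 - cos x <= 2.
Proof. have := cos_geN1 x; lra. Qed.

Lemma oneBcos_le_sqr x : 1 - cos x <= x ^+ 2 / 2.
Proof.
rewrite oneBcosE -[sin _ ^+ 2]real_normK ?num_real //.
have := normr_sin_le (x / 2); have := normr_ge0 (sin (x / 2)) => h0 h.
have : `|sin (x / 2)| ^+ 2 <= `|x / 2| ^+ 2 by rewrite ler_sqr ?nnegrE.
rewrite (real_normK (num_real (x / 2))); lra.
Qed.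

Lemma sin_ge x : 0 <= x -> x * (1 - x ^+ 2 / 2) <= sin x.
Proof.
move=> x0.
have [c] := @MVT_segment R sin cos 0 x x0
  (fun z _ => is_derive_sin z) (continuous_subspaceT (@continuous_sin R)).
rewrite in_itv /= => /andP[c0 cx]; rewrite sin0 !subr0 => ->.
rewrite mulrC ler_wpM2r //.
have := oneBcos_le_sqr c; have : c ^+ 2 <= x ^+ 2 by rewrite ler_sqr ?nnegrE.
lra.
Qed.

Lemma oneBcos_ge x : 0 <= x <= 2 -> x ^+ 2 / 2 * (1 - x ^+ 2 / 4) <= 1 - cos x.
Proof.
move=> /andP[x0 x2]; rewrite oneBcosE.
have h := @sin_ge (x / 2) ltac:(lra).
have l0 : 0 <= x / 2 * (1 - (x / 2) ^+ 2 / 2) by nra.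
have : (x / 2 * (1 - (x / 2) ^+ 2 / 2)) ^+ 2 <= sin (x / 2) ^+ 2.
  by rewrite ler_sqr ?nnegrE // (le_trans l0).
move=> h2; apply: le_trans (_ : 2 * (x / 2 * (1 - (x / 2) ^+ 2 / 2)) ^+ 2 <= _); last lra.
have -> : 2 * (x / 2 * (1 - (x / 2) ^+ 2 / 2)) ^+ 2 =
  x ^+ 2 / 2 * (1 - x ^+ 2 / 4) + x ^+ 2 / 2 * (x ^+ 4 / 64) by field.
by rewrite lerDl mulr_ge0 ?divr_ge0 ?exprn_ge0.
Qed.

Lemma oneBcos_ge8 x : 0 <= x <= 2 -> x ^+ 2 / 8 <= 1 - cos x.
Proof.
move=> /andP[x0 x2]; rewrite oneBcosE.
have h := @sin_ge (x / 2) ltac:(lra).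
have h1 : x / 4 <= sin (x / 2).
  apply: le_trans h; have : (x / 2) ^+ 2 <= 1 by rewrite expr_le1 //; lra.
  nra.
have : (x / 4) ^+ 2 <= sin (x / 2) ^+ 2.
  rewrite ler_sqr ?nnegrE //; lra.
move=> h2; have -> : x ^+ 2 / 8 = 2 * (x / 4) ^+ 2 by field.
lra.
Qed.

(** In half-angle form this is subadditivity of [|sin|], squared at the cost of a factor 2. It lets
    rounding noise be added to a sketch while the mean of [1 - cos] stays of order [Lambda]. *)
Lemma oneBcosD_le x y : 1 - cos (x + y) <= 2 * (1 - cos x) + 2 * (1 - cos y).
Proof.
rewrite !oneBcosE (_ : (x + y) / 2 = x / 2 + y / 2) ?sinD; last by field.
set a := sin (x / 2); set b := sin (y / 2).
set c := cos (x / 2); set d := cos (y / 2).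
have hc : c ^+ 2 <= 1 by rewrite /c cos2sin2; have := sqr_ge0 (sin (x / 2)); lra.
have hd : d ^+ 2 <= 1 by rewrite /d cos2sin2; have := sqr_ge0 (sin (y / 2)); lra.
have h : (a * d + c * b) ^+ 2 <= 2 * (a ^+ 2 * d ^+ 2) + 2 * (c ^+ 2 * b ^+ 2).
  have : 0 <= (a * d - c * b) ^+ 2 by apply: sqr_ge0.
  rewrite !expr2; lra.
have : a ^+ 2 * d ^+ 2 <= a ^+ 2 by rewrite ler_piMr // sqr_ge0.
have : c ^+ 2 * b ^+ 2 <= b ^+ 2 by rewrite ler_piMl // sqr_ge0.
lra.
Qed.

Lemma ln_le_subr1 x : 0 < x -> ln x <= x - 1.
Proof. by move=> x0; have := @le_ln1Dx R (x - 1) ltac:(lra); rewrite addrC subrK. Qed.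

Lemma powR_le1Dq y q : 0 <= y -> 0 <= q <= 1 -> y `^ q <= 1 + q * (y - 1).
Proof.
move=> y0 /andP[q0 q1].
have [->|yn0] := eqVneq y 0.
  have [->|qn0] := eqVneq q 0; first by rewrite powRr0; lra.
  by rewrite powR0 //; lra.
have yp : 0 < y by rewrite lt0r yn0.
set m := 1 + q * (y - 1).
have m0 : 0 < m.
  rewrite /m; have [->|qn1] := eqVneq q 1; first by lra.
  have : q < 1 by rewrite lt_neqAle qn1.
  nra.
have h1 := ln_le_subr1 (divr_gt0 yp m0).
have h2 := @ln_le_subr1 m^-1 ltac:(by rewrite invr_gt0).
rewrite ln_div ?posrE // in h1; rewrite lnV ?posrE // in h2.
(* Weighted arithmetic-geometric mean: the bounds [h1] and [h2] at [y / m] and [1 / m], with weights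
   [q] and [1 - q], have right-hand sides of sum 0, as [m] is the weighted mean of [y] and 1. *)
have h : q * ln y <= ln m.
  have e : q * (y / m) + (1 - q) * m^-1 = 1.
    by rewrite /m; field; rewrite -/m gt_eqF.
  have := ler_wpM2l q0 h1; have := @ler_wpM2l R (1 - q) ltac:(lra) _ _ h2.
  lra.
by rewrite -[leLHS]lnK ?posrE ?powR_gt0 // -[leRHS]lnK ?posrE // ler_expR ln_powR.
Qed.

Lemma ler_powR2 x y q : 0 <= q -> 0 <= x -> x <= y -> x `^ q <= y `^ q.
Proof.
move=> q0 x0 xy; rewrite ge0_ler_powR // nnegrE //; exact: le_trans xy.
Qed.

Lemma powR_le1 x q : 0 <= q -> 0 <= x <= 1 -> x `^ q <= 1.
Proof.
move=> q0 /andP[x0 x1]; have := @ler_powR2 x 1 q q0 x0 x1; by rewrite powR1.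
Qed.

Lemma powR_ge1 x q : 0 <= q -> 1 <= x -> 1 <= x `^ q.
Proof. by move=> q0 x1; have := @ler_powR2 1 x q q0 ler01 x1; rewrite powR1. Qed.

Lemma sqr_le_powR x p : p <= 2 -> 0 <= x <= 1 -> x ^+ 2 <= x `^ p.
Proof.
move=> p2 /andP[x0 x1]; have [->|xn0] := eqVneq x 0; first by rewrite expr0n powR_ge0.
by rewrite -powR_mulrn // ger_powR // lt0r xn0 x0.
Qed.

Lemma powR_le_sqr x p : p <= 2 -> 1 <= x -> x `^ p <= x ^+ 2.
Proof. by move=> p2 x1; rewrite -powR_mulrn ?(le_trans ler01) // ler_powR. Qed.

Lemma powR_x1 x p : 1 <= p -> 0 <= x -> x `^ p = x * x `^ (p - 1).
Proof. by move=> p1 x0; rewrite mulr_powRB1 //; lra. Qed.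

(** Split off one factor [1 + x] and bound the remaining power, which is concave, by its tangent at
    1; the product has quadratic coefficient [p - 1 <= 1]. *)
Lemma powR1D_le x p : 1 <= p <= 2 -> -1 <= x ->
  (1 + x) `^ p <= 1 + p * x + x ^+ 2.
Proof.
move=> /andP[p1 p2] x1.
rewrite powR_x1 //; last by lra.
have := @powR_le1Dq (1 + x) (p - 1) ltac:(lra) ltac:(lra).
set z := _ `^ _ => h.
have : (1 + x) * z <= (1 + x) * (1 + (p - 1) * (1 + x - 1)).
  by rewrite ler_wpM2l //; lra.
have : 0 <= (2 - p) * x ^+ 2 by rewrite mulr_ge0 ?sqr_ge0 //; lra.
rewrite expr2; nra.
Qed.

(* The linear term is odd in [x], so it averages out against a centred [x]. *)
Definition pslope p a : R := p * (Num.sg a * `|a| `^ (p - 1)).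

(** If [|x| <= |a|], divide by [a] and use [powR1D_le], where [(x / a)^2 <= |x / a|^p]. Otherwise
    the left side is at most [4 |x|^p] and the linear term at least [- 2 |x|^p], whence the constant
    6. *)
Lemma norm_powRD_le p a x : 1 <= p <= 2 ->
  `|a + x| `^ p <= `|a| `^ p + pslope p a * x + 6 * `|x| `^ p.
Proof.
move=> /andP[p1 p2].
have p0 : 0 <= p by lra.
have [->|an0] := eqVneq a 0.
  rewrite /pslope sgr0 mul0r mulr0 mul0r normr0 add0r powR0; last by lra.
  have := powR_ge0 `|x| p; lra.
have a0 : 0 < `|a| by rewrite normr_gt0.
have [xa|ax] := leP `|x| `|a|.
- have xa1 : `|x / a| <= 1 by rewrite normf_div ler_pdivrMr // mul1r.
  have ge : -1 <= x / a by move: xa1; rewrite ler_norml => /andP[].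
  have -> : a + x = a * (1 + x / a) by field.
  rewrite normrM powRM // (ger0_norm (_ : 0 <= 1 + x / a)); last by lra.
  have h := @powR1D_le (x / a) p ltac:(by rewrite p1) ge.
  have := ler_wpM2l (powR_ge0 `|a| p) h => /le_trans; apply.
  have -> : pslope p a * x = `|a| `^ p * (p * (x / a)).
    have -> : x / a = Num.sg a * x / `|a|.
      have key s b : a = s * b -> s * s = 1 -> b != 0 -> x / a = s * x / b.
        move=> -> ss b0; have s0 : s != 0.
          by apply: contra_eq_neq ss => ->; rewrite mul0r eq_sym oner_eq0.
        rewrite invfM mulrA; congr (_ / b); rewrite mulrC; apply: (mulfI s0).
        by rewrite !mulrA divff // ss.
      by apply: key; rewrite -?numEsg -?expr2 ?sqr_sg ?an0 // gt_eqF.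
    by rewrite /pslope (@powR_x1 `|a| p) //; field; rewrite gt_eqF.
  have : `|a| `^ p * (x / a) ^+ 2 <= `|x| `^ p.
    have -> : `|x| `^ p = `|a| `^ p * `|x / a| `^ p.
      by rewrite -powRM // -normrM mulrCA divff // mulr1.
    rewrite ler_wpM2l ?powR_ge0 // -real_normK ?num_real //.
    by rewrite sqr_le_powR // normr_ge0.
  have := powR_ge0 `|x| p; lra.
have h1 : `|a + x| `^ p <= 4 * `|x| `^ p.
  have : `|a + x| `^ p <= (2 * `|x|) `^ p.
    rewrite ler_powR2 //; apply: le_trans (ler_normD _ _) _; lra.
  move=> /le_trans; apply; rewrite powRM // ler_wpM2r ?powR_ge0 //.
  by have := @powR_le_sqr 2 p p2 ltac:(lra); lra.
have h2 : - (pslope p a * x) <= 2 * `|x| `^ p.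
  apply: le_trans (ler_norm _) _; rewrite normrN /pslope !normrM normr_sg an0 mul1r.
  rewrite (ger0_norm p0) (ger0_norm (powR_ge0 _ _)) (@powR_x1 `|x| p) //.
  rewrite -mulrA ler_pM // ?mulr_ge0 ?powR_ge0 //.
  by rewrite mulrC ler_wpM2l // ler_powR2 //; [lra|exact: ltW].
have := powR_ge0 `|a| p; lra.
Qed.

Lemma norm_powRD_le4 p a x : 1 <= p <= 2 ->
  `|a + x| `^ p <= 4 * `|a| `^ p + 4 * `|x| `^ p.
Proof.
move=> /andP[p1 p2].
have p0 : 0 <= p by lra.
have key u v : `|u| <= `|v| -> `|u + v| `^ p <= 4 * `|v| `^ p.
  move=> uv; have : `|u + v| `^ p <= (2 * `|v|) `^ p.
    rewrite ler_powR2 //; apply: le_trans (ler_normD _ _) _; lra.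
  move=> /le_trans; apply; rewrite powRM // ler_wpM2r ?powR_ge0 //.
  by have := @powR_le_sqr 2 p p2 ltac:(lra); lra.
have := powR_ge0 `|x| p; have := powR_ge0 `|a| p.
have /orP[/key|/key] := le_total `|a| `|x|; rewrite ?(addrC x); lra.
Qed.

Lemma oneBcos_le_powR p x : 1 <= p <= 2 -> 1 - cos x <= 2 * `|x| `^ p.
Proof.
move=> /andP[p1 p2]; have [x1|x1] := leP `|x| 1.
  apply: le_trans (oneBcos_le_sqr x) _.
  rewrite -real_normK ?num_real //.
  have := @sqr_le_powR `|x| p p2 ltac:(by rewrite normr_ge0).
  have := sqr_ge0 `|x|; lra.
apply: le_trans (oneBcos_le2 x) _.
have := @powR_ge1 `|x| p ltac:(lra) (ltW x1); lra.
Qed.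

(** Serves to bound a first moment by a p-th moment at an additive price [d]: above [d], the
    quotient [|x|^p / |x|] is at least [d^(p - 1) >= d]. *)
Lemma norm_le_delta p d x : 1 <= p <= 2 -> 0 < d <= 1 ->
  `|x| <= d + d^-1 * `|x| `^ p.
Proof.
move=> /andP[p1 p2] /andP[d0 d1].
have [xd|dx] := leP `|x| d.
  by rewrite (le_trans xd) // lerDl mulr_ge0 ?powR_ge0 // invr_ge0 ltW.
have x0 : 0 < `|x| by apply: lt_trans dx.
suff h : `|x| <= d^-1 * `|x| `^ p by lra.
rewrite powR_x1 // mulrCA ler_peMr // ler_pdivlMl // mulr1.
have : d `^ (p - 1) <= `|x| `^ (p - 1) by apply: ler_powR2; lra.
by apply: le_trans; apply: ger1_powR; [rewrite d0 | lra].
Qed.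

Lemma expR_lip x y : 0 <= x -> 0 <= y -> `|expR (- x) - expR (- y)| <= `|x - y|.
Proof.
wlog xy : x y / x <= y => [H|].
  move=> x0 y0; have /orP[/H|/H] := le_total x y; first exact.
  by rewrite -normrN opprB -(normrN (y - x)) opprB; apply.
move=> x0 y0; rewrite (ger0_norm (_ : 0 <= _ - _)); last by rewrite subr_ge0 ler_expR lerN2.
rewrite ler0_norm ?subr_le0 //.
have -> : expR (- y) = expR (- x) * expR (- (y - x)) by rewrite -expRD; congr expR; lra.
have h := expR_ge1Dx (- (y - x)).
have hx : expR (- x) <= 1 by rewrite expR_le1; lra.
have hx0 := expR_ge0 (- x).
have : expR (- x) - expR (- x) * expR (- (y - x)) <= expR (- x) * (y - x) by nra.
nra.
Qed.

Lemma expR_gap b x y : 0 <= x -> x <= y -> y <= b ->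
  expR (- b) * (y - x) <= expR (- x) - expR (- y).
Proof.
move=> x0 xy yb.
have -> : expR (- x) = expR (- y) * expR (y - x) by rewrite -expRD; congr expR; lra.
have h := expR_ge1Dx (y - x).
have h2 : expR (- b) <= expR (- y) by rewrite ler_expR lerN2.
have h0 := expR_ge0 (- b).
nra.
Qed.

(** Follows from [1 / (1 - x) <= 1 + x + 2 x^2]. It is the lower half of the comparison of
    [(1 - a)^N] with [exp (- N a)]. *)
Lemma oneB_ge_expR x : 0 <= x <= 1/2 -> expR (- (x + 2 * x ^+ 2)) <= 1 - x.
Proof.
move=> /andP[x0 x1].
rewrite expRN -[leRHS]invrK lef_pV2 ?posrE ?expR_gt0 ?invr_gt0 //; last by lra.
apply: le_trans (expR_ge1Dx _); rewrite -div1r ler_pdivrMr; last by lra.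
rewrite expr2; nra.
Qed.
End Elementary.

(** * Expectations over finite types *)

Section Expectation.
Variable R : realType.

Definition Ex (T : finType) (f : T -> R) : R := (\sum_x f x) / #|T|%:R.

Lemma eq_Ex (T : finType) (f g : T -> R) : f =1 g -> Ex f = Ex g.
Proof. by move=> fg; rewrite /Ex (eq_bigr g). Qed.

Lemma ExD (T : finType) (f g : T -> R) : Ex (fun x => f x + g x) = Ex f + Ex g.
Proof. by rewrite /Ex big_split mulrDl. Qed.

Lemma ExZ (T : finType) a (f : T -> R) : Ex (fun x => a * f x) = a * Ex f.
Proof. by rewrite /Ex -mulr_sumr mulrA. Qed.

Lemma ExN (T : finType) (f : T -> R) : Ex (fun x => - f x) = - Ex f.
Proof. by rewrite /Ex sumrN mulNr. Qed.

Lemma ExB (T : finType) (f g : T -> R) : Ex (fun x => f x - g x) = Ex f - Ex g.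
Proof. by rewrite ExD ExN. Qed.

Lemma Ex_sum (T : finType) (I : Type) (s : seq I) (P : pred I) (F : I -> T -> R) :
  Ex (fun x => \sum_(i <- s | P i) F i x) = \sum_(i <- s | P i) Ex (F i).
Proof. by rewrite /Ex exchange_big mulr_suml. Qed.

Lemma Ex0 (T : finType) : Ex (fun _ : T => 0) = 0.
Proof. by rewrite /Ex big1 // mul0r. Qed.

Lemma Ex_cst (T : finType) a : (0 < #|T|)%N -> Ex (fun _ : T => a) = a.
Proof.
move=> T0; rewrite /Ex sumr_const -[a *+ _]mulr_natr mulfK // pnatr_eq0 -lt0n //.
Qed.

Lemma ler_Ex (T : finType) (f g : T -> R) : (forall x, f x <= g x) -> Ex f <= Ex g.
Proof. by move=> fg; rewrite ler_wpM2r ?invr_ge0 // ler_sum. Qed.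

Lemma Ex_ge0 (T : finType) (f : T -> R) : (forall x, 0 <= f x) -> 0 <= Ex f.
Proof. by move=> f0; rewrite mulr_ge0 ?invr_ge0 // sumr_ge0. Qed.

Lemma norm_Ex (T : finType) (f : T -> R) : `|Ex f| <= Ex (fun x => `|f x|).
Proof.
rewrite /Ex normrM (@ger0_norm _ _^-1) ?invr_ge0 // ler_wpM2r ?invr_ge0 //.
exact: ler_norm_sum.
Qed.

Lemma Ex_pair (S T : finType) (f : S * T -> R) :
  Ex f = Ex (fun x => Ex (fun y => f (x, y))).
Proof.
rewrite /Ex -mulr_suml -mulrA -invfM -natrM mulnC -card_prod; congr (_ / _).
by rewrite pair_bigA; apply: eq_bigr => -[].
Qed.

(** Replaces conditioning on all coordinates but [j]: that coordinate is redrawn, and one averages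
    over the fresh value. *)
Definition resample (J U : finType) (w : {ffun J -> U}) (j : J) (u : U) : {ffun J -> U} :=
  [ffun i => if i == j then u else w i].

Lemma resample_eq (J U : finType) (w : {ffun J -> U}) j u : resample w j u j = u.
Proof. by rewrite ffunE eqxx. Qed.

Lemma resample_neq (J U : finType) (w : {ffun J -> U}) j u i :
  i != j -> resample w j u i = w i.
Proof. by rewrite ffunE => /negbTE->. Qed.

(** Exchanging [w j] with the fresh value is an involution of the pairs [(w, u)], hence preserves
    the uniform measure. *)
Lemma Ex_resample (J U : finType) (j : J) (f : {ffun J -> U} -> R) :
  (0 < #|U|)%N -> Ex f = Ex (fun w => Ex (fun u => f (resample w j u))).
Proof.
move=> U0; rewrite /Ex -mulr_suml; congr (_ / _).
apply: (canRL (mulfK _)); first by rewrite pnatr_eq0 -lt0n.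
rewrite pair_bigA /=.
pose g (x : {ffun J -> U} * U) := (resample x.1 j x.2, x.1 j).
have gg : involutive g.
  move=> [w u]; rewrite /g /= resample_eq; congr (_, _).
  by apply/ffunP => i; rewrite !ffunE; case: eqP => // ->.
rewrite (reindex_inj (inv_inj gg)) /=.
transitivity (\sum_(x : {ffun J -> U} * U) f x.1); last first.
  apply: eq_bigr => -[w u] _ /=; congr f.
  by apply/ffunP => i; rewrite !ffunE; case: eqP => // ->.
rewrite -(pair_bigA _ (fun w (u : U) => f w)) /= mulr_suml.
by apply: eq_bigr => w _; rewrite sumr_const; exact: mulr_natr.
Qed.

(** Multiplicativity of characteristic functions in real form: in the addition formula for [cos],
    the product of sines averages to 0. *)
Lemma Ex_cos_sum (J U : finType) (h : J -> U -> R) : (0 < #|U|)%N ->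
  (forall j, Ex (fun u => sin (h j u)) = 0) ->
  Ex (fun w : {ffun J -> U} => cos (\sum_j h j (w j))) =
  \prod_j Ex (fun u => cos (h j u)).
Proof.
move=> U0 hs.
suff H (s : seq J) : uniq s ->
    Ex (fun w : {ffun J -> U} => cos (\sum_(j <- s) h j (w j))) =
    \prod_(j <- s) Ex (fun u => cos (h j u)) by rewrite H ?index_enum_uniq.
elim: s => [_|j s IH /= /andP[js us]].
  rewrite big_nil (@eq_Ex _ _ (fun=> 1)) ?Ex_cst ?card_ffun ?expn_gt0 ?U0 //.
  by move=> w; rewrite big_nil cos0.
rewrite big_cons -IH // -ExZ (Ex_resample j) //; apply: eq_Ex => w.
have -> : Ex (fun u => cos (\sum_(i <- j :: s) h i (resample w j u i))) =
    Ex (fun u => cos (h j u) * cos (\sum_(i <- s) h i (w i))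
               - sin (h j u) * sin (\sum_(i <- s) h i (w i))).
  apply: eq_Ex => u; rewrite big_cons resample_eq -cosD.
  congr (cos (_ + _)); apply: eq_big_seq => i si; rewrite resample_neq //.
  by apply: contraNneq js => <-.
rewrite ExB.
under eq_Ex do rewrite mulrC.
rewrite ExZ; under [X in _ - X]eq_Ex do rewrite mulrC.
by rewrite ExZ hs mulr0 subr0 mulrC.
Qed.

Lemma Ex_sqr_sum (J U : finType) (h : U -> R) : (0 < #|U|)%N -> Ex h = 0 ->
  Ex (fun w : {ffun J -> U} => (\sum_j h (w j)) ^+ 2) = #|J|%:R * Ex (fun u => h u ^+ 2).
Proof.
move=> U0 h0.
suff H (s : seq J) : uniq s ->
    Ex (fun w : {ffun J -> U} => (\sum_(j <- s) h (w j)) ^+ 2) =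
    (size s)%:R * Ex (fun u => h u ^+ 2).
  by rewrite H ?index_enum_uniq // /index_enum -enumT -cardE.
elim: s => [_|j s IH /= /andP[js us]].
  rewrite mul0r (@eq_Ex _ _ (fun=> 0)) ?Ex0 //.
  by move=> w; rewrite big_nil expr0n.
rewrite -natr1 mulrDl mul1r -IH // (Ex_resample j) //.
transitivity (Ex (fun w : {ffun J -> U} => (\sum_(i <- s) h (w i)) ^+ 2 + Ex (fun u => h u ^+ 2))).
  apply: eq_Ex => w; set S := \sum_(i <- s) _.
  transitivity (Ex (fun u => (2 * S) * h u + h u ^+ 2 + S ^+ 2)); last first.
    by rewrite !ExD ExZ h0 mulr0 add0r addrC Ex_cst.
  apply: eq_Ex => u; rewrite big_cons resample_eq.
  have -> : \sum_(i <- s) h (resample w j u i) = S.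
    apply: eq_big_seq => i si; rewrite resample_neq //.
    by apply: contraNneq js => <-.
  ring.
by rewrite ExD Ex_cst // card_ffun expn_gt0 U0.
Qed.

(* von Bahr-Esseen inequality. The coins are revealed in order of decreasing
   rank [rk]. *)
Lemma von_Bahr_Esseen (J U : finType) (p : R) (rk : J -> nat)
    (h : J -> {ffun J -> U} -> R) (A : {set J}) :
  (0 < #|U|)%N -> 1 <= p <= 2 ->
  (forall j w, Ex (fun u => h j (resample w j u)) = 0) ->
  (forall i j w u, j != i -> (rk j <= rk i)%N -> h i (resample w j u) = h i w) ->
  Ex (fun w => `|\sum_(i in A) h i w| `^ p) <=
  6 * \sum_(i in A) Ex (fun w => `|h i w| `^ p).
Proof.
move=> U0 p12 h0 hi; have p0 : p != 0 by move: p12; lra.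
elim: {A}#|A| {-2}A (leqnn #|A|) => [|k IH] A.
  rewrite leqn0 cards_eq0 => /eqP ->; rewrite big_set0 mulr0.
  rewrite (@eq_Ex _ _ (fun=> 0)) ?Ex0 // => w.
  by rewrite big_set0 normr0 powR0.
have [->|/set0Pn[j0 j0A]] := eqVneq A set0.
  by move=> _; apply: IH; rewrite cards0.
(* The index of least rank is revealed last: redrawing its coin leaves all other terms fixed, so [S]
   is constant and the linear term of [norm_powRD_le] averages to 0. *)
case: (@arg_minnP _ j0 (mem A) rk j0A) => j jA0 jmin Ak.
have jA : j \in A by [].
have AE (F : J -> R) : \sum_(i in A) F i = F j + \sum_(i in A :\ j) F i.
  by rewrite (big_setD1 j).
rewrite AE mulrDr; apply: (@le_trans _ _ (6 * Ex (fun w => `|h j w| `^ p) +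
   Ex (fun w => `|\sum_(i in A :\ j) h i w| `^ p))); last first.
  rewrite lerD2l IH //; have := cardsD1 j A; rewrite jA => e.
  by rewrite e ltnS in Ak.
rewrite (Ex_resample j) // [X in 6 * X](Ex_resample j) // -ExZ -ExD.
apply: ler_Ex => w; set S := \sum_(i in A :\ j) h i w.
apply: (@le_trans _ _ (Ex (fun u => `|S| `^ p + (pslope p S * h j (resample w j u) +
   6 * `|h j (resample w j u)| `^ p)))).
  apply: ler_Ex => u; rewrite AE.
  have -> : \sum_(i in A :\ j) h i (resample w j u) = S.
    apply: eq_bigr => i; rewrite !inE => /andP[ij iA]; apply: hi; first by rewrite eq_sym.
    exact: jmin.
  by rewrite addrC addrA norm_powRD_le.
by rewrite !ExD !ExZ h0 mulr0 add0r Ex_cst // addrC.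
Qed.

Lemma coins_bij (T : finType) k : #|T| = (2 ^ k)%N ->
  exists f : k.-tuple bool -> T, bijective f.
Proof.
move=> Tk; have e : #|{: k.-tuple bool}| = #|T| by rewrite card_tuple card_bool.
exists (fun r => enum_val (cast_ord e (enum_rank r))).
exists (fun x => enum_val (cast_ord (esym e) (enum_rank x))) => x.
  by rewrite enum_valK cast_ordK enum_rankK.
by rewrite enum_valK cast_ordKV enum_rankK.
Qed.

Lemma coin_prob_bij (T : finType) k (f : k.-tuple bool -> T) (A : pred T) :
  bijective f -> coin_prob R (fun r => A (f r)) = Ex (fun x => (A x)%:R).
Proof.
move=> bf; rewrite /coin_prob /Ex (bij_eq_card bf); congr (_ / _).
rewrite (reindex f) /=; last exact: onW_bij.
by rewrite -natr_sum -sum1dep_card big_mkcond.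
Qed.

Lemma Ex_markov (T : finType) (A : pred T) (f : T -> R) (a : R) : 0 < a ->
  (forall x, 0 <= f x) -> (forall x, A x -> a <= f x) -> Ex (fun x => (A x)%:R) <= Ex f / a.
Proof.
move=> a0 f0 fA; rewrite mulrC -ExZ; apply: ler_Ex => x.
case: (boolP (A x)) => [/fA h|_] /=; last by rewrite mulr_ge0 ?invr_ge0 ?(ltW a0).
by rewrite mulr1n ler_pdivlMl // mulr1.
Qed.
End Expectation.

(** * An approximately stable law *)

Section LogScaleSum.
Variable R : realType.
Implicit Types (s t u v w : R).

Lemma exists_pow2 (x : R) : 1 <= x -> exists i : nat, x <= 2 ^+ i <= 2 * x.
Proof.
move=> x1.
have ex : exists i : nat, x <= 2 ^+ i.
  exists (Num.bound x); apply: le_trans (ltW (archi_boundP _)) _; first by lra.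
  by rewrite -natrX ler_nat ltnW // ltn_expl.
case: (ex_minnP ex) => -[|i] xi imin; [exists 0%N | exists i.+1]; rewrite xi /=.
  by rewrite expr0; lra.
rewrite exprS ler_pM2l //; case: leP => // /ltW /imin; by rewrite ltnn.
Qed.

Lemma powRV (x r : R) : 0 <= x -> (x^-1) `^ r = (x `^ r)^-1.
Proof. by move=> x0; rewrite -powR_inv1 // -powRrM mulN1r powRN. Qed.

Section Fixed.
Variables (p beta : R) (h : nat).
Hypotheses (p12 : 1 < p < 2) (beta0 : 0 < beta).
Hypotheses (betap : beta <= p - 1) (betap2 : 2 * beta <= 2 - p).
Hypothesis h0 : (0 < h)%N.

(** A rational ratio: [h ^ I * ratio ^ i] is an integer for [i <= I], so the law can be integer
    valued. *)
Definition ratio : R := 1 + h%:R^-1.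
Notation lam := ratio.

Let hR : 0 < h%:R :> R. Proof. by rewrite ltr0n. Qed.
Let hVle1 : h%:R^-1 <= 1 :> R. Proof. by rewrite invf_le1 ?ler1n. Qed.
Let hV0 : 0 < h%:R^-1 :> R. Proof. by rewrite invr_gt0. Qed.

Lemma ratio_gt1 : 1 < lam. Proof. have := hV0; rewrite /ratio; lra. Qed.
Lemma ratio_le2 : lam <= 2. Proof. have := hVle1; rewrite /ratio; lra. Qed.
Lemma ratio_gt0 : 0 < lam. Proof. exact: lt_trans ratio_gt1. Qed.

(* [cutoff] is dominated by the increments of the bounded increasing function
   [sigmoid] along a geometric progression, so its sums telescope. *)
Definition cutoff s : R := Num.min (s `^ beta) (s `^ beta)^-1.
Definition sigmoid s : R := 1 - (1 + s `^ beta)^-1.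

Lemma cutoff_ge0 s : 0 <= cutoff s.
Proof. by rewrite le_min powR_ge0 invr_ge0 powR_ge0. Qed.

Lemma cutoff_small s : 0 <= s <= 1 -> cutoff s = s `^ beta.
Proof.
move=> /andP[s0 s1]; apply/min_idPl.
have [->|w0] := eqVneq (s `^ beta) 0; first by rewrite invr0.
have w1 : s `^ beta <= 1 by rewrite powR_le1 ?s0 ?s1 // ltW.
have w00 : 0 < s `^ beta by rewrite lt_neqAle eq_sym w0 powR_ge0.
by apply: (le_trans w1); rewrite invf_ge1.
Qed.

Lemma cutoff_large s : 1 <= s -> cutoff s = (s `^ beta)^-1.
Proof.
move=> s1; apply/min_idPr.
have w1 : 1 <= s `^ beta by rewrite powR_ge1 // ltW.
by apply: le_trans (w1); rewrite invf_le1 // (lt_le_trans ltr01).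
Qed.

Lemma ratio_powR_ge : 1 + beta / (2 * h%:R) <= lam `^ beta.
Proof.
have hR1 := hR; have hV1 := hV0; have hV2 := hVle1; have be0 := beta0.
have lam0 := ratio_gt0.
rewrite -[leRHS]lnK ?posrE ?powR_gt0 // ln_powR.
apply: le_trans (expR_ge1Dx _); rewrite lerD2l ler_pM2l //.
have : ln lam^-1 <= lam^-1 - 1 by apply: ln_le_subr1; rewrite invr_gt0.
rewrite lnV ?posrE // => hl.
suff : (2 * h%:R)^-1 <= 1 - lam^-1 by lra.
have -> : 1 - lam^-1 = (h%:R + 1)^-1.
  by rewrite /ratio; field; rewrite !gt_eqF //; lra.
have h1 : 1 <= h%:R :> R by rewrite ler1n.
by rewrite lef_pV2 ?posrE; lra.
Qed.

Lemma cutoff_le_sigmoid s : 0 < s ->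
  cutoff s <= 16 * h%:R / beta * (sigmoid (lam * s) - sigmoid s).
Proof.
have hR1 := hR; have hV1 := hV0; have hV2 := hVle1; have /andP[p1 p2] := p12; have be0 := beta0; have be1 := betap; have be2 := betap2.
have l0 := ltW ratio_gt0; move=> s0; rewrite /sigmoid powRM ?(ltW s0) //.
set mu := lam `^ beta; set w := s `^ beta.
have w0 : 0 < w by rewrite powR_gt0.
have mu1 : 1 + beta / (2 * h%:R) <= mu := ratio_powR_ge.
have bh : 0 < beta / (2 * h%:R) by rewrite divr_gt0 ?mulr_gt0.
have mu2 : mu <= 2.
  apply: le_trans (_ : lam `^ 1 <= 2); last by rewrite powRr1 ?ratio_le2 // ltW // ratio_gt0.
  by rewrite /mu; apply: ler_powR; [exact: ltW ratio_gt1 | lra].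
have mu0 : 0 < mu by lra.
have mw0 : 0 < mu * w by rewrite mulr_gt0.
have -> : 1 - (1 + mu * w)^-1 - (1 - (1 + w)^-1) =
   (mu - 1) * (w / ((1 + w) * (1 + mu * w))).
  by field; rewrite !gt_eqF //; lra.
(* Here [cutoff s] is the minimum of [w] and [1 / w], which is at most [4 w / (1 + w)^2]; another
   factor 2 pays for [mu <= 2]. *)
have key : cutoff s <= 8 * (w / ((1 + w) * (1 + mu * w))).
  rewrite mulrA ler_pdivlMr; last by rewrite mulr_gt0 //; lra.
  have le4 : (1 + w) * (1 + mu * w) <= 2 * (1 + w) ^+ 2 by rewrite expr2; nra.
  have c0 := cutoff_ge0 s.
  apply: le_trans (ler_wpM2l c0 le4) _.
  have [w1|w1] := leP w 1.
    have : cutoff s <= w by rewrite /cutoff ge_min lexx.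
    have : (1 + w) ^+ 2 <= 4 by rewrite expr2; nra.
    nra.
  have cw : cutoff s * w <= 1.
    by rewrite -ler_pdivlMr // div1r /cutoff ge_min lexx orbT.
  have : (1 + w) ^+ 2 <= 4 * w ^+ 2 by rewrite !expr2; nra.
  move=> h1; have : cutoff s * (1 + w) ^+ 2 <= cutoff s * (4 * w ^+ 2) by rewrite ler_wpM2l.
  have : cutoff s * w * w <= 1 * w by rewrite ler_wpM2r // ltW.
  rewrite !expr2; nra.
apply: (le_trans key); rewrite [leRHS]mulrA ler_pM2r; last by rewrite divr_gt0 ?mulr_gt0 //; lra.
have -> : 8 = 16 * h%:R / beta * (beta / (2 * h%:R)) :> R.
  by field; rewrite !gt_eqF.
rewrite ler_pM2l; last by rewrite divr_gt0 ?mulr_gt0.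
lra.
Qed.

(** Independent of [t] and of the number of terms, because [sigmoid] stays between 0 and 1. The
    factor [h] reflects the density of the progression, about [h] indices per unit of logarithmic
    scale. *)
Lemma sum_cutoff t m n : 0 < t ->
  \sum_(m <= i < n) cutoff (t * lam ^+ i) <= 16 * h%:R / beta.
Proof.
have hR1 := hR; have hV1 := hV0; have hV2 := hVle1; have /andP[p1 p2] := p12; have be0 := beta0; have be1 := betap; have be2 := betap2.
move=> t0.
have [nm|mn] := leqP n m.
  by rewrite big_geq // divr_ge0 ?mulr_ge0 ?ltW.
apply: le_trans (_ : \sum_(m <= i < n) 16 * h%:R / beta *
   (sigmoid (t * lam ^+ i.+1) - sigmoid (t * lam ^+ i)) <= _).
  apply: ler_sum => i _; rewrite exprS mulrCA; apply: cutoff_le_sigmoid.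
  by rewrite mulr_gt0 // exprn_gt0 // ratio_gt0.
rewrite -mulr_sumr telescope_sumr; last exact: ltnW.
rewrite ler_piMr //; first by rewrite divr_ge0 ?mulr_ge0 ?ltW.
rewrite /sigmoid; set a := (t * lam ^+ n) `^ _; set b := (t * lam ^+ m) `^ _.
have a0 : 0 <= a by apply: powR_ge0.
have b0 : 0 <= b by apply: powR_ge0.
have : 0 <= (1 + a)^-1 by rewrite invr_ge0; lra.
have : (1 + b)^-1 <= 1 by rewrite invf_le1; lra.
lra.
Qed.

(* [kern] is chosen such that
   [lam ^- (i * p) * (1 - cos (t * lam ^ i)) = t ^ p * kern (t * lam ^ i)]. *)
Definition kern s : R := (1 - cos s) * s `^ (- p).

Lemma kern_ge0 s : 0 <= kern s.
Proof. by rewrite mulr_ge0 ?powR_ge0 ?oneBcos_ge0. Qed.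

Let sqr_powRN s : 0 < s -> s ^+ 2 * s `^ (- p) = s `^ (2 - p).
Proof. by move=> s0; rewrite -powR_mulrn ?ltW // -powRD // (gt_eqF s0) implybT. Qed.

Let id_powRN s : 0 < s -> s * s `^ (- p) = s `^ (1 - p).
Proof. by move=> s0; rewrite -{1}[s]powRr1 ?ltW // -powRD // (gt_eqF s0) implybT. Qed.

(** Near 0 the kernel is of order [s^(2 - p)], and [2 - p >= 2 beta]. One power [s^beta] becomes the
    summable [cutoff]; the other makes the sum over all small arguments small. [kern_large] splits
    the decay at infinity in the same way. *)
Lemma kern_small s : 0 < s <= 1 -> kern s <= s `^ beta * cutoff s.
Proof.
have /andP[p1 p2] := p12; have be0 := beta0; have be1 := betap; have be2 := betap2.
move=> /andP[s0 s1]; rewrite cutoff_small ?(ltW s0) //.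
apply: le_trans (_ : s ^+ 2 * s `^ (- p) <= _).
  rewrite ler_wpM2r ?powR_ge0 //; have := oneBcos_le_sqr s; have := sqr_ge0 s; lra.
rewrite sqr_powRN // -powRD; last by rewrite (gt_eqF s0) implybT.
rewrite ger_powR ?s0 //; lra.
Qed.

Lemma kern_large s : 1 <= s -> kern s <= 2 * (s `^ beta)^-1 * cutoff s.
Proof.
have /andP[p1 p2] := p12; have be0 := beta0; have be1 := betap; have be2 := betap2.
move=> s1; have s0 : 0 < s by lra.
rewrite cutoff_large // -mulrA ler_pM ?oneBcos_ge0 ?powR_ge0 ?oneBcos_le2 //.
rewrite -!powRN -powRD; last by rewrite (gt_eqF s0) implybT.
by rewrite ler_powR //; lra.
Qed.

(** Because of the factor [cutoff], the sum of these bounds over the indices is [O(1 / beta)],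
    whereas the kernels sum to at least [h / 64] ([kern_sum_ge]). A shift by a fraction of a step
    thus has relative effect [O(1 / (beta h))]. *)
Lemma kern_lip s rho : 0 < s -> 1 <= rho <= lam ->
  `|kern s - kern (rho * s)| <= 5 / h%:R * cutoff s.
Proof.
have hR1 := hR; have hV1 := hV0; have hV2 := hVle1; have /andP[p1 p2] := p12; have be0 := beta0; have be1 := betap; have be2 := betap2.
move=> s0 /andP[r1 rl]; have r0 : 0 < rho by lra.
rewrite /ratio in rl.
rewrite /kern powRM ?(ltW s0) ?(ltW r0) //.
set x := s `^ (- p); set y := rho `^ (- p).
have x0 : 0 < x by rewrite powR_gt0.
have y1 : y <= 1 by rewrite /y powRN invf_le1 ?powR_gt0 // powR_ge1 //; lra.
have y2 : 1 - 2 * h%:R^-1 <= y.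
  apply: (@le_trans _ _ (rho ^- 2)).
    rewrite -[rho ^- 2]div1r ler_pdivlMr ?exprn_gt0 //.
    apply: (@le_trans _ _ ((1 - 2 * (rho - 1)) * rho ^+ 2)).
      by rewrite ler_wpM2r ?sqr_ge0 //; lra.
    have : 0 <= (rho - 1) ^+ 2 * (2 * rho + 1) by rewrite mulr_ge0 ?sqr_ge0 //; lra.
    rewrite !expr2; nra.
  rewrite /y powRN lef_pV2 ?posrE ?powR_gt0 ?exprn_gt0 //.
  by apply: powR_le_sqr => //; lra.
have y0 : 0 <= y by apply: powR_ge0.
have -> : (1 - cos s) * x - (1 - cos (rho * s)) * (y * x) =
  x * ((1 - y) * (1 - cos s) - y * (cos s - cos (rho * s))) by ring.
rewrite normrM (ger0_norm (ltW x0)).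
have step d : `|cos s - cos (rho * s)| <= d -> `|(1 - y) * (1 - cos s) - y * (cos s - cos (rho * s))| <=
   2 * h%:R^-1 * (1 - cos s) + d.
  move=> hd; apply: le_trans (ler_normB _ _) _; rewrite !normrM.
  rewrite (ger0_norm (oneBcos_ge0 s)) (ger0_norm y0) (ger0_norm (_ : 0 <= 1 - y)); last by lra.
  have := oneBcos_ge0 s; have := normr_ge0 (cos s - cos (rho * s)); nra.
have srs : s <= rho * s by nra.
have [s1|s1] := leP s 1.
  rewrite cutoff_small ?(ltW s0) //.
  have sq : s ^+ 2 * x <= s `^ beta.
    by rewrite sqr_powRN // ger_powR ?s0 //; lra.
  have hd : `|cos s - cos (rho * s)| <= 3 / 2 * h%:R^-1 * s ^+ 2.
    apply: le_trans (cosB_le_sqr (ltW s0) srs) _.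
    have : (rho ^+ 2 - 1) <= 3 * h%:R^-1 by rewrite expr2; nra.
    have := sqr_ge0 s; rewrite exprMn; nra.
  apply: le_trans (ler_wpM2l (ltW x0) (step _ hd)) _.
  have h1 := oneBcos_le_sqr s.
  apply: (@le_trans _ _ (5 / h%:R * (s ^+ 2 * x))); last first.
    by rewrite ler_pM2l // divr_gt0.
  have : 2 * h%:R^-1 * (1 - cos s) <= 2 * h%:R^-1 * (s ^+ 2 / 2) by rewrite ler_wpM2l //; lra.
  have hs := mulr_ge0 (ltW hV1) (sqr_ge0 s) => h2.
  have : 2 * h%:R^-1 * (1 - cos s) + 3 / 2 * h%:R^-1 * s ^+ 2 <= 5 * h%:R^-1 * s ^+ 2 by lra.
  move=> /(ler_wpM2l (ltW x0)); lra.
rewrite cutoff_large ?(ltW s1) //.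
have sq : s * x <= (s `^ beta)^-1.
  by rewrite id_powRN // -powRN ler_powR ?(ltW s1) //; lra.
have hd : `|cos s - cos (rho * s)| <= h%:R^-1 * s.
  apply: le_trans (cos_lip _ _) _; rewrite distrC ger0_norm; nra.
apply: le_trans (ler_wpM2l (ltW x0) (step _ hd)) _.
have h1 := oneBcos_le2 s.
apply: (@le_trans _ _ (5 / h%:R * (s * x))); last first.
  by rewrite ler_pM2l // divr_gt0.
have : 2 * h%:R^-1 * (1 - cos s) <= 2 * h%:R^-1 * (2 * s) by rewrite ler_wpM2l //; lra.
move=> h2; have : 2 * h%:R^-1 * (1 - cos s) + h%:R^-1 * s <= 5 * h%:R^-1 * s by lra.
move=> /(ler_wpM2l (ltW x0)); lra.
Qed.

(* Plays for the lower bound on [kern] the role of [sigmoid] in the upper bound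
   on [cutoff]. *)
Definition clamp s : R := Num.max 2^-1 (Num.min 2 s).

Lemma clamp_le_kern s : 0 < s -> clamp (lam * s) - clamp s <= 64 / h%:R * kern s.
Proof.
have hR1 := hR; have hV1 := hV0; have hV2 := hVle1; have /andP[p1 p2] := p12.
move=> s0; have l1 := ratio_gt1; have l2 := ratio_le2.
have k0 : 0 <= 64 / h%:R * kern s by rewrite mulr_ge0 ?kern_ge0 // divr_ge0.
have [sl|sl] := leP (lam * s) 2^-1.
  rewrite /clamp !(min_idPr _) ?(max_idPl _) ?subrr //; nra.
have [s2|s2] := leP 2 s.
  rewrite /clamp !(min_idPl _) ?subrr //; nra.
have s4 : 1 / 4 <= s by nra.
have d : clamp (lam * s) - clamp s <= 2 / h%:R.
  have : (lam - 1) * s <= 2 / h%:R by rewrite /ratio addrC addKr mulrC ler_pM2r //; lra.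
  by rewrite /clamp !maxEle !minEle; do !case: ifPn; rewrite -?ltNge; lra.
apply: (le_trans d).
suff hk : 1 / 32 <= kern s.
  have -> : 2 / h%:R = 64 / h%:R * (1 / 32) :> R by field; rewrite gt_eqF.
  by rewrite ler_wpM2l // divr_ge0.
apply: le_trans (_ : s ^+ 2 / 8 * s `^ (- p) <= _); last first.
  by rewrite ler_wpM2r ?powR_ge0 // oneBcos_ge8 // !ltW.
have -> : s ^+ 2 / 8 * s `^ (- p) = s `^ (2 - p) / 8.
  by rewrite -(sqr_powRN s0) mulrAC.
suff : 1 / 4 <= s `^ (2 - p) by lra.
apply: le_trans (_ : (1 / 4) `^ (2 - p) <= _).
  by apply: ger1_powR; lra.
by apply: ler_powR2; lra.
Qed.

Definition kern_sum (I : nat) t : R := \sum_(0 <= i < I) kern (t * lam ^+ i).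

Lemma kern_sum_ge I t : 0 < t <= 1 / 2 -> 2 <= t * lam ^+ I ->
  h%:R / 64 <= kern_sum I t.
Proof.
have hR1 := hR; have hV1 := hV0; have hV2 := hVle1.
move=> /andP[t0 t1] tI.
have H : \sum_(0 <= i < I) (clamp (t * lam ^+ i.+1) - clamp (t * lam ^+ i)) <=
    64 / h%:R * kern_sum I t.
  rewrite /kern_sum mulr_sumr; apply: ler_sum => i _; rewrite exprS mulrCA.
  by apply: clamp_le_kern; rewrite mulr_gt0 // exprn_gt0 // ratio_gt0.
move: H; rewrite telescope_sumr // expr0 mulr1.
have -> : clamp (t * lam ^+ I) = 2.
  rewrite /clamp (min_idPl _) // (max_idPr _) //; lra.
have -> : clamp t = 2^-1.
  rewrite /clamp (min_idPr _) ?(max_idPl _) //; lra.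
have -> : 64 / h%:R * kern_sum I t = kern_sum I t / (h%:R / 64) by field; rewrite gt_eqF.
rewrite ler_pdivlMr; last by rewrite divr_gt0.
have : 0 < h%:R / 64 :> R by rewrite divr_gt0.
lra.
Qed.

Lemma ratio_expr_ge n : 1 + n%:R / h%:R <= lam ^+ n.
Proof.
have hR1 := hR; have hV1 := hV0; have hV2 := hVle1.
elim: n => [|n IH]; first by rewrite expr0; lra.
rewrite exprS -natr1; have l0 := ratio_gt0.
have n0 : 0 <= n%:R / h%:R :> R by rewrite divr_ge0.
apply: le_trans (ler_wpM2l (ltW l0) IH).
have -> : lam * (1 + n%:R / h%:R) = 1 + (n%:R + 1) / h%:R + n%:R / h%:R / h%:R.
  by rewrite /ratio; field; rewrite gt_eqF.
by rewrite lerDl divr_ge0.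
Qed.

(** Multiplying [t] by [ratio] shifts the index. With [j] the number of whole steps from [t] to
    [t2], the two sums differ by a fractional step [rho] ([B1]), by [j] terms of small argument
    ([B2]) and by [j] terms of large argument ([B3]). *)
Lemma kern_sum_const I t t2 S : 0 < t -> t <= t2 -> t2 <= 1 / 2 -> 2 <= S -> S <= t * lam ^+ I ->
  `|kern_sum I t - kern_sum I t2| <=
  16 / beta * (5 + h%:R * (t2 `^ beta + 2 * (S `^ beta)^-1)).
Proof.
have hR1 := hR; have hV1 := hV0; have hV2 := hVle1; have /andP[p1 p2] := p12; have be0 := beta0; have be1 := betap; have be2 := betap2.
move=> t0 tt2 t2h S2 SI.
have lamp i : 0 < lam ^+ i by rewrite exprn_gt0 // ratio_gt0.
have ex : exists j, t2 < t * lam ^+ j.+1.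
  exists (Num.bound (t2 / t * h%:R)); rewrite -ltr_pdivrMl // mulrC.
  apply: lt_le_trans (ratio_expr_ge _).
  have := @archi_boundP R (t2 / t * h%:R) ltac:(by rewrite mulr_ge0 // divr_ge0 //; lra).
  set b := Num.bound _ => hb; rewrite -ltr_pdivlMr // in hb.
  apply: lt_trans hb _; rewrite -natr1 mulrDl; lra.
case: (ex_minnP ex) => j jt2 jmin.
have tj : t * lam ^+ j <= t2.
  case: j jt2 jmin => [_ _|j _ jmin]; first by rewrite expr0 mulr1.
  by case: leP => // /jmin; rewrite ltnn.
have jI : (j <= I)%N.
  case: leqP => // /ltnW Ij.
  have : lam ^+ I <= lam ^+ j by rewrite ler_eXn2l // ratio_gt1.
  move=> /(ler_wpM2l (ltW t0)); lra.
pose rho := t2 / (t * lam ^+ j).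
have tlj : 0 < t * lam ^+ j by rewrite mulr_gt0.
have rho1 : 1 <= rho by rewrite /rho ler_pdivlMr // mul1r.
have rhol : rho <= lam.
  by rewrite /rho ler_pdivrMr // mulrCA -exprS ltW.
have r0 : 0 < rho by lra.
pose G i := kern (rho * (t * lam ^+ i)).
have E2 : kern_sum I t2 = \sum_(j <= i < I + j) G i.
  rewrite -{1}[j]add0n big_addn addnK /kern_sum; apply: eq_bigr => i _.
  rewrite /G exprD; congr kern; rewrite /rho; field.
  by rewrite !gt_eqF.
have E3 : \sum_(0 <= i < I) G i + \sum_(I <= i < I + j) G i =
   \sum_(0 <= i < j) G i + kern_sum I t2.
  rewrite E2 -!big_cat_nat //= ?leq_addr //; exact: leq_trans (leq_addr _ _).
have B1 : `|kern_sum I t - \sum_(0 <= i < I) G i| <= 5 / h%:R * (16 * h%:R / beta).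
  rewrite /kern_sum -sumrB; apply: le_trans (ler_norm_sum _ _ _) _.
  apply: le_trans (_ : \sum_(0 <= i < I) 5 / h%:R * cutoff (t * lam ^+ i) <= _).
    by apply: ler_sum => i _; apply: kern_lip; rewrite ?mulr_gt0 // rho1.
  by rewrite -mulr_sumr ler_pM2l ?divr_gt0 // sum_cutoff.
have rt0 : 0 < rho * t by rewrite mulr_gt0.
have t20 : 0 < t2 by lra.
have B2 : \sum_(0 <= i < j) G i <= t2 `^ beta * (16 * h%:R / beta).
  apply: le_trans (_ : \sum_(0 <= i < j) t2 `^ beta * cutoff (rho * t * lam ^+ i) <= _); last first.
    by rewrite -mulr_sumr ler_wpM2l ?powR_ge0 // sum_cutoff.
  rewrite big_nat [leRHS]big_nat; apply: ler_sum => i /andP[_ ij].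
  have it2 : rho * t * lam ^+ i <= t2.
    have : lam ^+ i <= lam ^+ j by rewrite ler_eXn2l ?ratio_gt1 // ltnW.
    move=> /(ler_wpM2l (ltW t0)) /(ler_wpM2l (ltW r0)).
    by rewrite {2}/rho mulfVK ?gt_eqF // mulrA.
  have s0 : 0 < rho * t * lam ^+ i by rewrite mulr_gt0.
  have s01 : 0 < rho * t * lam ^+ i <= 1 by rewrite s0 /=; lra.
  rewrite /G mulrA; apply: (le_trans (kern_small s01)).
  by rewrite ler_wpM2r ?cutoff_ge0 // ler_powR2 // ltW.
have S0 : 0 < S by lra.
have B3 : \sum_(I <= i < I + j) G i <= 2 * (S `^ beta)^-1 * (16 * h%:R / beta).
  apply: le_trans (_ : \sum_(I <= i < I + j) 2 * (S `^ beta)^-1 * cutoff (rho * t * lam ^+ i) <= _); last first.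
    by rewrite -mulr_sumr ler_wpM2l ?mulr_ge0 ?invr_ge0 ?powR_ge0 // sum_cutoff.
  rewrite big_nat [leRHS]big_nat; apply: ler_sum => i /andP[Ii _].
  have iS : S <= rho * t * lam ^+ i.
    have : lam ^+ I <= lam ^+ i by rewrite ler_eXn2l // ratio_gt1.
    move=> /(ler_wpM2l (ltW t0)) hi; rewrite -mulrA.
    have : 0 < t * lam ^+ i by rewrite mulr_gt0.
    nra.
  have s0 : 0 < rho * t * lam ^+ i by rewrite mulr_gt0.
  have s1 : 1 <= rho * t * lam ^+ i by lra.
  rewrite /G mulrA; apply: (le_trans (kern_large s1)).
  rewrite ler_wpM2r ?cutoff_ge0 // ler_pM2l // lef_pV2 ?posrE ?powR_gt0 //.
  by rewrite ler_powR2 // ltW.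
have G0 m n : 0 <= \sum_(m <= i < n) G i by apply: sumr_ge0 => i _; apply: kern_ge0.
have -> : 16 / beta * (5 + h%:R * (t2 `^ beta + 2 * (S `^ beta)^-1)) =
  5 / h%:R * (16 * h%:R / beta) + t2 `^ beta * (16 * h%:R / beta) +
  2 * (S `^ beta)^-1 * (16 * h%:R / beta).
  by field; rewrite !gt_eqF ?powR_gt0.
have := G0 0%N j; have := G0 I (I + j)%N.
move: B1 B2 B3; rewrite !ler_norml => /andP[]; lra.
Qed.
End Fixed.
End LogScaleSum.

(** * Parameters for which the kernel sum is nearly constant on a window *)

Section KernWindow.
Variable R : realType.

Lemma ln2_ge : 2^-1 <= ln 2 :> R.
Proof.
have := @ln_le_subr1 R 2^-1 ltac:(lra); rewrite lnV ?posrE //; lra.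
Qed.

Lemma ln2_le : ln 2 <= 1 :> R.
Proof. have := @ln_le_subr1 R 2 ltac:(lra); lra. Qed.

Lemma kern_parameters (p : R) : 1 < p < 2 -> exists C k, 1 <= C /\
  forall eta T : R, 0 < eta <= 1 / 2 -> 1 <= T ->
  let B := C * ((1 + ln T) / eta) ^+ k in
  exists h I : nat, exists kappa0 tau2 : R,
  [/\ (0 < h)%N /\ (0 < I)%N, 0 < tau2 <= 1 / 2 /\ 1 / 64 <= kappa0,
      forall t, tau2 / T <= t <= tau2 -> `|kern_sum p h I t - kappa0| <= eta * kappa0,
      (I * h)%:R <= B & 64 * I%:R / tau2 ^+ 2 <= B].
Proof.
move=> /andP[p1 p2].
pose beta := Num.min (2 - p) (p - 1) / 2.
have beta0 : 0 < beta by rewrite divr_gt0 // lt_min; apply/andP; split; lra.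
have betap2 : 2 * beta <= 2 - p.
  by rewrite /beta mulrC mulfVK ?pnatr_eq0 // ge_min lexx.
have betap : beta <= p - 1.
  have : 2 * beta <= p - 1 by rewrite /beta mulrC mulfVK ?pnatr_eq0 // ge_min lexx orbT.
  lra.
have beta1 : beta <= 1 / 2 by lra.
clearbody beta.
have [k2 hk2] : exists k2 : nat, 2 / beta <= k2%:R.
  by exists (Num.bound (2 / beta)); apply/ltW/archi_boundP; rewrite divr_ge0 // ltW.
(* [11 = 5 + 6]: in [kern_sum_const] the two tails contribute [h * (3 / D) <= 6]. The factor 64
   offsets the lower bound [h / 64] on [kappa0], so that [D = c3 / eta <= h] yields relative error
   [eta]. *)
have [c3 c3E] : exists c, c = 64 * (16 / beta * 11) by exists (64 * (16 / beta * 11)).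
have c31 : 1 <= c3.
  have : 2 <= beta^-1 by rewrite -(invrK 2) lef_pV2 ?posrE ?invr_gt0 //; lra.
  rewrite c3E; lra.
pose c2 : R := 2 * (1 + 2 / beta * c3).
have bV : 0 < 2 / beta by rewrite divr_gt0.
have c21 : 1 <= c2.
  have : 0 <= 2 / beta * c3 by rewrite mulr_ge0 ?(ltW bV) //; lra.
  rewrite /c2; lra.
exists (64 * (2 * c3) ^+ 2 * c2 * c3 ^+ k2), (k2 + 3)%N.
have X1 : 1 <= c3 ^+ k2 by rewrite exprn_ege1.
have X2 : 1 <= (2 * c3) ^+ 2 by rewrite exprn_ege1 //; lra.
split.
  do 2 rewrite -[leLHS]mulr1; rewrite ler_pM ?mulr1 //.
  rewrite -[leLHS]mulr1 ler_pM //; lra.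
move=> eta T /andP[eta0 eta1] T1.
set z := (1 + ln T) / eta => B.
have lnT : 0 <= ln T by rewrite ln_ge0.
have etaz : eta^-1 <= z by rewrite /z ler_peMl ?invr_ge0 ?(ltW eta0) //; lra.
have Vge : 2 <= eta^-1.
  by rewrite -(invrK 2) lef_pV2 ?posrE ?invr_gt0 //; lra.
have z1 : 1 <= z by lra.
have lnTz : 1 + ln T <= z by rewrite /z ler_peMr //; lra.
pose D := c3 / eta.
have Dz : D <= c3 * z by rewrite /D ler_wpM2l //; lra.
have D2 : 2 <= D.
  have : c3 * 2 <= D by rewrite /D ler_wpM2l //; lra.
  lra.
have [i0 /andP[hD hD2]] := @exists_pow2 R D ltac:(lra).
pose h := (2 ^ i0)%N; have hE : h%:R = 2 ^+ i0 :> R by rewrite natrX.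
rewrite -hE in hD hD2.
have h0 : (0 < h)%N by rewrite expn_gt0.
(* Chosen so that [tau2^beta = 1 / D]; since [h <= 2 D], the tails stay bounded after multiplication
   by [h]. *)
pose tau2 := D `^ (- beta^-1).
have D0 : 0 < D by lra.
have tau0 : 0 < tau2 by rewrite powR_gt0.
have tauV : tau2^-1 = D `^ beta^-1 by rewrite /tau2 powRN invrK.
have tauV2 : 2 <= tau2^-1.
  rewrite tauV; apply: (le_trans D2); apply: le1r_powR; first lra.
  by rewrite invf_ge1 //; lra.
have tau12 : tau2 <= 1 / 2.
  rewrite -[tau2]invrK div1r lef_pV2 ?posrE ?invr_gt0 //.
have taub : tau2 `^ beta = D^-1.
  by rewrite /tau2 -powRrM mulNr mulVf ?gt_eqF // powR_inv1 // ltW.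
have tauVb : (tau2^-1 `^ beta)^-1 = D^-1.
  by rewrite powRV ?(ltW tau0) // invrK taub.
have T0 : 0 < T by lra.
have TT : 1 <= T / tau2 ^+ 2.
  rewrite -[leLHS]mul1r ler_pM // -exprVn exprn_ege1 //; lra.
have TT4 : 2 <= T / tau2 ^+ 2.
  rewrite -[leLHS]mul1r ler_pM // -exprVn; apply: (le_trans tauV2).
  by rewrite expr2 ler_peMr //; lra.
have [i1 /andP[hT hT2]] := exists_pow2 TT.
have i10 : (0 < i1)%N by case: i1 hT {hT2} => //; rewrite expr0; lra.
(* As [ratio ^ h >= 2], these indices cover a factor of at least [2 ^ i1 >= T / tau2^2], which leads
   from [tau2 / T] to [1 / tau2]. *)
pose I := (h * i1)%N.
have TauI t : tau2 / T <= t -> tau2^-1 <= t * ratio R h ^+ I.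
  move=> ht; have t0 : 0 < t by apply: lt_le_trans ht; rewrite divr_gt0 //; lra.
  have r2 : T / tau2 ^+ 2 <= ratio R h ^+ I.
    apply: (le_trans hT); rewrite /I exprM lerXn2r ?nnegrE //.
      by rewrite exprn_ge0 // ltW // ratio_gt0.
    have := ratio_expr_ge R h0 h; rewrite divff ?gt_eqF ?ltr0n //; lra.
  apply: (@le_trans _ _ (tau2 / T * (T / tau2 ^+ 2))).
    rewrite le_eqVlt; apply/orP; left; apply/eqP.
    by field; rewrite !gt_eqF.
  by rewrite ler_pM ?divr_ge0 ?exprn_ge0 ?(ltW tau0) ?(ltW T0).
pose kappa0 := kern_sum p h I tau2.
have p12 : 1 < p < 2 by rewrite p1 p2.
have tauT : tau2 / T <= tau2.
  by rewrite ler_pdivrMr ?ler_peMr //; lra.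
have kh : h%:R / 64 <= kappa0.
  apply: (kern_sum_ge p12 h0); first by rewrite tau0.
  by apply: (le_trans tauV2); apply: TauI.
have h1 : 1 <= h%:R :> R by rewrite ler1n.
have lnD : ln D <= c3 * z by have := ln_le_subr1 D0; lra.
have Tt0 : 0 < T / tau2 ^+ 2 by lra.
have i1z : i1%:R <= c2 * z.
  have : i1%:R * ln 2 <= ln (2 * (T / tau2 ^+ 2)).
    by rewrite mulr_natl -lnXn // ler_ln ?posrE // ?exprn_gt0 ?(mulr_gt0 _ Tt0).
  rewrite lnM ?posrE // ln_div ?posrE ?exprn_gt0 // lnXn // /tau2 ln_powR.
  have lnDb : beta^-1 * ln D <= beta^-1 * (c3 * z) by rewrite ler_wpM2l ?invr_ge0 // ltW.
  have l1 := ln2_le; have l2 := ln2_ge.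
  have : i1%:R * 2^-1 <= i1%:R * ln 2 :> R by rewrite ler_wpM2l.
  rewrite /c2; lra.
clearbody c2 z.
have hz : h%:R <= 2 * c3 * z by move: hD2 Dz; clear; lra.
have z0 : 0 <= z by move: z1; clear; lra.
have c20 : 0 <= c2 by move: c21; clear; lra.
have c30 : 0 <= c3 by move: c31; clear; lra.
have h00 : 0 <= h%:R :> R by [].
have i00 : 0 <= i1%:R :> R by [].
have IE : I%:R = h%:R * i1%:R :> R by rewrite natrM.
exists h, I, kappa0, tau2; split.
- by rewrite h0 muln_gt0 h0.
- by rewrite tau0; split => //; move: kh h1; clear; lra.
- move=> t /andP[t1 t2].
  have t0 : 0 < t by apply: lt_le_trans t1; rewrite divr_gt0 //; lra.
  have := kern_sum_const p12 beta0 betap betap2 h0 t0 t2 tau12 tauV2 (TauI _ t1).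
  move=> /le_trans; apply; rewrite taub tauVb.
  have -> : D^-1 + 2 * D^-1 = 3 * D^-1 by ring.
  have hd : h%:R * (3 * D^-1) <= 6.
    have hD1 : h%:R * D^-1 <= 2 by rewrite ler_pdivrMr.
    by rewrite mulrCA; move: hD1; clear; lra.
  apply: (@le_trans _ _ (eta * (h%:R / 64))); last by rewrite ler_pM2l.
  apply: (@le_trans _ _ (16 / beta * 11)).
    by rewrite ler_pM2l ?divr_gt0 //; move: hd; clear; lra.
  have : eta * D <= eta * h%:R by rewrite ler_pM2l.
  have -> : eta * D = c3 by rewrite /D mulrC mulfVK // gt_eqF.
  by rewrite c3E; clear; lra.
- have hh : h%:R * h%:R <= (2 * c3 * z) * (2 * c3 * z) by rewrite ler_pM.
  apply: (@le_trans _ _ ((2 * c3 * z) * (2 * c3 * z) * (c2 * z))).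
    rewrite natrM IE mulrAC; apply: ler_pM => //; exact: mulr_ge0.
  rewrite /B exprD.
  have -> : 64 * (2 * c3) ^+ 2 * c2 * c3 ^+ k2 * (z ^+ k2 * z ^+ 3) =
     (2 * c3 * z * (2 * c3 * z) * (c2 * z)) * (64 * (c3 ^+ k2 * z ^+ k2)) by ring.
  rewrite ler_peMr //.
    by rewrite !mulr_ge0.
  have zk : 1 <= z ^+ k2 by rewrite exprn_ege1.
  by have := ler_pM ler01 ler01 X1 zk; clear; lra.
- have tau2b : tau2^-1 ^+ 2 <= c3 ^+ k2 * z ^+ k2.
    rewrite -exprMn tauV -powR_mulrn ?powR_ge0 // -powRrM mulrC.
    apply: (@le_trans _ _ (D `^ k2%:R)); first by apply: ler_powR => //; move: D2; clear; lra.
    by rewrite powR_mulrn ?(ltW D0) // lerXn2r // nnegrE ?(ltW D0) // mulr_ge0.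
  apply: (@le_trans _ _ (64 * ((2 * c3 * z) * (c2 * z)) * (c3 ^+ k2 * z ^+ k2))).
    rewrite -exprVn IE; apply: ler_pM => //; rewrite ?mulr_ge0 ?exprn_ge0 ?invr_ge0 ?(ltW tau0) //.
    by rewrite ler_pM2l // ler_pM.
  rewrite /B exprD.
  have -> : 64 * (2 * c3) ^+ 2 * c2 * c3 ^+ k2 * (z ^+ k2 * z ^+ 3) =
    64 * (2 * c3 * z * (c2 * z)) * (c3 ^+ k2 * z ^+ k2) * (2 * c3 * z) by ring.
  rewrite ler_peMr //; first by rewrite !mulr_ge0 ?exprn_ge0.
  by have := ler_pM ler01 ler01 c31 z1; clear; lra.
Qed.

End KernWindow.

(** * The law itself, from the kernel sum for p < 2 and directly for p = 2 *)

Section StableLaw.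
Variable R : realType.

Lemma multiset_seq (I : Type) (W : I -> nat) (l : seq I) :
  exists s : seq (option I), (size s)%:R = \sum_(i <- l) (W i)%:R :> R /\
  forall F : option I -> R, \sum_(x <- s) F x = \sum_(i <- l) (W i)%:R * F (Some i).
Proof.
elim: l => [|i l [s [ss sF]]].
  by exists [::]; rewrite big_nil; split => // F; rewrite !big_nil.
exists (nseq (W i) (Some i) ++ s); split.
  by rewrite size_cat size_nseq natrD big_cons ss.
move=> F; rewrite big_cat big_cons sF big_nseq /=; congr (_ + _).
by rewrite mulr_natl; elim: (W i) => //= n ->; rewrite mulrS.
Qed.

(** The coins are bits, so the weights are truncated to multiples of [1 / 2 ^ b], with [b] so large
    that each loss is at most [eta * q i]. *)
Lemma dyadic_weights (I : finType) (q : I -> R) (eta : R) : 0 < eta ->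
  (forall i, 0 < q i) -> \sum_i q i <= 1 ->
  exists b (f : 'I_(2 ^ b) -> option I) (w : I -> R),
    (forall i, (1 - eta) * q i <= w i <= q i) /\
    forall F : option I -> R, F None = 0 -> Ex (fun u => F (f u)) = \sum_i w i * F (Some i).
Proof.
move=> eta0 q0 q1.
pose x := 1 + \sum_i (eta * q i)^-1.
have xi i : (eta * q i)^-1 <= x.
  rewrite /x (bigD1 i) //= addrCA lerDl addr_ge0 //.
  by apply: sumr_ge0 => j _; rewrite invr_ge0 mulr_ge0 ?(ltW eta0) // ltW.
have x1 : 1 <= x.
  by rewrite /x lerDl; apply: sumr_ge0 => j _; rewrite invr_ge0 mulr_ge0 ?(ltW eta0) // ltW.
have [b /andP[xb _]] := exists_pow2 x1.
have b0 : 0 < 2 ^+ b :> R by rewrite exprn_gt0.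
pose W i := Num.truncn (2 ^+ b * q i).
have Wle i : (W i)%:R <= 2 ^+ b * q i by rewrite truncn_le mulr_ge0 // ltW.
have Wge i : 2 ^+ b * q i <= (W i)%:R + 1.
  by rewrite natr1; apply/ltW/truncnS_gt.
have [s [ss sF]] := multiset_seq W (index_enum I).
have sb : (size s <= 2 ^ b)%N.
  rewrite -(ler_nat R) ss natrX.
  apply: le_trans (_ : \sum_i 2 ^+ b * q i <= _); first exact: ler_sum.
  by rewrite -mulr_sumr ler_piMr // ltW.
(* Positions past the end of [s] fall on the default [None], which thus absorbs the missing mass. *)
exists b, (fun u => nth None s u), (fun i => (W i)%:R / 2 ^+ b); split=> [i|F F0].
  apply/andP; split; last by rewrite ler_pdivrMr // mulrC.
  rewrite ler_pdivlMr //; have := Wge i; have := xi i => h1 h2.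
  have e0 : 0 < eta * q i by rewrite mulr_gt0.
  have : 1 <= 2 ^+ b * (eta * q i) by rewrite -ler_pdivrMr // div1r; lra.
  lra.
rewrite /Ex card_ord natrX.
have -> : \sum_i ((W i)%:R / 2 ^+ b) * F (Some i) = (\sum_(x <- s) F x) / 2 ^+ b.
  by rewrite sF mulr_suml; apply: eq_bigr => i _; rewrite mulrAC.
congr (_ / _); rewrite (big_nth None) -(big_mkord xpredT (fun u => F (nth None s u))).
rewrite (big_cat_nat _ sb) //= [X in _ + X]big1_seq ?addr0 // => u.
by rewrite mem_index_iota => /andP[_ /andP[su _]]; rewrite nth_default.
Qed.

(** One [B] bounds the moment relative to [kappa], the logarithm of the range and the inverse scale,
    because a polynomial bound on each is all that the cost requires. The window is given by its
    upper end [t2], which belongs to the law, and the prescribed ratio [T]. *)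
Record stable_law (p eta T B : R) (U : finType) (xi : U -> int) (kappa t2 : R) : Prop :=
  StableLaw {
  sl_card : exists b, #|U| = (2 ^ b)%N;
  sl_kappa : 0 < kappa;
  sl_t2 : 0 < t2;
  sl_mean : Ex (fun u => (xi u)%:~R) = 0 :> R;
  sl_sin : forall t : R, Ex (fun u => sin (t * (xi u)%:~R)) = 0;
  sl_cos : forall t : R, t2 / T <= t <= t2 ->
    `|Ex (fun u => 1 - cos (t * (xi u)%:~R)) - kappa * t `^ p| <= eta * (kappa * t `^ p);
  sl_mom : Ex (fun u => `|(xi u)%:~R| `^ p) <= kappa * B;
  sl_bnd : forall u, `|(xi u)%:~R| <= expR B;
  sl_scale : 1 / (kappa * t2 `^ p) <= B }.

Lemma Ex_sign (T : finType) (g : T -> bool -> R) :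
  Ex (fun u : T * bool => g u.1 u.2) = Ex (fun x => (g x true + g x false) / 2).
Proof.
by rewrite Ex_pair; apply: eq_Ex => x; rewrite /Ex big_bool card_bool.
Qed.

Lemma stable_law_lt2 (p : R) : 1 < p < 2 -> exists C k, 1 <= C /\
  forall eta T : R, 0 < eta <= 1 -> 1 <= T ->
  exists (U : finType) (xi : U -> int) (kappa t2 : R),
    stable_law p eta T (C * ((1 + ln T) / eta) ^+ k) xi kappa t2.
Proof.
move=> p12; have /andP[p1 p2] := p12.
have [C [k [C1 H]]] := kern_parameters p12.
exists (C * 2 ^+ k), k; split; first by rewrite -[leLHS]mulr1 ler_pM // exprn_ege1 //; lra.
move=> eta T /andP[eta0 eta1] T1.
(* Half of [eta] is spent on the kernel sum, half on the truncation of the weights. *)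
have [h [I [kappa0 [tau2 []]]]] := H (eta / 2) T ltac:(lra) T1.
have -> : C * ((1 + ln T) / (eta / 2)) ^+ k = C * 2 ^+ k * ((1 + ln T) / eta) ^+ k.
  rewrite -mulrA -exprMn; congr (_ * _ ^+ _); field; rewrite gt_eqF //.
set B := C * 2 ^+ k * _.
move=> [h0 I0] [/andP[tau0 tau12] k64] ker IhB IB.
have hR : 0 < h%:R :> R by rewrite ltr0n.
have IR : 0 < I%:R :> R by rewrite ltr0n.
have lam0 := ratio_gt0 R h0; have lam1 := ratio_gt1 R h0.
pose A : R := h%:R ^+ I; have A0 : 0 < A by rewrite exprn_gt0.
pose a (i : 'I_I) : nat := (h.+1 ^ i * h ^ (I - i))%N.
have aE i : (a i)%:R = A * ratio R h ^+ i.
  have -> : A = h%:R ^+ i * h%:R ^+ (I - i) by rewrite -exprD subnKC // ltnW.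
  rewrite /a natrM !natrX mulrAC; congr (_ * _).
  by rewrite -exprMn /ratio mulrDr mulr1 divff ?gt_eqF // -natr1.
pose q (i : 'I_I) : R := (ratio R h ^+ i) `^ (- p) / I%:R.
have lampos (i : nat) : 0 < ratio R h ^+ i by rewrite exprn_gt0.
have q0 i : 0 < q i by rewrite divr_gt0 // powR_gt0.
have q1 : \sum_i q i <= 1.
  apply: le_trans (_ : \sum_(i < I) I%:R^-1 <= _).
    apply: ler_sum => i _; rewrite /q ler_piMl ?invr_ge0 ?(ltW IR) //.
    rewrite powRN invf_le1 ?powR_gt0 // powR_ge1 //; first lra.
    by rewrite exprn_ege1 // ltW.
  rewrite sumr_const card_ord -[_ *+ _]mulr_natr mulVf // gt_eqF //.
have [b [f [w [wq fE]]]] := @dyadic_weights _ q (eta / 2) ltac:(lra) q0 q1.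
pose mag (x : option 'I_I) : nat := if x is Some i then a i else 0%N.
(* The extra bit is an independent sign; it annihilates odd functions, hence the mean and all sine
   averages. *)
pose xi (u : 'I_(2 ^ b) * bool) : int := (-1) ^+ u.2 * (mag (f u.1))%:Z.
have xiE u : (xi u)%:~R = (-1) ^+ u.2 * (mag (f u.1))%:R :> R.
  by rewrite /xi rmorphM rmorphXn /= rmorphN1 -pmulrn.
have odd0 (g : R -> R) : (forall x, g (- x) = - g x) -> Ex (fun u => g (xi u)%:~R) = 0.
  move=> go; under eq_Ex do rewrite xiE.
  rewrite (Ex_sign (fun u s => g ((-1) ^+ s * (mag (f u))%:R))) (@eq_Ex _ _ _ (fun=> 0)) ?Ex0 //.
  by move=> x; rewrite expr1 expr0 mulN1r mul1r go addNr mul0r.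
have evenE (g : R -> R) : (forall x, g (- x) = g x) -> g 0 = 0 ->
   Ex (fun u => g (xi u)%:~R) = \sum_i w i * g (a i)%:R.
  move=> ge g0; under eq_Ex do rewrite xiE.
  rewrite (Ex_sign (fun u s => g ((-1) ^+ s * (mag (f u))%:R))).
  rewrite -(fE (fun x => g (mag x)%:R)) //; apply: eq_Ex => x.
  by rewrite expr1 expr0 mulN1r mul1r ge; field.
have w0 i : 0 <= w i.
  have /andP[h1 _] := wq i; apply: le_trans h1; rewrite mulr_ge0 ?(ltW (q0 i)) //; lra.
exists ('I_(2 ^ b) * bool)%type, xi, (kappa0 * A `^ p / I%:R), (tau2 / A).
have Ap : 0 < A `^ p by rewrite powR_gt0.
have k0 : 0 < kappa0 by lra.
have kap0 : 0 < kappa0 * A `^ p / I%:R by rewrite divr_gt0 // mulr_gt0.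
have kt2 : kappa0 * A `^ p / I%:R * (tau2 / A) `^ p = kappa0 * tau2 `^ p / I%:R.
  rewrite powRM ?invr_ge0 ?(ltW A0) ?(ltW tau0) // powRV ?(ltW A0) //.
  by field; rewrite !gt_eqF.
have I64 : 64 * I%:R <= B.
  apply: le_trans IB; rewrite ler_pdivlMr ?exprn_gt0 // ler_piMr ?mulr_ge0 // expr2; nra.
split => //.
- by exists b.+1; rewrite card_prod card_ord card_bool expnSr.
- by rewrite divr_gt0.
- by apply: (odd0 id).
- by move=> t; apply: (odd0 (fun x => sin (t * x))) => x; rewrite mulrN sinN.
- move=> t /andP[t1 t3].
  have t0 : 0 < t by apply: lt_le_trans t1; rewrite !divr_gt0 //; lra.
  rewrite (evenE (fun x => 1 - cos (t * x))); last 2 first.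
  + by move=> x; rewrite mulrN cosN.
  + by rewrite mulr0 cos0 subrr.
  pose tau := t * A.
  have tau00 : 0 < tau by rewrite mulr_gt0.
  have tauR : tau2 / T <= tau <= tau2.
    apply/andP; split; last by rewrite /tau -ler_pdivlMr.
    by rewrite /tau -ler_pdivrMr // mulrAC.
  have taup : 0 < tau `^ p by rewrite powR_gt0.
  have tE : kappa0 * A `^ p / I%:R * t `^ p = kappa0 * (tau `^ p / I%:R).
    by rewrite /tau powRM ?(ltW t0) ?(ltW A0) //; ring.
  have gE : \sum_i q i * (1 - cos (t * (a i)%:R)) = kern_sum p h I tau * (tau `^ p / I%:R).
    rewrite /kern_sum big_mkord mulr_suml; apply: eq_bigr => i _.
    rewrite aE mulrA -/tau /kern /q (powRM (- p)) ?(ltW tau00) ?(ltW (lampos _)) //.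
    have -> : tau `^ (- p) = (tau `^ p)^-1 by rewrite powRN.
    by field; rewrite !gt_eqF.
  set S := \sum_i _ in gE; set S' := \sum_i _.
  have SS : S' <= S.
    by apply: ler_sum => i _; rewrite ler_wpM2r ?oneBcos_ge0 //; case/andP: (wq i).
  have SS' : (1 - eta / 2) * S <= S'.
    rewrite /S mulr_sumr; apply: ler_sum => i _.
    by rewrite mulrA ler_wpM2r ?oneBcos_ge0 //; case/andP: (wq i).
  have := ker _ tauR; rewrite tE ler_norml => /andP[k1 k2].
  set m := tau `^ p / I%:R in gE *.
  have m0 : 0 <= m by rewrite divr_ge0 ?(ltW taup) // ltW.
  have km : 0 <= kappa0 * m by rewrite mulr_ge0 // ltW.
  have S1 : S <= (1 + eta / 2) * (kappa0 * m) by rewrite gE mulrA ler_wpM2r //; lra.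
  have S2 : (1 - eta / 2) * (kappa0 * m) <= S by rewrite gE mulrA ler_wpM2r //; lra.
  have S3 : (1 - eta / 2) * ((1 - eta / 2) * (kappa0 * m)) <= (1 - eta / 2) * S.
    by rewrite ler_wpM2l //; lra.
  have S4 : 0 <= eta ^+ 2 * (kappa0 * m) by rewrite mulr_ge0 ?sqr_ge0.
  have S5 : 0 <= eta * (kappa0 * m) by rewrite mulr_ge0 // ltW.
  rewrite expr2 in S4.
  by rewrite ler_norml; apply/andP; split; lra.
- rewrite (evenE (fun x => `|x| `^ p)); last 2 first.
  + by move=> x; rewrite normrN.
  + by rewrite normr0 powR0 //; lra.
  apply: (@le_trans _ _ (A `^ p)).
    apply: le_trans (_ : \sum_(i < I) A `^ p / I%:R <= _).
      apply: ler_sum => i _; have /andP[_ wi] := wq i.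
      rewrite ger0_norm // aE powRM ?(ltW A0) ?(ltW (lampos _)) //.
      apply: le_trans (ler_wpM2r _ wi) _; first by rewrite mulr_ge0 ?powR_ge0.
      rewrite /q powRN le_eqVlt; apply/orP; left; apply/eqP.
      by field; rewrite !gt_eqF // powR_gt0.
    by rewrite sumr_const card_ord -[_ *+ _]mulr_natr mulfVK // gt_eqF.
  have -> : kappa0 * A `^ p / I%:R * B = A `^ p * (kappa0 * B / I%:R) by ring.
  rewrite ler_peMr ?(ltW Ap) // ler_pdivlMr // mul1r.
  apply: (@le_trans _ _ (1 / 64 * B)); first lra.
  by rewrite ler_wpM2r //; lra.
- move=> u; rewrite xiE normrM normrX normrN1 expr1n mul1r ger0_norm //.
  case: (f u.1) => [i|] /=; last exact: expR_ge0.
  apply: (@le_trans _ _ ((h.+1 ^ I)%:R)).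
    have -> : (h.+1 ^ I = h.+1 ^ i * h.+1 ^ (I - i))%N by rewrite -expnD subnKC // ltnW.
    rewrite ler_nat /a leq_mul2l leq_exp2r ?subn_gt0 //.
    by rewrite leqnSn orbT.
  apply: (@le_trans _ _ (expR (I * h)%:R)); last by rewrite ler_expR.
  rewrite natrM expRM_natl natrX lerXn2r ?nnegrE ?expR_ge0 //.
  by rewrite -natr1 addrC expR_ge1Dx.
- apply: le_trans IB; rewrite kt2 div1r invf_div ler_pdivrMr ?mulr_gt0 ?powR_gt0 //.
  rewrite mulrAC ler_pdivlMr ?exprn_gt0 // mulrAC.
  have tp : tau2 ^+ 2 <= tau2 `^ p by apply: sqr_le_powR; lra.
  have h3 : 1 * (tau2 ^+ 2) <= (64 * kappa0) * (tau2 `^ p) by apply: ler_pM; rewrite ?sqr_ge0 //; lra.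
  have := ler_wpM2l (ltW IR) h3; lra.
Qed.

(** At [p = 2] the kernel does not decay at 0, but no heavy tail is needed either: for a random
    sign, [1 - cos t] lies between [(1 - t^2 / 4) t^2 / 2] and [t^2 / 2]. *)
Lemma stable_law_2 : exists C k, 1 <= C /\
  forall eta T : R, 0 < eta <= 1 -> 1 <= T ->
  exists (U : finType) (xi : U -> int) (kappa t2 : R),
    stable_law 2 eta T (C * ((1 + ln T) / eta) ^+ k) xi kappa t2.
Proof.
exists 2, 2%N; split; first lra.
move=> eta T /andP[eta0 eta1] T1.
set z := (1 + ln T) / eta.
have lnT : 0 <= ln T by rewrite ln_ge0.
have etaz : eta^-1 <= z by rewrite /z ler_peMl ?invr_ge0 ?(ltW eta0) //; lra.
have eV : 1 <= eta^-1 by rewrite invf_ge1.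
have z1 : 1 <= z by lra.
clearbody z.
have ez : (eta^-1) ^+ 2 <= z ^+ 2 by rewrite lerXn2r ?nnegrE //; lra.
have zz : 1 <= z ^+ 2 by rewrite exprn_ege1.
exists bool, (fun s : bool => (-1) ^+ s), 2^-1, eta.
have odd0 (g : R -> R) : (forall x, g (- x) = - g x) -> Ex (fun s : bool => g ((-1) ^+ s : int)%:~R) = 0.
  by move=> go; rewrite /Ex big_bool /= expr1 expr0 rmorphN1 rmorph1 go addNr mul0r.
have evenE (g : R -> R) : (forall x, g (- x) = g x) -> Ex (fun s : bool => g ((-1) ^+ s : int)%:~R) = g 1.
  by move=> ge; rewrite /Ex big_bool /= expr1 expr0 rmorphN1 rmorph1 ge card_bool; field.
have T0 : 0 < T by lra.
split; rewrite ?invr_gt0 //.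
- by exists 1%N; rewrite card_bool.
- by apply: (odd0 id).
- by move=> t; apply: (odd0 (fun x => sin (t * x))) => x; rewrite mulrN sinN.
- move=> t /andP[t1 t3].
  have t0 : 0 < t by apply: lt_le_trans t1; rewrite divr_gt0.
  rewrite (evenE (fun x => 1 - cos (t * x))); last by move=> x; rewrite mulrN cosN.
  rewrite mulr1 powR_mulrn ?(ltW t0) // mulrC.
  have u1 := oneBcos_le_sqr t.
  have u2 := @oneBcos_ge R t ltac:(lra).
  have tt : t ^+ 2 <= eta by rewrite expr2; nra.
  have := sqr_ge0 t => t20.
  rewrite ler_norml; apply/andP; split; last by nra.
  nra.
- rewrite (evenE (fun x => `|x| `^ 2)); last by move=> x; rewrite normrN.
  rewrite normr1 powR1; lra.
- move=> s; rewrite rmorphXn /= rmorphN1 normrX normrN1 expr1n.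
  have := expR_ge1Dx (2 * z ^+ 2); lra.
- rewrite powR_mulrn ?(ltW eta0) // div1r invfM invrK -exprVn; lra.
Qed.

Lemma stable_law_exists (p : R) : 1 < p <= 2 -> exists C k, 1 <= C /\
  forall eta T : R, 0 < eta <= 1 -> 1 <= T ->
  exists (U : finType) (xi : U -> int) (kappa t2 : R),
    stable_law p eta T (C * ((1 + ln T) / eta) ^+ k) xi kappa t2.
Proof.
move=> /andP[p1 p2]; have [->|pn2] := eqVneq p 2; first exact: stable_law_2.
by apply: stable_law_lt2; rewrite p1 lt_neqAle pn2.
Qed.
End StableLaw.

(** * Rounding and aggregation along a tree *)

Section Rounding.
Implicit Types (G s g : nat) (y : int).

(** The subtraction is truncated: if [|y| < 2 ^ s.+1] the cell is 0, and such a [y] is not changed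
    by rounding. *)
Definition cell s y : nat := trunc_log 2 `|y| - s.

(* Randomised rounding of [y] to a multiple of [2 ^ cell s y]; [u] is uniform,
   and the remainder [r] is rounded up with probability [r / 2 ^ cell s y]. *)
Definition dyround G s (u : 'I_(2 ^ G)) y : int :=
  let g := cell s y in
  (2 ^ g)%:Z * ((y %/ (2 ^ g)%:Z)%Z +
     (u < `|(y %% (2 ^ g)%:Z)%Z| * 2 ^ (G - g))%N%:Z).

Lemma abs_lt_trunc_log y : (`|y| < 2 ^ (trunc_log 2 `|y|).+1)%N.
Proof. exact: trunc_log_ltn. Qed.

Lemma cell_le G s y : (`|y| <= 2 ^ G)%N -> (cell s y <= G)%N.
Proof.
move=> yG; apply: leq_trans (leq_subr _ _) _.
have [->|y0] := eqVneq `|y|%N 0%N; first by rewrite trunc_log0.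
rewrite -(@leq_exp2l 2) //; apply: leq_trans (trunc_logP _ _) yG => //.
by rewrite lt0n.
Qed.

Lemma sum_ord_ltn n c : (c <= n)%N -> (\sum_(u < n) (u < c)%N = c)%N.
Proof.
move=> cn; rewrite -(big_mkord xpredT (fun u => (u < c)%N : nat)) (big_cat_nat _ cn) //=.
rewrite [X in (_ + X)%N]big1_seq ?addn0 => [|u]; last first.
  by rewrite mem_index_iota => /andP[_ /andP[cu _]]; rewrite ltnNge cu.
rewrite big_nat (eq_bigr (fun=> 1%N)) => [|u /andP[_ ->] //].
by rewrite -big_nat sum_nat_const_nat muln1 subn0.
Qed.

(** Exactly [r * 2 ^ (G - g)] of the [2 ^ G] coins round up, so one coin range gives exact
    unbiasedness for every [g <= G]. *)
Lemma dyround_unbiased G s y : (cell s y <= G)%N ->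
  \sum_(u < 2 ^ G) (dyround s u y - y) = 0.
Proof.
move=> gG; rewrite sumrB sumr_const card_ord /dyround.
set g := cell s y in gG *; set q : int := (2 ^ g)%:Z.
have q0 : q != 0 by rewrite eqz_nat expn_eq0.
have qp : 0 < q by rewrite lt0r q0.
set r := (y %% q)%Z; have r0 : 0 <= r by rewrite modz_ge0.
have rq : (`|r| < 2 ^ g)%N.
  by rewrite -ltz_nat gez0_abs // ltz_pmod.
rewrite -mulr_sumr big_split sumr_const card_ord /=.
have -> : \sum_(u < 2 ^ G) (u < `|r| * 2 ^ (G - g))%N%:Z =
    (\sum_(u < 2 ^ G) (u < `|r| * 2 ^ (G - g))%N : nat)%:Z.
  by rewrite -(big_morph Posz PoszD (erefl _)).
have E : (2 ^ G = 2 ^ g * 2 ^ (G - g))%N by rewrite -expnD subnKC.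
rewrite sum_ord_ltn; last by rewrite [leqRHS]E leq_mul2r (ltnW rq) orbT.
have nat (x : int) n : x *+ n = x * n%:Z by rewrite -mulr_natr natz.
have EG : (2 ^ G)%:Z = q * (2 ^ (G - g))%:Z by rewrite E PoszM.
rewrite !nat EG PoszM gez0_abs // [X in _ - X * _ = _](divz_eq y q) -/r.
ring.
Qed.

Lemma dyround_error G s (u : 'I_(2 ^ G)) y : (2 ^ s * `|(dyround s u y - y)%R| <= `|y|)%N.
Proof.
rewrite /dyround; set g := cell s y; set q : int := (2 ^ g)%:Z.
have q0 : q != 0 by rewrite eqz_nat expn_eq0.
have qp : 0 < q by rewrite lt0r q0.
set r := (y %% q)%Z; have r0 : 0 <= r by rewrite modz_ge0.
have rq : r < q by rewrite ltz_pmod.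
set b : nat := (u < _)%N.
have -> : q * ((y %/ q)%Z + b%:Z) - y = q * b%:Z - r.
  by rewrite [in X in _ - X](divz_eq y q) -/r; ring.
have [g0|gp] := posnP g.
  have r00 : r = 0.
    apply/eqP; rewrite eq_le r0 andbT; move: rq; rewrite /q g0 expn0; lia.
  have -> : b = 0%N by rewrite /b r00 mul0n.
  by rewrite r00 mulr0 subrr muln0.
have eg : (2 ^ s * 2 ^ g <= `|y|)%N.
  have y0 : (0 < `|y|)%N.
    by rewrite lt0n; apply: contraTneq gp => e; rewrite /g /cell e trunc_log0.
  rewrite -expnD; apply: leq_trans (trunc_logP (isT : 1 < 2)%N y0).
  by rewrite leq_exp2l // subnKC // ltnW // -subn_gt0.
apply: leq_trans eg; rewrite leq_mul2l; apply/orP; right.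
by rewrite /b; case: (u < _)%N; move: rq r0; rewrite /q; lia.
Qed.

Lemma dyround_le G s (u : 'I_(2 ^ G)) y : (`|dyround s u y| <= 2 * `|y|)%N.
Proof.
have := dyround_error s u y.
have : (`|(dyround s u y - y)%R| <= 2 ^ s * `|(dyround s u y - y)%R|)%N.
  by rewrite leq_pmull // expn_gt0.
lia.
Qed.

(** The offset [2 ^ s.+1] makes the stored mantissa nonnegative. Rounding up can reach [2 ^ s.+1]
    itself, so both ends of the symmetric range are included. *)
Definition decode_float G s (c : 'I_G.+1 * 'I_(2 ^ s.+2).+1) : int :=
  (2 ^ c.1)%:Z * (c.2%:Z - (2 ^ s.+1)%:Z).

Lemma dyround_float G s (u : 'I_(2 ^ G)) y : (cell s y <= G)%N ->
  exists c : 'I_G.+1 * 'I_(2 ^ s.+2).+1, decode_float c = dyround s u y.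
Proof.
move=> gG; rewrite /dyround; set g := cell s y in gG *; set q : int := (2 ^ g)%:Z.
set b : nat := (u < _)%N; set a := (y %/ q)%Z.
have q0 : q != 0 by rewrite eqz_nat expn_eq0.
have qp : 0 < q by rewrite lt0r q0.
have yb : (`|y| < 2 ^ g * 2 ^ s.+1)%N.
  apply: leq_trans (abs_lt_trunc_log y) _; rewrite -expnD leq_exp2l // addnS ltnS.
  by rewrite /g /cell; lia.
have ye := divz_eq y q; rewrite -/a in ye.
have r0 : 0 <= (y %% q)%Z by rewrite modz_ge0.
have rq : (y %% q)%Z < q by rewrite ltz_pmod.
have S0 : (0 : int) < (2 ^ s.+1)%:Z by rewrite ltz_nat expn_gt0.
have ub : y < q * (2 ^ s.+1)%:Z by rewrite /q -PoszM; lia.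
have lb : - (q * (2 ^ s.+1)%:Z) < y by rewrite /q -PoszM; lia.
have a1 : a < (2 ^ s.+1)%:Z by nia.
have a2 : - (2 ^ s.+1)%:Z <= a by nia.
have b1 : (b <= 1)%N by rewrite /b; case: (u < _)%N.
have cb : (`|(a + b%:Z + (2 ^ s.+1)%:Z)%R| < (2 ^ s.+2).+1)%N.
  by rewrite ltnS (expnS _ s.+1); lia.
have gb : (g < G.+1)%N by [].
exists (Ordinal gb, Ordinal cb); rewrite /decode_float /=.
by congr (_ * _); lia.
Qed.
End Rounding.

(** * Sums along a rooted tree with rounding at every vertex *)

Section Tree.
Variables (V : finType) (o : V) (par : V -> V) (dep : V -> nat) (D : nat).
Hypotheses (par_root : par o = o)
  (dep_par : forall v, v != o -> (dep (par v) < dep v)%N)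
  (depD : forall v, (dep v <= D)%N).

Definition child (u v : V) : bool := (u != o) && (par u == v).

Lemma dep_child u v : child u v -> (dep v < dep u)%N.
Proof. by move=> /andP[uo /eqP <-]; apply: dep_par. Qed.

Lemma dep_fconnect u v : fconnect par u v -> (dep v <= dep u)%N.
Proof.
move=> /iter_findex <-; elim: (findex _ _ _) => // k IH.
rewrite iterS; apply: leq_trans IH; set w := iter _ _ _.
by have [->|/dep_par/ltnW //] := eqVneq w o; rewrite par_root.
Qed.

Lemma fconnect_par u v : fconnect par u v = (u == v) || fconnect par (par u) v.
Proof.
apply/idP/orP => [uv|[/eqP ->|]]; last 2 first.
- exact: connect0.
- exact: connect_trans (fconnect1 _ _).
have := iter_findex uv; case: (findex _ _ _) => [/= ->|k]; first by left.
by rewrite iterSr => <-; right; apply: fconnect_iter.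
Qed.

Lemma fconnect_root v : fconnect par o v = (o == v).
Proof.
apply/idP/eqP => [/iter_findex <-|->]; last exact: connect0.
by elim: (findex _ _ _) => //= k <-.
Qed.

Lemma root_fconnect u : fconnect par u o.
Proof.
have [n] := ubnP (dep u); elim: n u => // n IH u; rewrite ltnS => un.
have [->|uo] := eqVneq u o; first exact: connect0.
rewrite fconnect_par IH ?orbT //; exact: leq_trans (dep_par uo) un.
Qed.

Lemma fconnect_strict u v :
  (u != o) && fconnect par (par u) v = fconnect par u v && (u != v).
Proof.
have [->|uo] /= := eqVneq u o; first by rewrite fconnect_root andbN.
rewrite [fconnect par u v]fconnect_par; have [<-|] /= := eqVneq u v; last by rewrite andbT.
by apply/negbTE/negP => /dep_fconnect; rewrite leqNgt dep_par.
Qed.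

Lemma card_ancestors u : (#|[set v | fconnect par u v]| <= D.+1)%N.
Proof.
apply: (@leq_trans (dep u).+1); last by rewrite ltnS.
have [n] := ubnP (dep u); elim: n u => // n IH u; rewrite ltnS => un.
have [->|uo] := eqVneq u o.
  rewrite (_ : [set v | _] = [set o]) ?cards1 //.
  by apply/setP => v; rewrite !inE fconnect_root eq_sym.
have h := dep_par uo.
have -> : [set v | fconnect par u v] = u |: [set v | fconnect par (par u) v].
  by apply/setP => v; rewrite !inE fconnect_par eq_sym.
rewrite cardsU1; apply: (@leq_add _ _ 1 (dep u)); first by case: (_ \notin _).
apply: leq_trans (h); apply: IH; exact: leq_trans h un.
Qed.

Section Aggregate.
Variables (own : V -> int) (rnd : V -> int -> int).

(** Fuel replaces recursion on the tree: below [v] there are at most [D - dep v] further levels, so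
    [D.+1] always suffices ([agg_fuel_stable]). *)
Fixpoint agg_fuel (f : nat) (v : V) : int :=
  if f is f'.+1 then own v + \sum_(u | child u v) rnd u (agg_fuel f' u) else 0.

Definition agg (v : V) : int := agg_fuel D.+1 v.

Lemma agg_fuel_stable f f' v : (D - dep v < f)%N -> (D - dep v < f')%N ->
  agg_fuel f v = agg_fuel f' v.
Proof.
elim: f f' v => [//|f IH] [//|f'] v h h' /=; congr (_ + _).
apply: eq_bigr => u /dep_child uv; congr rnd; have uD := depD u.
by apply: IH; lia.
Qed.

Lemma aggE v : agg v = own v + \sum_(u | child u v) rnd u (agg u).
Proof.
rewrite {1}/agg /=; congr (_ + _); apply: eq_bigr => u /dep_child uv; congr rnd.
by apply: agg_fuel_stable; have := depD u; lia.
Qed.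

(** Sum [aggE] over the subtree of [v]: every strict descendant contributes its rounded value
    exactly once, at its parent, so unrounded values cancel up to the rounding errors. *)
Lemma agg_unroll v : agg v = \sum_(u | fconnect par u v) own u +
  \sum_(u | fconnect par u v && (u != v)) (rnd u (agg u) - agg u).
Proof.
have E : \sum_(u | fconnect par u v) agg u = \sum_(u | fconnect par u v) own u +
    \sum_(u | fconnect par u v && (u != v)) rnd u (agg u).
  rewrite (eq_bigr _ (fun u _ => aggE u)) big_split /=; congr (_ + _).
  rewrite [RHS](partition_big par (fun u => fconnect par u v)) /=; last first.
    by move=> u; rewrite -fconnect_strict => /andP[].
  apply: eq_bigr => u uv; apply: eq_bigl => w; rewrite -fconnect_strict /child.
  by have [->|] := eqVneq (par w) u; rewrite ?andbF // uv !andbT.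
rewrite (bigD1 v) ?connect0 //= in E.
rewrite sumrB addrA; apply/eqP; rewrite eq_sym subr_eq eq_sym; apply/eqP.
exact: E.
Qed.

Lemma agg_bound B : (forall v, `|own v| <= B)%N ->
  (forall u y, `|rnd u y| <= 2 * `|y|)%N ->
  forall v, (`|agg v| <= (2 * #|V|).+1 ^ D.+1 * B)%N.
Proof.
move=> hown hrnd v; rewrite /agg; elim: D.+1 v => [|f IH] v //=.
have absD (x y : int) : (`|(x + y)%R| <= `|x| + `|y|)%N by lia.
apply: leq_trans (absD _ _) _.
have S : (`|(\sum_(u | child u v) rnd u (agg_fuel f u))%R| <=
    \sum_(u : V) 2 * ((2 * #|V|).+1 ^ f * B))%N.
  rewrite big_mkcond /=.
  elim/big_ind2: _ => [//|x1 x2 y1 y2 h1 h2|u _].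
    by apply: leq_trans (absD _ _) _; apply: leq_add.
  case: ifP => // _; apply: leq_trans (hrnd _ _) _; by rewrite leq_mul2l IH.
apply: leq_trans (leq_add (hown v) S) _.
have {S}-> : (\sum_(u : V) 2 * ((2 * #|V|).+1 ^ f * B) = #|V| * (2 * ((2 * #|V|).+1 ^ f * B)))%N.
  exact: sum_nat_const.
rewrite expnS; have P0 : (0 < (2 * #|V|).+1 ^ f)%N by rewrite expn_gt0.
move: ((2 * #|V|).+1 ^ f)%N P0 #|V| => P P0 m.
have : (B <= P * B)%N by rewrite leq_pmull.
nia.
Qed.
End Aggregate.

Section RandomRounding.
Variables (R : realType) (G s : nat).
Implicit Types (w : {ffun V -> 'I_(2 ^ G)}).

Definition rounded_agg (own : V -> int) w : V -> int :=
  agg own (fun u => dyround s (w u)).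

(** A coin acts only after its vertex has formed its sum, hence only on strictly shallower vertices.
    This is what [von_Bahr_Esseen] asks for, with the depth as rank. *)
Lemma rounded_agg_resample own w j c v : (dep j <= dep v)%N ->
  rounded_agg own (resample w j c) v = rounded_agg own w v.
Proof.
rewrite /rounded_agg /agg; elim: D.+1 v => [//|f IH] v jv /=; congr (_ + _).
apply: eq_bigr => u /dep_child uv; rewrite IH; last by lia.
by rewrite resample_neq //; apply: contraTneq uv => ->; rewrite -leqNgt.
Qed.

(** The errors are relative to the rounded sums, so the estimate is closed on itself: the total of
    [Q] is at most 4 times that of [|Y|^p] plus [24 * D.+1 / 2 ^ s] times itself, and
    [48 * D.+1 <= 2 ^ s] makes the last factor at most 1/2. *)
Lemma rounding_error (p : R) (own : V -> int) B :
  1 <= p <= 2 -> (forall v, `|own v| <= B)%N ->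
  ((2 * #|V|).+1 ^ D.+1 * B <= 2 ^ G)%N -> (48 * D.+1 <= 2 ^ s)%N ->
  Ex (fun w => `|(rounded_agg own w o - \sum_v own v)%:~R| `^ p) <=
  48 / 2 ^+ s * \sum_v `|(\sum_(u | fconnect par u v) own u)%:~R : R| `^ p.
Proof.
move=> p12 hown hG hs; have /andP[p1 p2] := p12.
have p0 : 0 <= p by lra.
have U0 : (0 < #|'I_(2 ^ G)|)%N by rewrite card_ord expn_gt0.
pose h u w : R := (dyround s (w u) (rounded_agg own w u) - rounded_agg own w u)%:~R.
pose Y v : R := (\sum_(u | fconnect par u v) own u)%:~R.
have unroll w v : (rounded_agg own w v)%:~R =
    Y v + \sum_(u in [set u | fconnect par u v && (u != v)]) h u w.
  rewrite {1}/rounded_agg agg_unroll rmorphD /=; congr (_ + _).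
  rewrite raddf_sum /=; apply: eq_bigl => u; by rewrite inE.
have le w v : (`|rounded_agg own w v| <= 2 ^ G)%N.
  apply: leq_trans hG; apply: agg_bound => // u y; exact: dyround_le.
have h0 j w : Ex (fun c => h j (resample w j c)) = 0.
  rewrite /h; under eq_Ex do rewrite resample_eq rounded_agg_resample //.
  rewrite /Ex -raddf_sum /= dyround_unbiased ?mulr0z ?mul0r //.
  exact: cell_le.
have hi i j w c : j != i -> (dep j <= dep i)%N -> h i (resample w j c) = h i w.
  by move=> ji jd; rewrite /h rounded_agg_resample // resample_neq // eq_sym.
have s0 : 0 < 2 ^+ s :> R by rewrite exprn_gt0.
have s1 : 1 <= 2 ^+ s :> R by rewrite exprn_ege1 //; lra.
have herr u w : `|h u w| `^ p <= (2 ^+ s)^-1 * `|(rounded_agg own w u)%:~R| `^ p.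
  have : `|h u w| <= (2 ^+ s)^-1 * `|(rounded_agg own w u)%:~R|.
    have -> : (2 ^+ s)^-1 = ((2 ^ s)%N%:Z%:~R)^-1 :> R by rewrite -pmulrn natrX.
    rewrite ler_pdivlMl ?ltr0z ?ltz_nat ?expn_gt0 // /h -!intr_norm -intrM ler_int.
    by have := dyround_error s (w u) (rounded_agg own w u); lia.
  move=> /(ler_powR2 p0 (normr_ge0 _)) /le_trans; apply.
  rewrite powRM ?invr_ge0 ?(ltW s0) // ler_wpM2r ?powR_ge0 //.
  by rewrite ge1r_powR ?invr_gt0 ?s0 //= invf_le1.
pose Q v := Ex (fun w => `|(rounded_agg own w v)%:~R| `^ p).
have Q0 v : 0 <= Q v by apply: Ex_ge0 => w; apply: powR_ge0.
have err v : Ex (fun w => `|\sum_(u in [set u | fconnect par u v && (u != v)]) h u w| `^ p) <=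
    6 / 2 ^+ s * \sum_(u | fconnect par u v) Q u.
  apply: le_trans (von_Bahr_Esseen _ U0 p12 h0 hi) _.
  rewrite -mulrA ler_pM2l // mulr_sumr big_mkcond [leRHS]big_mkcond /=.
  apply: ler_sum => u _; rewrite inE; case: ifP => [/andP[-> _]|_]; last first.
    by case: ifP => // _; rewrite mulr_ge0 ?invr_ge0 // ltW.
  by rewrite -ExZ; apply: ler_Ex => w; apply: herr.
have sumQ : \sum_v Q v <= 8 * \sum_v `|Y v| `^ p.
  have : \sum_v Q v <= \sum_v (4 * `|Y v| `^ p + 4 * (6 / 2 ^+ s * \sum_(u | fconnect par u v) Q u)).
    apply: ler_sum => v _.
    apply: le_trans (_ : Ex (fun w => 4 * `|Y v| `^ p +
       4 * `|\sum_(u in [set u | fconnect par u v && (u != v)]) h u w| `^ p) <= _).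
      by apply: ler_Ex => w; rewrite unroll norm_powRD_le4.
    rewrite ExD Ex_cst ?card_ffun ?expn_gt0 ?U0 // lerD2l ExZ ler_pM2l //.
  rewrite big_split /= -!mulr_sumr.
  have : \sum_v \sum_(u | fconnect par u v) Q u <= D.+1%:R * \sum_v Q v.
    rewrite (exchange_big_dep xpredT) //= mulr_sumr; apply: ler_sum => u _.
    rewrite sumr_const -[_ *+ _]mulr_natl ler_wpM2r // ler_nat.
    by apply: leq_trans (card_ancestors u); rewrite cardsE.
  have : D.+1%:R * 48 <= 2 ^+ s :> R by rewrite -natrX -natrM ler_nat mulnC.
  set S := \sum_v \sum_(u | _) _; set T := \sum_v Q v; set A := \sum_v _ `^ p.
  have T0 : 0 <= T by apply: sumr_ge0.
  move=> hD hS.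
  have : 6 / 2 ^+ s * S <= 1 / 8 * T.
    rewrite mulrAC ler_pdivrMr //.
    have := ler_wpM2r T0 hD; lra.
  lra.
have -> : 48 / 2 ^+ s * \sum_v `|Y v| `^ p = 6 / 2 ^+ s * (8 * \sum_v `|Y v| `^ p).
  by field; rewrite gt_eqF.
have s6 : 0 < 6 / 2 ^+ s :> R by rewrite divr_gt0.
apply: le_trans (_ : 6 / 2 ^+ s * \sum_(u | fconnect par u o) Q u <= _); last first.
  rewrite ler_pM2l //; apply: le_trans sumQ.
  by rewrite le_eqVlt; apply/orP; left; apply/eqP/eq_bigl => u /=; exact: root_fconnect.
apply: le_trans (err o); apply: ler_Ex => w.
have -> : \sum_v own v = \sum_(u | fconnect par u o) own u.
  by apply: eq_bigl => u; rewrite root_fconnect.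
by rewrite rmorphB /= unroll addrC addKr.
Qed.

(** A subtree sum [x] is at most the total [S], so [x^p <= S^(p - 1) x], which is linear in the
    entries; every vertex is counted once per ancestor, at most [D.+1] times. *)
Lemma sum_subtree_moment (n : nat) (p : R) (X : V -> 'I_n -> R) : 1 <= p ->
  (forall v j, 0 <= X v j) ->
  \sum_v \sum_j (\sum_(u | fconnect par u v) X u j) `^ p <=
  D.+1%:R * \sum_j (\sum_u X u j) `^ p.
Proof.
move=> p1 X0; rewrite exchange_big /= mulr_sumr; apply: ler_sum => j _.
set S := \sum_u X u j.
have S0 : 0 <= S by apply: sumr_ge0.
have sub v : 0 <= \sum_(u | fconnect par u v) X u j <= S.
  rewrite sumr_ge0 //= /S [leRHS](bigID (fun u => fconnect par u v)) /= lerDl.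
  by apply: sumr_ge0.
apply: le_trans (_ : \sum_v S `^ (p - 1) * \sum_(u | fconnect par u v) X u j <= _).
  apply: ler_sum => v _; have /andP[h0 h1] := sub v.
  by rewrite powR_x1 // mulrC ler_wpM2r // ler_powR2 //; lra.
rewrite -mulr_sumr (exchange_big_dep xpredT) //=.
apply: le_trans (_ : S `^ (p - 1) * (D.+1%:R * S) <= _); last first.
  by rewrite (powR_x1 p1) // mulrCA (mulrC S).
rewrite ler_wpM2l ?powR_ge0 // mulr_sumr; apply: ler_sum => u _.
rewrite sumr_const -[_ *+ _]mulr_natl ler_wpM2r // ler_nat.
by apply: leq_trans (card_ancestors u); rewrite cardsE.
Qed.
End RandomRounding.
End Tree.

(** * Spanning trees and the tree protocol *)

Section SpanningTree.
Variables (V : finType) (e : rel V) (o : V).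
Hypothesis conn : connected_graph e.

Lemma exists_walk u v : exists2 k, (k < #|V|)%N & walk e k u v.
Proof.
have [_ _ /(_ u v)/connectP[p pp vE]] := conn.
case/shortenP: pp vE => q pq uq _ vE; exists (size q).
  by have := max_card (mem (u :: q)); rewrite (card_uniqP uq).
by apply/existsP; exists (in_tuple q); rewrite pq vE eqxx.
Qed.

Lemma dist_le k u v : (k < #|V|)%N -> walk e k u v -> (dist e u v <= k)%N.
Proof.
move=> kV wk; rewrite leqNgt; apply/negP => /(before_find 0%N).
by rewrite nth_iota // add0n wk.
Qed.

Lemma walk_dist u v : walk e (dist e u v) u v.
Proof.
have [k kV wk] := exists_walk u v.
have h : has (fun k => walk e k u v) (iota 0 #|V|).
  by apply/hasP; exists k => //; rewrite mem_iota.
have := nth_find 0%N h; rewrite nth_iota //.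
by move: h; rewrite has_find size_iota.
Qed.

Lemma dist_lt_card u v : (dist e u v < #|V|)%N.
Proof. by have [k kV /(dist_le kV)] := exists_walk u v; move=> /leq_ltn_trans; apply. Qed.

Definition depth (v : V) : nat := dist e v o.

Definition parent (v : V) : V :=
  if v == o then o else odflt o [pick w | e v w && (depth w < depth v)%N].

Lemma depth_le v : (depth v <= diameter e)%N.
Proof.
apply: leq_trans (leq_bigmax v); exact: (leq_bigmax (F := dist e v) o).
Qed.

Lemma parent_spec v : v != o -> e v (parent v) /\ (depth (parent v) < depth v)%N.
Proof.
move=> vo; rewrite /parent (negbTE vo); case: pickP => [w /andP[] //|H].
have := walk_dist v o; have := dist_lt_card v o.
rewrite -/(depth v) => kV /existsP[t]; case: t => s /= sk pl.
case dv: (depth v) s sk pl kV => [|k] [|w s] //= sk.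
  by move=> /eqP ls; rewrite ls eqxx in vo.
move=> /andP[ps /eqP ls] kV.
have /negP[] := negbT (H w); move: ps => /andP[-> ps] /=.
rewrite dv ltnS; apply: dist_le; first exact: ltnW.
by apply/existsP; exists (@Tuple _ _ s sk); rewrite /= ps ls eqxx.
Qed.
End SpanningTree.

(** * Bit-level execution of one upward pass along the tree *)

Section TreeProtocol.
Variables (R : Type) (V : finType) (e : rel V) (n M : nat) (o : V).
Variables (par : V -> V) (dep : V -> nat) (D : nat).
Hypotheses (par_spec : forall v, v != o -> e v (par v) /\ (dep (par v) < dep v)%N)
  (depD : forall v, (dep v <= D)%N).
Variables (k : nat) (T : Type) (coin : k.-tuple bool -> T).
Variables (Msg : finType) (m0 : Msg) (L : nat).
Hypothesis MsgL : (#|Msg| <= 2 ^ L)%N.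
Variables (send : T -> V -> input n M -> (V -> Msg) -> Msg)
  (answer : T -> input n M -> (V -> Msg) -> R).

Definition bits_of (c : Msg) : seq bool :=
  enum_val (cast_ord (esym (card_tuple L bool))
    (widen_ord (leq_trans MsgL (eq_leq (f_equal (expn^~ L) (esym card_bool)))) (enum_rank c))).

Definition msg_of (s : seq bool) : Msg := odflt m0 [pick c | bits_of c == s].

Lemma size_bits_of c : size (bits_of c) = L.
Proof. by rewrite size_tuple. Qed.

Lemma bits_ofK : cancel bits_of msg_of.
Proof.
move=> c; rewrite /msg_of; case: pickP => [d /eqP|/(_ c)]; last by rewrite eqxx.
by move=> /val_inj/enum_val_inj/cast_ord_inj/(f_equal val)/= /val_inj/enum_rank_inj.
Qed.

(** Rounds come in blocks of [L], one per depth, the deepest first. A vertex thus speaks after all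
    its children have finished, at times known to everybody. *)
Definition start (u : V) : nat := (D - dep u) * L.

Definition tree_protocol : protocol R V n M := {|
  coins := k;
  rounds := D.+1 * L;
  speaks := fun t _ u v _ _ => child o par u v && (start u <= t < start u + L)%N;
  bit := fun t r u x recv _ _ =>
    nth false (bits_of (send (coin r) u x (fun w => msg_of (recv w)))) (t - start u);
  decide := fun r x recv _ => answer (coin r) x (fun w => msg_of (recv w)) |}.

Variables (r : k.-tuple bool) (X : V -> input n M) (msg : V -> Msg).

(** Nothing arrives from a vertex that is not a child; [msg_of [::]] is what the decoder makes of
    that silence. *)
Definition received (v w : V) : Msg := if child o par w v then msg w else msg_of [::].

Hypothesis msgE : forall u, msg u = send (coin r) u (X u) (received u).

Let dep_lt u v : child o par u v -> (dep v < dep u)%N.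
Proof. by move=> /andP[/par_spec[_ h] /eqP <-]. Qed.

(** The invariant behind all facts about the run: [u] sends successive bits of one fixed message,
    because the strings of its children are already complete when its block begins. *)
Lemma run_tree_prefix t (u v : V) :
  iteri t (step e (P := tree_protocol) r X) (fun _ _ => [::]) u v =
  if child o par u v then take (t - start u) (bits_of (msg u)) else [::].
Proof.
elim: t u v => [|t IH] u v; first by case: ifP => // _; rewrite take0.
rewrite iteriS {1}/step /=; case: ifP => [/and3P[euv cuv /andP[t1 t2]]|].
  rewrite cuv IH cuv subSn // (take_nth false) ?size_bits_of; last by rewrite ltn_subLR.
  congr rcons; congr nth; congr bits_of.
  rewrite [in RHS]msgE; congr send; apply: boolp.funext => w; rewrite IH /received.
  case: ifP => // cwu; rewrite take_oversize ?bits_ofK // size_bits_of.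
  suff : (start w + L <= start u)%N by lia.
  rewrite /start -mulSnr leq_mul2r; apply/orP; right.
  by have := dep_lt cwu; have := depD w; lia.
rewrite IH; case: ifP => // cuv.
have -> : e u v by have /andP[/par_spec[h _] /eqP <-] := cuv.
move=> /= h; have [t1|t1] := leqP (start u) t.
  by rewrite !take_oversize ?size_bits_of //; move: h; rewrite t1 /=; lia.
by congr take; lia.
Qed.

Lemma run_tree (u v : V) : run e tree_protocol r X u v =
  if child o par u v then bits_of (msg u) else [::].
Proof.
rewrite /run run_tree_prefix; case: ifP => // _.
rewrite take_oversize // size_bits_of /= /start.
have : ((D - dep u) * L <= D * L)%N by rewrite leq_mul2r leq_subr orbT.
rewrite mulSn; lia.
Qed.

Lemma output_tree : output e tree_protocol r X o = answer (coin r) (X o) (received o).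
Proof.
rewrite /output /=; congr answer; apply: boolp.funext => w.
by rewrite run_tree /received; case: ifP => // _; rewrite bits_ofK.
Qed.

Lemma total_comm_tree : (total_comm e tree_protocol r X <= #|V| * L)%N.
Proof.
rewrite /total_comm -sum_nat_const; apply: leq_sum => u _.
rewrite (bigD1 (par u)) //= big1 ?addn0 => [|v vu].
  by rewrite run_tree; case: ifP => // _; rewrite size_bits_of.
by rewrite run_tree /child (eq_sym (par u)) (negbTE vu) andbF.
Qed.

Lemma max_comm_tree : (max_comm e tree_protocol r X <= L)%N.
Proof.
apply/bigmax_leqP => u _; apply/bigmax_leqP => v _; rewrite !run_tree.
case: ifP => [cuv|_]; case: ifP => [cvu|_]; rewrite ?size_bits_of ?addn0 //.
by have := ltn_trans (dep_lt cuv) (dep_lt cvu); rewrite ltnn.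
Qed.
End TreeProtocol.

(** * The noisy sketch *)

Section Sketch.
Variables (R : realType) (p eta T B : R) (U : finType) (xi : U -> int) (kappa t2 : R).
Hypotheses (p12 : 1 <= p <= 2) (eta01 : 0 < eta <= 1 / 2).
Hypothesis law : stable_law p eta T B xi kappa t2.
Variables (n N : nat).

(** Each coordinate gets [N] independent copies of the law, as [(1 - a)^N] is close to
    [exp (- N a)]. *)
Definition sketch (x : 'I_n -> R) (w : {ffun 'I_n * 'I_N -> U}) : R :=
  \sum_c x c.1 * (xi (w c))%:~R.

Lemma law_card_gt0 : (0 < #|U|)%N.
Proof. by have [b ->] := sl_card law; rewrite expn_gt0. Qed.

(** Each term depends on its own coin alone, so [von_Bahr_Esseen] applies with a constant rank. *)
Lemma sketch_moment x : (forall j, 0 <= x j) ->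
  Ex (fun w => `|sketch x w| `^ p) <= 6 * (N%:R * (kappa * B) * \sum_j x j `^ p).
Proof.
move=> x0.
pose h (c : 'I_n * 'I_N) (w : {ffun 'I_n * 'I_N -> U}) : R := x c.1 * (xi (w c))%:~R.
have h0 c w : Ex (fun u => h c (resample w c u)) = 0.
  under eq_Ex do rewrite /h resample_eq.
  by rewrite ExZ (sl_mean law) mulr0.
have hi i j w u : j != i -> (0 <= 0)%N -> h i (resample w j u) = h i w.
  by move=> ji _; rewrite /h resample_neq // eq_sym.
have := @von_Bahr_Esseen R _ _ p (fun=> 0%N) h setT law_card_gt0 p12 h0 hi.
rewrite (@eq_Ex _ _ _ (fun w => `|sketch x w| `^ p)); last first.
  by move=> w; congr (`| _ | `^ _); apply: eq_bigl => c; rewrite inE.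
move=> /le_trans; apply; rewrite ler_pM2l //.
apply: (@le_trans _ _ (\sum_(c : 'I_n * 'I_N) x c.1 `^ p * (kappa * B))).
  rewrite (eq_bigl xpredT) => [|c]; last by rewrite inE.
  apply: ler_sum => c _.
  apply: (@le_trans _ _ (x c.1 `^ p * Ex (fun u => `|(xi u)%:~R| `^ p))); last first.
    by rewrite ler_wpM2l ?powR_ge0 // (sl_mom law).
  rewrite (Ex_resample c) ?law_card_gt0 // le_eqVlt; apply/orP; left; apply/eqP.
  transitivity (Ex (fun _ : {ffun 'I_n * 'I_N -> U} => x c.1 `^ p * Ex (fun u => `|(xi u)%:~R| `^ p))).
    apply: eq_Ex => w; rewrite -ExZ; apply: eq_Ex => u.
    by rewrite /h resample_eq normrM (ger0_norm (x0 _)) powRM.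
  by rewrite Ex_cst // card_ffun expn_gt0 law_card_gt0.
rewrite -(pair_bigA _ (fun j (_ : 'I_N) => x j `^ p * (kappa * B))) /= mulr_sumr.
apply: ler_sum => j _; rewrite sumr_const card_ord -[_ *+ _]mulr_natl.
by rewrite le_eqVlt; apply/orP; left; apply/eqP; ring.
Qed.

(** The mean is the product of the [(1 - a j)^N], with [a j] within a factor [1 +- eta] of [b j].
    From [Lambda <= 2] and [4 / eta <= N] come [b j <= eta / 2] and [a j <= eta], so the
    second-order term of the logarithm is again a relative error [O(eta)]. Zero coordinates lie
    outside the window but contribute nothing. *)
Lemma sketch_cos x theta : 4 / eta <= N%:R -> 0 <= theta ->
  (forall j, x j = 0 \/ t2 / T <= theta * x j <= t2) -> (forall j, 0 <= x j) ->
  let Lambda := N%:R * kappa * theta `^ p * \sum_j x j `^ p in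
  Lambda <= 2 ->
  `|Ex (fun w => cos (theta * sketch x w)) - expR (- Lambda)| <= 4 * eta * Lambda /\
  Ex (fun w => 1 - cos (theta * sketch x w)) <= 3 * Lambda.
Proof.
have /andP[e0 e1] := eta01; have /andP[p1 p2] := p12.
move=> hN th0 hx x0 Lambda L2.
have k0 := sl_kappa law.
have U0 := law_card_gt0.
have N0 : 0 < N%:R :> R by apply: lt_le_trans hN; rewrite divr_gt0.
pose a j := Ex (fun u => 1 - cos (theta * x j * (xi u)%:~R)).
pose b j := kappa * (theta * x j) `^ p.
have b0 j : 0 <= b j by rewrite mulr_ge0 ?powR_ge0 // ltW.
have a0 j : 0 <= a j by apply: Ex_ge0 => u; apply: oneBcos_ge0.
have ab j : `|a j - b j| <= eta * b j.
  case: (hx j) => [xj|]; last by move=> /(sl_cos law).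
  rewrite /a /b xj mulr0 powR0; last by lra.
  rewrite mulr0 mulr0 subr0 (@eq_Ex _ _ _ (fun=> 0)) ?Ex0 ?normr0 // => u.
  by rewrite mul0r cos0 subrr.
have bL : N%:R * \sum_j b j = Lambda.
  rewrite /Lambda !mulr_sumr; apply: eq_bigr => j _.
  by rewrite /b powRM //; ring.
have L0 : 0 <= Lambda by rewrite -bL mulr_ge0 // sumr_ge0.
have bj j : N%:R * b j <= 2.
  apply: le_trans L2; rewrite -bL ler_pM2l // (bigD1 j) //= lerDl sumr_ge0 //.
have aj j : a j <= eta.
  have := ab j; rewrite ler_norml => /andP[_ h].
  have b4 : b j * 4 <= 2 * eta.
    have := bj j; rewrite ler_pdivrMr // in hN => hb.
    have := ler_wpM2l (b0 j) hN; nra.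
  have := b0 j; nra.
have E : Ex (fun w => cos (theta * sketch x w)) = \prod_j (1 - a j) ^+ N.
  transitivity (\prod_(c : 'I_n * 'I_N) Ex (fun u => cos (theta * x c.1 * (xi u)%:~R))).
    rewrite -Ex_cos_sum //; last by move=> c; apply: (sl_sin law).
    by apply: eq_Ex => w; rewrite mulr_sumr; congr cos; apply: eq_bigr => c _; rewrite mulrA.
  rewrite -(pair_bigA _ (fun j (_ : 'I_N) => Ex (fun u => cos (theta * x j * (xi u)%:~R)))) /=.
  apply: eq_bigr => j _; rewrite prodr_const card_ord; congr (_ ^+ _).
  by rewrite /a ExB Ex_cst // opprB addrC subrK.
have up : \prod_j (1 - a j) ^+ N <= expR (- ((1 - eta) * Lambda)).
  apply: le_trans (_ : \prod_j expR (- (N%:R * a j)) <= _).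
    apply: ler_prod => j _; rewrite exprn_ge0 ?subr_ge0 ?(le_trans (aj j)) //=; last by lra.
    rewrite -(mulrN N%:R) expRM_natl lerXn2r ?nnegrE ?expR_ge0 ?expR_ge1Dx //.
    by rewrite subr_ge0 (le_trans (aj j)) //; lra.
  rewrite -expR_sum ler_expR sumrN lerN2 -mulr_sumr -bL mulrCA ler_pM2l //.
  rewrite mulr_sumr; apply: ler_sum => j _.
  by have := ab j; rewrite ler_norml => /andP[]; lra.
have lo : expR (- ((1 + 4 * eta) * Lambda)) <= \prod_j (1 - a j) ^+ N.
  apply: (@le_trans _ _ (\prod_j expR (- (N%:R * (a j + 2 * a j ^+ 2))))).
    rewrite -expR_sum ler_expR sumrN lerN2 -mulr_sumr -bL mulrCA ler_pM2l //.
    rewrite mulr_sumr; apply: ler_sum => j _.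
    have := ab j; rewrite ler_norml => /andP[_ h].
    have h1 : a j + 2 * a j ^+ 2 <= a j * (1 + 2 * eta).
      have := aj j; have := a0 j; rewrite expr2; nra.
    apply: (le_trans h1).
    have h2 : a j * (1 + 2 * eta) <= (1 + eta) * b j * (1 + 2 * eta).
      by rewrite ler_wpM2r //; lra.
    apply: (le_trans h2); rewrite mulrAC ler_wpM2r //; nra.
  apply: ler_prod => j _; rewrite expR_ge0 /=.
  rewrite -(mulrN N%:R) expRM_natl lerXn2r ?nnegrE ?expR_ge0 //.
    by rewrite subr_ge0 (le_trans (aj j)) //; lra.
  by apply: oneB_ge_expR; rewrite a0 (le_trans (aj j)).
have eL : 0 <= eta * Lambda by rewrite mulr_ge0 // ltW.
split.
  have lip1 := @expR_lip R ((1 - eta) * Lambda) Lambda ltac:(rewrite mulr_ge0 //; lra) L0.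
  have lip2 := @expR_lip R Lambda ((1 + 4 * eta) * Lambda) L0 ltac:(rewrite mulr_ge0 //; lra).
  rewrite E ler_norml; apply/andP; split.
    have := le_trans (ler_norm _) lip2; rewrite ler0_norm; last by lra.
    lra.
  have := le_trans (ler_norm _) lip1; rewrite ler0_norm; last by lra.
  lra.
rewrite ExB Ex_cst ?card_ffun ?expn_gt0 ?U0 // E.
have := expR_ge1Dx (- ((1 + 4 * eta) * Lambda)).
have : eta * Lambda <= 1 / 2 * Lambda by rewrite ler_wpM2r.
lra.
Qed.
End Sketch.

(** * The sketch after rounding along the tree *)

Section NoisySketch.
Variables (R : realType) (p eps T B : R) (U : finType) (xi : U -> int) (kappa t2 : R).
Hypotheses (p12 : 1 <= p <= 2) (eps01 : 0 < eps <= 1).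
Hypothesis law : stable_law p (eps / 16) T B xi kappa t2.
Variables (V : finType) (o : V) (par : V -> V) (dep : V -> nat) (D : nat).
Hypotheses (par_root : par o = o)
  (dep_par : forall v, v != o -> (dep (par v) < dep v)%N)
  (depD : forall v, (dep v <= D)%N).
Variables (n N M G s W : nat).
Hypothesis hN : 4 / (eps / 16) <= N%:R.
Hypothesis hW : forall u, (`|xi u| <= W)%N.
Hypothesis hG : ((2 * #|V|).+1 ^ D.+1 * (n * N * (M * W)) <= 2 ^ G)%N.
Hypothesis hs : (48 * D.+1 <= 2 ^ s)%N.
Hypothesis hsB : 32 * (288 * (B * D.+1%:R)) <= eps ^+ 2 * 2 ^+ s.

Definition sample : finType := ({ffun 'I_n * 'I_N -> U} * {ffun V -> 'I_(2 ^ G)})%type.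

Definition local_sketch (w : sample) (x : input n M) : int :=
  \sum_(c : 'I_n * 'I_N) (x c.1)%:Z * xi (w.1 c).

Definition noisy_sketch (X : V -> input n M) (w : sample) : int :=
  rounded_agg o par D s (fun v => local_sketch w (X v)) w.2 o.

Definition total (X : V -> input n M) (j : 'I_n) : nat := (\sum_v X v j)%N.

Definition scale_ok (theta : R) (X : V -> input n M) :=
  forall j, total X j = 0%N \/ t2 / T <= theta * (total X j)%:R <= t2.

Lemma local_sketch_le w x : (`|local_sketch w x| <= n * N * (M * W))%N.
Proof.
have H : (`|local_sketch w x| <= \sum_(c : 'I_n * 'I_N) M * W)%N.
  rewrite /local_sketch; elim/big_ind2: _ => [|x1 x2 y1 y2 h1 h2|c _].
  - by [].
  - by apply: leq_trans (leq_add h1 h2); clear; lia.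
  rewrite abszM; apply: leq_mul; last exact: hW.
  by rewrite absz_nat -ltnS ltn_ord.
by move: H; rewrite sum_nat_const card_prod !card_ord.
Qed.

Lemma sum_local_sketch (P : pred V) (X : V -> input n M) w :
  (\sum_(v | P v) local_sketch w (X v))%:~R =
  sketch xi (fun j => \sum_(v | P v) (X v j)%:R) w.1 :> R.
Proof.
rewrite /sketch /local_sketch exchange_big.
rewrite (big_morph (fun z : int => z%:~R : R) (fun x y => intrD R x y) (erefl : 0%:~R = 0)).
apply: eq_bigr => c _.
rewrite -mulr_suml intrM; congr (_ * _).
by rewrite (big_morph (fun z : int => z%:~R : R) (fun x y => intrD R x y) (erefl : 0%:~R = 0)).
Qed.

Lemma noisy_sketch_card : (0 < #|sample|)%N.
Proof. by rewrite card_prod !card_ffun muln_gt0 !expn_gt0 (law_card_gt0 law) card_ord expn_gt0. Qed.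

(** [288 = 48 * 6], from [rounding_error] and from [sketch_moment] for every subtree; [D.+1] comes
    from [sum_subtree_moment]. *)
Lemma noisy_sketch_error (X : V -> input n M) :
  Ex (fun w : sample => `|(noisy_sketch X w)%:~R - sketch xi (fun j => (total X j)%:R) w.1| `^ p) <=
  288 * B * D.+1%:R / 2 ^+ s * (N%:R * kappa * \sum_j (total X j)%:R `^ p).
Proof.
have /andP[p1 p2] := p12; have s0 : 0 < 2 ^+ s :> R by rewrite exprn_gt0.
rewrite Ex_pair.
apply: (@le_trans _ _ (Ex (fun a : {ffun 'I_n * 'I_N -> U} => 48 / 2 ^+ s *
    \sum_v `|sketch xi (fun j => \sum_(u | fconnect par u v) (X u j)%:R) a| `^ p))).
  apply: ler_Ex => a; pose own (v : V) := \sum_(c : 'I_n * 'I_N) (X v c.1)%:Z * xi (a c).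
  pose w0 : {ffun V -> 'I_(2 ^ G)} := [ffun=> Ordinal (expn_gt0 2 G : 0 < 2 ^ G)%N].
  have hown v : (`|own v| <= n * N * (M * W))%N by exact: (local_sketch_le (a, w0) (X v)).
  have := rounding_error par_root dep_par depD p12 hown hG hs.
  have -> : \sum_v `|(\sum_(u | fconnect par u v) own u)%:~R : R| `^ p =
     \sum_v `|sketch xi (fun j => \sum_(u | fconnect par u v) (X u j)%:R) a| `^ p.
    apply: eq_bigr => v _; congr (`| _ | `^ _).
    exact: (sum_local_sketch (fun u => fconnect par u v) X (a, w0)).
  apply: le_trans; apply: ler_Ex => w.
  rewrite /noisy_sketch /= rmorphB /= -/(own) (sum_local_sketch xpredT X (a, w0)) /=.
  rewrite /sketch; under [X in _ - X]eq_bigr do rewrite /total natr_sum.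
  exact: lexx.
rewrite ExZ Ex_sum.
have C0 : 0 <= 6 * (N%:R * (kappa * B)).
  have : 0 <= kappa * B by apply: le_trans (sl_mom law); apply: Ex_ge0 => u; apply: powR_ge0.
  by move=> h; rewrite mulr_ge0 // mulr_ge0.
apply: (@le_trans _ _ (48 / 2 ^+ s * (6 * (N%:R * (kappa * B)) *
    (D.+1%:R * \sum_j (total X j)%:R `^ p)))); last first.
  by rewrite le_eqVlt; apply/orP; left; apply/eqP; field; rewrite gt_eqF.
rewrite ler_pM2l ?divr_gt0 //.
apply: (@le_trans _ _ (\sum_v 6 * (N%:R * (kappa * B)) * \sum_j (\sum_(u | fconnect par u v) (X u j)%:R) `^ p)).
  apply: ler_sum => v _; rewrite -mulrA; apply: (sketch_moment p12 law).
  by move=> j; apply: sumr_ge0.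
rewrite -mulr_sumr ler_wpM2l //.
have := @sum_subtree_moment V o par dep D par_root dep_par depD R n p (fun u j => (X u j)%:R) p1 (fun _ _ => ler0n _ _).
move=> /le_trans; apply; rewrite ler_wpM2l //.
apply: ler_sum => j _; rewrite /total natr_sum; exact: lexx.
Qed.

Lemma noisy_sketch_cos (X : V -> input n M) theta : 0 <= theta -> scale_ok theta X ->
  let Lambda := N%:R * kappa * theta `^ p * \sum_j (total X j)%:R `^ p in
  Lambda <= 2 ->
  `|Ex (fun w => cos (theta * (noisy_sketch X w)%:~R)) - expR (- Lambda)| <= eps /\
  Ex (fun w => 1 - cos (theta * (noisy_sketch X w)%:~R)) <= 8 * Lambda.
Proof.
have /andP[p1 p2] := p12; have /andP[e0 e1] := eps01.
move=> th0 ok Lambda L2; have s0 : 0 < 2 ^+ s :> R by rewrite exprn_gt0.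
have k0 := sl_kappa law.
pose x j : R := (total X j)%:R.
have L0 : 0 <= Lambda.
  rewrite !mulr_ge0 ?powR_ge0 ?(ltW k0) // sumr_ge0 // => j _; exact: powR_ge0.
have [c1 c2] : `|Ex (fun a => cos (theta * sketch (N := N) xi x a)) - expR (- Lambda)| <= 4 * (eps / 16) * Lambda /\
  Ex (fun a => 1 - cos (theta * sketch (N := N) xi x a)) <= 3 * Lambda.
  apply: (@sketch_cos R p (eps / 16) T B U xi kappa t2 p12 _ law n N x theta hN th0) => //; first by lra.
  by move=> j; case: (ok j) => [e|]; [left; rewrite /x e | right].
pose err (w : sample) : R := (noisy_sketch X w)%:~R - sketch xi x w.1.
pose rho := 288 * B * D.+1%:R / 2 ^+ s.
have rho_le : rho <= eps ^+ 2 / 32.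
  by have := hsB; rewrite /rho ler_pdivrMr //; lra.
have B0 : 0 <= B.
  have : 0 <= kappa * B by apply: le_trans (sl_mom law); apply: Ex_ge0 => u; apply: powR_ge0.
  by rewrite pmulr_rge0.
have rho0 : 0 <= rho by rewrite !mulr_ge0 ?invr_ge0 // ltW.
have hE : Ex (fun w => `|theta * err w| `^ p) <= rho * Lambda.
  under eq_Ex do rewrite normrM powRM // (ger0_norm th0).
  rewrite ExZ; have := ler_wpM2l (powR_ge0 theta p) (noisy_sketch_error X).
  rewrite -/rho => /le_trans; apply.
  by rewrite /Lambda le_eqVlt; apply/orP; left; apply/eqP; ring.
have Efst (f : {ffun 'I_n * 'I_N -> U} -> R) : Ex (fun w : sample => f w.1) = Ex f.
  rewrite Ex_pair; apply: eq_Ex => a /=; rewrite Ex_cst // card_ffun card_ord !expn_gt0 //.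
have yE w : theta * (noisy_sketch X w)%:~R = theta * sketch xi x w.1 + theta * err w.
  by rewrite /err; ring.
have S0 := noisy_sketch_card.
have e2 : eps ^+ 2 <= 1 by rewrite expr_le1 // ltW.
split; last first.
  apply: (@le_trans _ _ (Ex (fun w : sample => 2 * (1 - cos (theta * sketch xi x w.1)) +
      2 * (2 * `|theta * err w| `^ p)))).
    apply: ler_Ex => w; rewrite yE; apply: (le_trans (oneBcosD_le _ _)).
    by rewrite lerD2l ler_pM2l // oneBcos_le_powR.
  rewrite ExD !ExZ (Efst (fun a => 1 - cos (theta * sketch xi x a))).
  have : rho * Lambda <= 1 / 2 * Lambda by rewrite ler_wpM2r //; lra.
  lra.
have -> : Ex (fun w => cos (theta * (noisy_sketch X w)%:~R)) - expR (- Lambda) =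
  Ex (fun w : sample => cos (theta * (noisy_sketch X w)%:~R) - cos (theta * sketch xi x w.1)) +
  (Ex (fun a => cos (theta * sketch (N := N) xi x a)) - expR (- Lambda)).
  by rewrite ExB (Efst (fun a => cos (theta * sketch xi x a))); ring.
apply: (le_trans (ler_normD _ _)).
(* Budget: [eps / 4] for the threshold in [norm_le_delta], [eps / 4] for the moment of the rounding
   error, as [rho <= eps^2 / 32], and [eps / 2] for the exact sketch at accuracy [eps / 16]. *)
have h1 : `|Ex (fun w : sample => cos (theta * (noisy_sketch X w)%:~R) - cos (theta * sketch xi x w.1))| <=
    eps / 4 + (eps / 4)^-1 * (rho * Lambda).
  apply: (le_trans (norm_Ex _)).
  apply: (@le_trans _ _ (Ex (fun w => eps / 4 + (eps / 4)^-1 * `|theta * err w| `^ p))).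
    apply: ler_Ex => w; apply: (le_trans (cos_lip _ _)).
    have -> : theta * (noisy_sketch X w)%:~R - theta * sketch xi x w.1 = theta * err w by rewrite /err; ring.
    by apply: norm_le_delta => //; lra.
  rewrite ExD Ex_cst // ExZ lerD2l ler_wpM2l // invr_ge0; lra.
have h2 : (eps / 4)^-1 * (rho * Lambda) <= eps / 4.
  rewrite ler_pdivrMl; last by lra.
  have : rho * Lambda <= eps ^+ 2 / 32 * 2 by rewrite ler_pM.
  rewrite expr2; lra.
have h3 : eps * Lambda <= eps * 2 by rewrite ler_pM2l.
lra.
Qed.
End NoisySketch.

(** * Decoding *)

Section Decoding.
Variables (R : realType) (p : R).
Hypothesis p12 : 1 <= p <= 2.

(* Halving the frequency scales the exponent [F] by [halving i]. *)
Definition halving (i : nat) : R := (2^-1 ^+ i) `^ p.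

Lemma halving_gt0 i : 0 < halving i.
Proof. by rewrite powR_gt0 // exprn_gt0 // invr_gt0. Qed.

Lemma halvingS i : 1 / 4 * halving i <= halving i.+1 <= 1 / 2 * halving i.
Proof.
have /andP[p1 p2] := p12.
rewrite /halving exprS powRM ?exprn_ge0 ?invr_ge0 // -/(halving i).
have h0 := ltW (halving_gt0 i).
apply/andP; split; rewrite ler_wpM2r //; last first.
  by rewrite div1r; apply: ge1r_powR => //; apply/andP; split; lra.
have h : 0 <= (2^-1 : R) <= 1 by rewrite invr_ge0 ler0n invf_le1 ?ler1n ?ltr0n.
apply: le_trans (@sqr_le_powR R _ p p2 h); rewrite expr2; lra.
Qed.

Lemma halving0 : halving 0 = 1.
Proof. by rewrite /halving expr0 powR1. Qed.

(** A geometric series from its first term below [c] on. Telescoping the minimum of [c] and the term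
    avoids locating the start: every summand is at most twice the corresponding difference. *)
Lemma sum_halving (F c : R) L : 0 <= F -> 0 <= c ->
  \sum_(i < L | F * halving i <= c) F * halving i <= 2 * c.
Proof.
move=> F0 c0; pose g i := Num.min c (F * halving i).
apply: (@le_trans _ _ (\sum_(0 <= i < L) 2 * (g i - g i.+1))); last first.
  rewrite -mulr_sumr ler_pM2l //.
  have -> : \sum_(0 <= i < L) (g i - g i.+1) = - \sum_(0 <= i < L) (g i.+1 - g i).
    by rewrite -sumrN; apply: eq_bigr => i _; rewrite opprB.
  rewrite telescope_sumr // opprB.
  have : g 0%N <= c by rewrite /g ge_min lexx.
  have : 0 <= g L by rewrite /g le_min c0 mulr_ge0 // ltW // halving_gt0.
  lra.
rewrite big_mkcond big_mkord; apply: ler_sum => i _.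
have /andP[_ h] := halvingS i.
have hF : F * halving i.+1 <= 1 / 2 * (F * halving i) by have := ler_wpM2l F0 h; lra.
have h0 : 0 <= F * halving i by rewrite mulr_ge0 // ltW // halving_gt0.
case: ifP => [hc|_].
  rewrite /g (min_idPr hc) (min_idPr (_ : F * halving i.+1 <= c)); lra.
rewrite mulr_ge0 // subr_ge0 /g le_min !ge_min lexx /=.
by apply/orP; right; lra.
Qed.

(** Take the first index with exponent at most 2: a single step divides the exponent by at most
    4. *)
Lemma exists_halving (F : R) L : 1 <= F -> F * halving L <= 2 ->
  exists2 i, (i <= L)%N & 1 / 2 <= F * halving i <= 2.
Proof.
move=> F1 hL; have ex : exists i, F * halving i <= 2 by exists L.
case: (ex_minnP ex) => i hi imin; exists i; first exact: imin.
rewrite hi andbT; case: i hi imin => [_ _|i hi imin].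
  by rewrite halving0; lra.
have h2 : 2 < F * halving i by rewrite ltNge; apply/negP => /imin; rewrite ltnn.
have /andP[h _] := halvingS i.
have := ler_wpM2l (le_trans ler01 F1) h; lra.
Qed.

(* The frequencies with [F * halving i > 2] are ignored, as nothing is known
   about the observations there. *)
Definition fits (L : nat) (eps : R) (obs : nat -> R) (F : R) : bool :=
  [forall i : 'I_L.+1, (F * halving i <= 2) ==>
     (`|obs i - expR (- (F * halving i))| <= 2 * eps)].

(** At the frequency where the larger exponent lies in [[1/2, 2]] both tests are active, and [exp]
    has slope at least [exp (- 2) >= 1/16] in absolute value. Two errors of [2 * eps] leave an
    exponent gap of at most [64 * eps]; dividing by an exponent of at least 1/2 gives 128. *)
Lemma fits_close L eps obs F F' : 0 <= F' -> F' <= F -> 1 <= F -> F * halving L <= 2 ->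
  fits L eps obs F -> fits L eps obs F' -> F - F' <= 128 * eps * F.
Proof.
move=> F'0 FF' F1 hL /forallP f1 /forallP f2.
have [i iL /andP[i1 i2]] := exists_halving F1 hL.
have iL' : (i < L.+1)%N by [].
have h0 := ltW (halving_gt0 i).
have i3 : F' * halving i <= F * halving i by rewrite ler_wpM2r.
have := f1 (Ordinal iL'); have := f2 (Ordinal iL'); rewrite /= i2 (le_trans i3 i2) /=.
have := expR_gap (mulr_ge0 F'0 h0) i3 i2.
have e16 : 1 / 16 <= expR (- 2) :> R.
  have h2 : 1 / 2 <= expR (- (1 / 2)) :> R by have := @expR_ge1Dx R (- (1 / 2)); lra.
  have -> : - 2 = 4%:R * (- (1 / 2)) :> R by lra.
  rewrite expRM_natl (_ : 1 / 16 = (1 / 2) ^+ 4); last by field.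
  by rewrite lerXn2r ?nnegrE ?expR_ge0 //; lra.
rewrite !ler_norml => g /andP[a1 a2] /andP[b1 b2].
have d0 : 0 <= (F - F') * halving i by rewrite mulr_ge0 // subr_ge0.
have g2 : 1 / 16 * ((F - F') * halving i) <= 4 * eps.
  have := ler_wpM2r d0 e16; lra.
have h1 : (F - F') * (1 / 2) <= (F - F') * (F * halving i).
  by rewrite ler_wpM2l // subr_ge0.
have h2 : F * ((F - F') * halving i) <= F * (64 * eps) by rewrite ler_wpM2l //; lra.
lra.
Qed.

(** [fits_close] bounds the gap by [eps / 2] times the larger value; if that is the estimate [F'],
    use that [1 + eps] times [1 - eps / 2] is at least 1. *)
Lemma fits_approximates L eps obs F F' : 0 < eps < 1 ->
  (F = 0 \/ 1 <= F) -> (F' = 0 \/ 1 <= F') ->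
  F * halving L <= 2 -> F' * halving L <= 2 ->
  fits L (eps / 256) obs F -> fits L (eps / 256) obs F' ->
  approximates eps F' F.
Proof.
move=> /andP[e0 e1] hF hF' hL hL' f1 f2.
have F0 : 0 <= F by case: hF => [->|]; lra.
have F'0 : 0 <= F' by case: hF' => [->|]; lra.
have e2 : 0 <= eps * (1 - eps) by rewrite mulr_ge0 //; lra.
rewrite /approximates; have [FF'|/ltW FF'] := leP F' F.
  case: hF => [Fz|F1].
    have -> : F' = 0 by lra.
    by rewrite Fz !mulr0 lexx.
  have := fits_close F'0 FF' F1 hL f1 f2 => h.
  have eF := mulr_ge0 (ltW e0) F0; apply/andP; split; lra.
case: hF' => [Fz|F1].
  have -> : F = 0 by lra.
  by rewrite Fz !mulr0 lexx.
have h := fits_close F0 FF' F1 hL' f2 f1.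
have eF := mulr_ge0 (ltW e0) F0; apply/andP; split; first lra.
have h3 : F' * (1 - eps / 2) <= F by lra.
have h4 : (1 + eps) * (F' * (1 - eps / 2)) <= (1 + eps) * F by rewrite ler_wpM2l //; lra.
have h5 : 0 <= F' * (eps * (1 - eps)) by rewrite mulr_ge0.
lra.
Qed.
End Decoding.

(** * Concentration of the empirical means of cosines at all frequencies together *)

Section Concentration.
Variable R : realType.

(** The variance is at most the mean of [(1 - f)^2], hence, as [0 <= 1 - f <= 2], at most twice the
    mean of [1 - f]. This is small when [f] is mostly near 1, as at low frequencies. *)
Lemma Ex_mean_deviation (T : finType) (K : nat) (f : T -> R) : (0 < #|T|)%N -> (0 < K)%N ->
  (forall x, `|f x| <= 1) ->
  Ex (fun w : {ffun 'I_K -> T} => ((\sum_k f (w k)) / K%:R - Ex f) ^+ 2) <=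
  2 * Ex (fun x => 1 - f x) / K%:R.
Proof.
move=> T0 K0 f1; have KR : 0 < K%:R :> R by rewrite ltr0n.
pose h x := f x - Ex f.
have h0 : Ex h = 0 by rewrite /h ExB Ex_cst // subrr.
rewrite (@eq_Ex _ _ _ (fun w : {ffun 'I_K -> T} => K%:R ^- 2 * (\sum_k h (w k)) ^+ 2)); last first.
  move=> w; rewrite /h sumrB sumr_const card_ord -[_ *+ _]mulr_natl.
  by rewrite -exprVn -exprMn; congr (_ ^+ 2); field; rewrite gt_eqF.
rewrite ExZ Ex_sqr_sum // card_ord.
have -> : K%:R ^- 2 * (K%:R * Ex (fun u => h u ^+ 2)) = Ex (fun u => h u ^+ 2) / K%:R.
  by field; rewrite gt_eqF.
rewrite ler_pM2r ?invr_gt0 //.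
have -> : Ex (fun u => h u ^+ 2) = Ex (fun u => (1 - f u) ^+ 2) - (1 - Ex f) ^+ 2.
  have -> : Ex (fun u => h u ^+ 2) = Ex (fun u => (1 - f u) ^+ 2 +
      (2 * (1 - Ex f) * h u - (1 - Ex f) ^+ 2)).
    by apply: eq_Ex => u; rewrite /h; ring.
  by rewrite ExD ExB ExZ h0 mulr0 sub0r Ex_cst.
have : Ex (fun u => (1 - f u) ^+ 2) <= 2 * Ex (fun x => 1 - f x).
  rewrite -ExZ; apply: ler_Ex => u; have := f1 u; rewrite ler_norml expr2 => /andP[a b]; nra.
have := sqr_ge0 (1 - Ex f); lra.
Qed.

Variables (p eps : R) (T : finType) (K L : nat) (theta0 F : R) (y : T -> R).
Hypotheses (p12 : 1 <= p <= 2) (eps0 : 0 < eps) (F0 : 0 <= F).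
Hypotheses (T0 : (0 < #|T|)%N) (hK : 256 / eps ^+ 2 <= K%:R).
Hypothesis hy : forall i, (i <= L)%N -> F * halving p i <= 2 ->
  `|Ex (fun w => cos (theta0 * 2^-1 ^+ i * y w)) - expR (- (F * halving p i))| <= eps /\
  Ex (fun w => 1 - cos (theta0 * 2^-1 ^+ i * y w)) <= 8 * (F * halving p i).

(** Markov for the sum of the squared deviations over the active frequencies: the variances, at most
    [16 * Lambda / K], sum to at most [64 / K <= eps^2 / 4]. *)
Lemma fits_probability : 3 / 4 <= Ex (fun w : {ffun 'I_K -> T} =>
  (fits p L eps (fun i => (\sum_k cos (theta0 * 2^-1 ^+ i * y (w k))) / K%:R) F)%:R : R).
Proof.
have e2 : 0 < eps ^+ 2 by rewrite exprn_gt0.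
have KR : 0 < K%:R :> R by apply: lt_le_trans hK; rewrite divr_gt0.
have K0 : (0 < K)%N by rewrite -(ltr0n R).
pose f i w := cos (theta0 * 2^-1 ^+ i * y w).
pose obs i (w : {ffun 'I_K -> T}) := (\sum_k f i (w k)) / K%:R.
pose A w := ~~ fits p L eps (obs ^~ w) F.
have W0 : (0 < #|{: {ffun 'I_K -> T}}|)%N by rewrite card_ffun expn_gt0 T0.
suff : Ex (fun w => (A w)%:R : R) <= 1 / 4.
  move=> h; have : Ex (fun w : {ffun 'I_K -> T} => 1 - (A w)%:R : R) = 1 - Ex (fun w => (A w)%:R : R).
    by rewrite ExB Ex_cst.
  rewrite (@eq_Ex _ _ _ (fun w => (fits p L eps (obs ^~ w) F)%:R : R)); last first.
    by move=> w; rewrite /A; case: (fits _ _ _ _ _) => /=; rewrite ?subr0 ?subrr.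
  by move=> ->; lra.
pose g (w : {ffun 'I_K -> T}) : R :=
  \sum_(i < L.+1 | F * halving p i <= 2) (obs i w - Ex (f i)) ^+ 2.
apply: (@le_trans _ _ (Ex g / eps ^+ 2)).
  apply: Ex_markov => // [w|w]; first by apply: sumr_ge0 => i _; apply: sqr_ge0.
  rewrite /A negb_forall => /existsP[i]; rewrite negb_imply -ltNge => /andP[i2 hi].
  rewrite /g (bigD1 i) //=; apply: (@le_trans _ _ ((obs i w - Ex (f i)) ^+ 2)); last first.
    by rewrite lerDl sumr_ge0 // => j _; apply: sqr_ge0.
  have [h _] := hy (ltn_ord i : (i <= L)%N) i2.
  rewrite -[leRHS]real_normK ?num_real // lerXn2r ?nnegrE ?(ltW eps0) //.
  have : `|obs i w - expR (- (F * halving p i))| <= `|obs i w - Ex (f i)| +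
     `|Ex (f i) - expR (- (F * halving p i))|.
    by apply: le_trans (ler_normD _ _); rewrite addrA subrK.
  rewrite -/(f i) in h; lra.
rewrite ler_pdivrMr // /g Ex_sum.
apply: (@le_trans _ _ (\sum_(i < L.+1 | F * halving p i <= 2) 16 / K%:R * (F * halving p i))).
  apply: ler_sum => i i2; have [_ h] := hy (ltn_ord i : (i <= L)%N) i2.
  apply: (le_trans (Ex_mean_deviation T0 K0 _)); first by move=> x; apply: cos_max.
  rewrite [leRHS]mulrAC ler_pM2r ?invr_gt0 //.
  have : 2 * Ex (fun x => 1 - f i x) <= 2 * (8 * (F * halving p i)) by rewrite ler_pM2l.
  lra.
rewrite -mulr_sumr.
apply: (@le_trans _ _ (16 / K%:R * (2 * 2))).
  by rewrite ler_wpM2l ?divr_ge0 // sum_halving.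
rewrite mulrAC ler_pdivrMr //.
by have := hK; rewrite ler_pdivrMr //; lra.
Qed.
End Concentration.

(** * The moment protocol *)

Section MomentProtocol.
Variables (R : realType) (p eps T B : R) (U : finType) (xi : U -> int) (kappa t2 : R).
Hypotheses (p12 : 1 <= p <= 2) (eps01 : 0 < eps < 1).
Let eps1 := eps / 256.
Hypothesis law : stable_law p (eps1 / 16) T B xi kappa t2.
Variables (V : finType) (e : rel V) (o : V).
Hypothesis conn : connected_graph e.
Let D := diameter e.
Let par := parent e o.
Variables (n M N G s W K L : nat).
Hypothesis hN : 4 / (eps1 / 16) <= N%:R.
Hypothesis hW : forall u, (`|xi u| <= W)%N.
Hypothesis hG : ((2 * #|V|).+1 ^ D.+1 * (n * N * (M * W)) <= 2 ^ G)%N.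
Hypothesis hs : (48 * D.+1 <= 2 ^ s)%N.
Hypothesis hsB : 32 * (288 * (B * D.+1%:R)) <= eps1 ^+ 2 * 2 ^+ s.
Hypothesis hK : 256 / eps1 ^+ 2 <= K%:R.
Hypothesis n0 : (0 < n)%N.
Hypothesis hL : (n * (#|V| * M).+1 <= 2 ^ L)%N.
Hypothesis hTL : 32 * 2 ^+ L / (eps1 / 16) <= T.
Hypothesis hN1 : 16 / (eps1 / 16 * (kappa * t2 `^ p)) <= N%:R.
Hypothesis hN2 : N%:R <= 32 / (eps1 / 16 * (kappa * t2 `^ p)).

Let par_root : par o = o. Proof. by rewrite /par /parent eqxx. Qed.
Let par_dep v (vo : v != o) : (depth e o (par v) < depth e o v)%N := (parent_spec conn vo).2.
Let dep_le v : (depth e o v <= D)%N := depth_le e o v.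

(** Normalised by [N * kappa * theta0^p = 1], so that after [i] halvings the exponent is
    [F * halving p i]. *)
Let theta0 : R := (N%:R * kappa)^-1 `^ p^-1.
Let F (x : 'I_n -> nat) : R := \sum_j (x j)%:R `^ p.

Let N_gt0 : 0 < N%:R :> R.
Proof.
have /andP[e0 _] := eps01; apply: lt_le_trans hN1.
by rewrite !divr_gt0 // !mulr_gt0 ?invr_gt0 ?powR_gt0 ?(sl_kappa law) ?(sl_t2 law).
Qed.

Let theta0_powR : theta0 `^ p = (N%:R * kappa)^-1.
Proof.
have /andP[p1 p2] := p12; have k0 := sl_kappa law.
rewrite /theta0 -powRrM mulVf ?powRr1 //; last by lra.
by rewrite invr_ge0 mulr_ge0 // ltW.
Qed.

Let theta_powR i : (theta0 * 2^-1 ^+ i) `^ p = (N%:R * kappa)^-1 * halving p i.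
Proof. by rewrite powRM ?powR_ge0 ?exprn_ge0 ?invr_ge0 // theta0_powR. Qed.

Lemma F_zero_or_ge1 x : F x = 0 \/ 1 <= F x.
Proof.
have /andP[p1 p2] := p12.
have [/existsP[j xj]|/existsPn H] := boolP [exists j, x j != 0%N].
  right; rewrite /F (bigD1 j) //=.
  have : 1 <= (x j)%:R `^ p :> R by apply: powR_ge1; [lra | rewrite ler1n lt0n].
  have : 0 <= \sum_(i < n | i != j) (x i)%:R `^ p :> R by apply: sumr_ge0 => i _; apply: powR_ge0.
  lra.
left; rewrite /F big1 // => j _; have := H j; rewrite negbK => /eqP ->.
by rewrite powR0 //; lra.
Qed.

(** The frequencies reach far enough down for every vector that the decoder considers;
    [fits_approximates] needs this for the estimate as well as for the truth. *)
Lemma F_halving x : (forall j, x j <= #|V| * M)%N -> F x * halving p L <= 2.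
Proof.
move=> hx; have /andP[p1 p2] := p12.
set T0 := (#|V| * M)%N in hx *.
have FT : F x <= (n * T0)%:R `^ p.
  apply: (@le_trans _ _ (\sum_(j < n) T0%:R `^ p)).
    by apply: ler_sum => j _; apply: ler_powR2; rewrite ?ler_nat //; lra.
  rewrite sumr_const card_ord -[_ *+ _]mulr_natl natrM powRM // ler_wpM2r ?powR_ge0 //.
  by apply: le1r_powR => //; rewrite ler1n.
have h : (n * T0)%:R `^ p * halving p L <= 1.
  rewrite /halving -powRM ?exprn_ge0 ?invr_ge0 //.
  have : (n * T0)%:R * 2^-1 ^+ L <= 1 :> R.
    rewrite exprVn ler_pdivrMr ?exprn_gt0 // mul1r -natrX ler_nat.
    by apply: leq_trans hL; rewrite leq_mul2l leqnSn orbT.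
  move=> h; apply: powR_le1; first lra.
  by rewrite h mulr_ge0 // exprn_ge0 // invr_ge0.
by have := ler_wpM2r (ltW (halving_gt0 p L)) FT; lra.
Qed.

(** Upper end: an exponent of at most 2 bounds the p-th power of [theta * x] by [2 / (N * kappa)],
    which [hN1] compares with that of [t2]. Lower end: nonzero totals are at least 1, [hN2] keeps
    [theta0] above [eta * t2 / 32], and [hTL] leaves room for [L] halvings. *)
Lemma scale_ok_theta X i : (i <= L)%N -> F (total X) * halving p i <= 2 ->
  scale_ok T t2 (theta0 * 2^-1 ^+ i) (X : V -> input n M).
Proof.
move=> iL Fi j; have /andP[p1 p2] := p12; have /andP[e0 e1] := eps01.
have k0 := sl_kappa law; have t20 := sl_t2 law; have N0 := N_gt0.
have [->|xj] := eqVneq (total X j) 0%N; [by left | right].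
have eta0 : 0 < eps1 / 16 by rewrite !divr_gt0.
have eta1 : eps1 / 16 <= 1 by rewrite /eps1; lra.
have [eta etaE] : exists x, x = eps1 / 16 by exists (eps1 / 16).
rewrite -etaE in eta0 eta1.
have tp0 : 0 < t2 `^ p by rewrite powR_gt0.
have kt0 : 0 < eta * (kappa * t2 `^ p) by rewrite !mulr_gt0.
have Nk0 : 0 < N%:R * kappa by rewrite mulr_gt0.
have th0 : 0 <= theta0 by apply: powR_ge0.
have r0 : 0 <= 2^-1 ^+ i :> R by rewrite exprn_ge0 ?invr_ge0.
set x : R := (total X j)%:R; have x1 : 1 <= x by rewrite ler1n lt0n.
have x0 : 0 <= x by lra.
apply/andP; split.
  have th : eta / 32 * t2 <= theta0.
    rewrite leNgt; apply/negP => h.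
    have : theta0 `^ p < (eta / 32 * t2) `^ p.
      have p0 : 0 < p by lra.
      apply: gt0_ltr_powR; rewrite ?nnegrE //.
      by rewrite mulr_ge0 ?divr_ge0 ?(ltW eta0) ?(ltW t20).
    apply/negP; rewrite -leNgt theta0_powR powRM ?divr_ge0 ?(ltW eta0) ?(ltW t20) //.
    apply: (@le_trans _ _ (eta / 32 * t2 `^ p)).
      by rewrite ler_wpM2r ?powR_ge0 // ge1r_powR //; apply/andP; split; lra.
    have := hN2; rewrite -etaE ler_pdivlMr // => h2.
    rewrite -[leRHS]div1r ler_pdivlMr //; lra.
  apply: (@le_trans _ _ (eta / 32 * t2 * 2^-1 ^+ L)); last first.
    rewrite -mulrA -[leLHS]mulr1 mulrA; apply: ler_pM => //.
      by rewrite !mulr_ge0 ?exprn_ge0 ?invr_ge0 ?(ltW t20) ?(ltW eta0).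
    apply: ler_pM => //; rewrite ?exprn_ge0 ?invr_ge0 //; first by rewrite !mulr_ge0 ?invr_ge0 ?(ltW t20) ?(ltW eta0).
    by apply: ler_wiXn2l => //; rewrite ?invr_ge0 // invf_le1 // ler1n.
  have T1 : 0 < T by apply: lt_le_trans hTL; rewrite -etaE divr_gt0 // mulr_gt0 // exprn_gt0.
  rewrite ler_pdivrMr //.
  have := hTL; rewrite -etaE => h.
  have c0 : 0 <= eta / 32 * t2 * 2^-1 ^+ L.
    by rewrite !mulr_ge0 ?exprn_ge0 ?invr_ge0 ?(ltW t20) ?(ltW eta0).
  apply: le_trans (ler_wpM2l c0 h).
  rewrite exprVn le_eqVlt; apply/orP; left; apply/eqP; field.
  by rewrite !gt_eqF ?exprn_gt0.
rewrite leNgt; apply/negP => h.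
have : t2 `^ p < (theta0 * 2^-1 ^+ i * x) `^ p.
  have p0 : 0 < p by lra.
  apply: gt0_ltr_powR; rewrite ?nnegrE ?(ltW t20) //.
  by rewrite mulr_ge0 // mulr_ge0.
apply/negP; rewrite -leNgt powRM ?mulr_ge0 // theta_powR -mulrA mulrC ler_pdivrMr //.
apply: (@le_trans _ _ 2).
  apply: le_trans Fi; rewrite mulrC ler_wpM2r ?(ltW (halving_gt0 _ _)) //.
  rewrite /F (bigD1 j) //= lerDl; apply: sumr_ge0 => k _; exact: powR_ge0.
have := hN1; rewrite -etaE ler_pdivrMr // => h2.
have : eta * (kappa * t2 `^ p * N%:R) <= 1 * (kappa * t2 `^ p * N%:R).
  by rewrite ler_wpM2r // !mulr_ge0 // ltW.
lra.
Qed.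

Let sampleT : finType := sample U V n N G.

Lemma total_le (X : V -> input n M) j : (total X j <= #|V| * M)%N.
Proof.
rewrite /total -sum_nat_const; apply: leq_sum => v _.
by rewrite -ltnS ltn_ord.
Qed.

Definition observed (y : 'I_K -> int) (i : nat) : R :=
  (\sum_k cos (theta0 * 2^-1 ^+ i * (y k)%:~R)) / K%:R.

(** Searching only integer vectors with bounded entries makes [F] zero or at least 1 and keeps it
    within reach of the frequencies, as [fits_approximates] requires; the true total is among the
    candidates. *)
Definition estimate (y : 'I_K -> int) : R :=
  if [pick x : {ffun 'I_n -> 'I_(#|V| * M).+1} |
       fits p L eps1 (observed y) (F (fun j => x j))] is Some x
  then F (fun j => x j) else 0.

Let sketch_at (X : V -> input n M) : sampleT -> int := noisy_sketch xi o par D s X.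

Lemma moment_total (X : V -> input n M) : moment p X = F (total X).
Proof.
apply: eq_bigr => j _; rewrite /total natr_sum ger0_norm //.
by apply: sumr_ge0.
Qed.

Lemma estimate_correct (X : V -> input n M) :
  3 / 4 <= Ex (fun w : {ffun 'I_K -> sampleT} =>
    (approximates eps (estimate (fun k => sketch_at X (w k))) (moment p X))%:R : R).
Proof.
have /andP[e0 e1] := eps01; have /andP[p1 p2] := p12.
have eps10 : 0 < eps1 by rewrite divr_gt0.
have eps11 : 0 < eps1 <= 1 by rewrite eps10 /eps1; lra.
have F0 x : 0 <= F x by case: (F_zero_or_ge1 x) => [->|]; lra.
have T0 : (0 < #|sampleT|)%N by apply: (noisy_sketch_card law).
have hy i : (i <= L)%N -> F (total X) * halving p i <= 2 ->
  `|Ex (fun w => cos (theta0 * 2^-1 ^+ i * (sketch_at X w)%:~R)) - expR (- (F (total X) * halving p i))| <= eps1 /\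
  Ex (fun w => 1 - cos (theta0 * 2^-1 ^+ i * (sketch_at X w)%:~R)) <= 8 * (F (total X) * halving p i).
  move=> iL Fi.
  have := noisy_sketch_cos p12 eps11 law par_root par_dep dep_le hN hW hG hs hsB _ (scale_ok_theta iL Fi).
  rewrite theta_powR -/(F (total X)).
  have -> : N%:R * kappa * ((N%:R * kappa)^-1 * halving p i) * F (total X) = F (total X) * halving p i.
    have Nk : N%:R * kappa != 0 by rewrite gt_eqF // mulr_gt0 ?(sl_kappa law).
    by rewrite (mulVKf Nk) mulrC.
  by apply => //; rewrite mulr_ge0 ?powR_ge0 ?exprn_ge0 ?invr_ge0.
apply: le_trans (fits_probability p12 eps10 (F0 _) T0 hK hy) _.
apply: ler_Ex => w.
case fit : (fits _ _ _ _ _) => //=; rewrite ler_nat.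
pose x0 : {ffun 'I_n -> 'I_(#|V| * M).+1} := [ffun j => inord (total X j)].
have x0E : F (fun j => x0 j) = F (total X).
  by apply: eq_bigr => j _; rewrite ffunE inordK // ltnS total_le.
rewrite /estimate moment_total; case: pickP => [x fx|/(_ x0)]; last first.
  by rewrite x0E /observed fit.
rewrite lt0b; apply: (fits_approximates p12 eps01 _ _ _ _ fit fx).
- exact: F_zero_or_ge1.
- exact: F_zero_or_ge1.
- by apply: F_halving => j; apply: total_le.
- by apply: F_halving => j; rewrite -ltnS ltn_ord.
Qed.

Let code : finType := ('I_G.+1 * 'I_(2 ^ s.+2).+1)%type.
Let Msg : finType := {ffun 'I_K -> code}.
Let code0 : code := (ord0, ord0).

Definition encode_float (y : int) : code := odflt code0 [pick c : code | decode_float c == y].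

Lemma encode_floatK u (y : int) : (cell s y <= G)%N ->
  decode_float (encode_float (dyround (G := G) s u y)) = dyround s u y.
Proof.
move=> yG; have [c cE] := dyround_float u yG.
rewrite /encode_float; case: pickP => [d /eqP //|/(_ c)]; by rewrite cE eqxx.
Qed.

Definition partial_sum (w : sampleT) (u : V) (x : input n M) (recv : V -> code) : int :=
  local_sketch xi w x + \sum_(v | child o par v u) decode_float (recv v).

Definition send_sketch (w : {ffun 'I_K -> sampleT}) (u : V) (x : input n M) (recv : V -> Msg) : Msg :=
  [ffun k => encode_float (dyround s ((w k).2 u) (partial_sum (w k) u x (fun v => recv v k)))].

Definition answer_sketch (w : {ffun 'I_K -> sampleT}) (x : input n M) (recv : V -> Msg) : R :=
  estimate (fun k => partial_sum (w k) o x (fun v => recv v k)).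

Variable l : nat.
Hypothesis hl : (#|code| <= 2 ^ l)%N.

(** By [hG] all partial sums are at most [2 ^ G] in absolute value, so their rounded values are
    transmitted without loss and the run computes the sketches of [estimate_correct]. The sample
    space has a power of 2 as cardinality, hence is in bijection with coin strings. *)
Lemma moment_protocol : exists P : protocol R V n M, forall X : V -> input n M,
  3 / 4 <= coin_prob R (fun r => approximates eps (output e P r X o) (moment p X)) /\
  forall r : (coins P).-tuple bool,
    (total_comm e P r X <= #|V| * (K * l))%N /\ (max_comm e P r X <= K * l)%N.
Proof.
have [b Ub] := sl_card law.
have cardT : #|{ffun 'I_K -> sampleT}| = (2 ^ ((b * (n * N) + G * #|V|) * K))%N.
  rewrite card_ffun card_prod !card_ffun card_prod !card_ord Ub.
  by rewrite -!expnM -expnD -expnM.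
have [coin coinB] := coins_bij cardT.
have MsgL : (#|Msg| <= 2 ^ (K * l))%N.
  rewrite card_ffun card_ord mulnC expnM; case: K => [//|K']; by rewrite leq_exp2r.
pose agg_at (w : {ffun 'I_K -> sampleT}) (X : V -> input n M) (k : 'I_K) : V -> int :=
  rounded_agg o par D s (fun v => local_sketch xi (w k) (X v)) (w k).2.
have agg_le w X k v : (cell s (agg_at w X k v) <= G)%N.
  apply: cell_le; apply: leq_trans hG; apply: agg_bound.
    by move=> u; apply: local_sketch_le.
  by move=> u y; apply: dyround_le.
pose msg (w : {ffun 'I_K -> sampleT}) (X : V -> input n M) (u : V) : Msg := [ffun k => encode_float (dyround s ((w k).2 u) (agg_at w X k u))].
pose dflt : Msg := [ffun=> code0].
pose P := tree_protocol o par (depth e o) D coin dflt MsgL send_sketch answer_sketch.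
have psum (w : {ffun 'I_K -> sampleT}) X k u (recv : V -> Msg) : (forall v, child o par v u -> recv v = msg w X v) ->
    partial_sum (w k) u (X u) (fun v => recv v k) = agg_at w X k u.
  move=> hrecv; rewrite /partial_sum /agg_at /rounded_agg (aggE par_dep dep_le).
  congr (_ + _); apply: eq_bigr => v cv.
  by rewrite hrecv // ffunE encode_floatK // -/(agg_at w X k v).
have par_sp v : v != o -> e v (par v) /\ (depth e o (par v) < depth e o v)%N.
  exact: parent_spec.
exists P => X.
have msgE r u : msg (coin r) X u = send_sketch (coin r) u (X u)
    (received o par dflt MsgL (msg (coin r) X) u).
  apply/ffunP => k; rewrite !ffunE psum // => v cv.
  by rewrite /received cv.
split; last first.
  move=> r; split; first exact: (total_comm_tree par_sp dep_le answer_sketch (msgE r)).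
  exact: (max_comm_tree par_sp dep_le answer_sketch (msgE r)).
pose A (w : {ffun 'I_K -> sampleT}) := approximates eps (estimate (fun k => sketch_at X (w k))) (moment p X).
have -> : coin_prob R (fun r => approximates eps (output e P r X o) (moment p X)) =
    coin_prob R (fun r => A (coin r)).
  congr coin_prob; apply: boolp.funext => r.
  rewrite /A (output_tree par_sp dep_le answer_sketch (msgE r)) /answer_sketch.
  congr (approximates _ (estimate _) _); apply: boolp.funext => k.
  by rewrite psum // => v cv; rewrite /received cv.
by rewrite (coin_prob_bij R A coinB) estimate_correct.
Qed.
End MomentProtocol.

(** * Values of the parameters and the resulting message length *)

Section Tuning.
Variables (R : realType) (C0 : R) (k0 : nat).
Hypothesis C01 : 1 <= C0.
Variables (n m M D : nat) (eps : R).

(** 256 is the loss in [fits_approximates], 16 the loss from the law to the rounded sketch in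
    [noisy_sketch_cos]. *)
Definition tol : R := eps / 256 / 16.
(** [64 = 2 * 32]: the power [2 ^ L] is at most twice [n * (m * M).+1], and 32 is the factor in the
    hypothesis [hTL] of [moment_protocol]. *)
Definition range_ratio : R := 64 * (n%:R * (m * M).+1%:R) / tol.
Definition law_bound : R := C0 * ((1 + ln range_ratio) / tol) ^+ k0.
(* Bounds the number of bits of the partial sums. *)
Definition magnitude_bits : R :=
  2 * (1 + D.+1%:R * ln (2 * m).+1%:R + ln n%:R + 32 * law_bound / tol
         + ln M.+1%:R + law_bound).
(* Up to a factor 2, the required value of [2 ^ s] for [s] bits of mantissa. *)
Definition precision : R := 32 * (288 * (law_bound * D.+1%:R)) / (eps / 256) ^+ 2.
(* Bounds the number of floating point numbers that can be sent. *)
Definition code_bound : R := 32 * ((magnitude_bits + 1) * precision).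

Hypotheses (n0 : (0 < n)%N) (eps01 : 0 < eps < 1).

Lemma tol_gt0 : 0 < tol.
Proof. by have /andP[e0 _] := eps01; rewrite /tol !divr_gt0. Qed.

Lemma tol_le1 : tol <= 1.
Proof. by have /andP[_ e1] := eps01; rewrite /tol; lra. Qed.

Lemma range_ratio_ge : 64 / tol <= range_ratio.
Proof.
rewrite /range_ratio ler_pM2r ?invr_gt0 ?tol_gt0 // ler_peMr //.
by rewrite -natrM ler1n muln_gt0 n0.
Qed.

Lemma range_ratio_ge1 : 1 <= range_ratio.
Proof.
apply: le_trans range_ratio_ge; rewrite ler_pdivlMr ?tol_gt0 // mul1r.
by have := tol_le1; lra.
Qed.

Lemma law_bound_ge1 : 1 <= law_bound.
Proof.
rewrite /law_bound -[leLHS]mulr1; apply: ler_pM => //.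
rewrite exprn_ege1 // ler_pdivlMr ?tol_gt0 // mul1r.
by have := tol_le1; have := ln_ge0 range_ratio_ge1; lra.
Qed.
End Tuning.

Lemma ln_natr_ge0 (R : realType) n : 0 <= ln n%:R :> R.
Proof. by case: n => [|n]; [rewrite ln0 | rewrite ln_ge0 // ler1n]. Qed.

(** 1024 is [2 * 256 * 2]: the number of repetitions is rounded up to a power of 2, and a float of
    [l] bits satisfies [l <= 2 * ln (2 ^ l)] because [ln 2 >= 1/2]. *)
Lemma moment_protocol_cost (R : realType) (p C0 : R) (k0 : nat) :
  1 < p <= 2 -> 1 <= C0 ->
  (forall eta T : R, 0 < eta <= 1 -> 1 <= T ->
    exists (U : finType) (xi : U -> int) (kappa t2 : R),
      stable_law p eta T (C0 * ((1 + ln T) / eta) ^+ k0) xi kappa t2) ->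
  forall (n M : nat) (V : finType) (e : rel V) (o : V) (eps : R),
  (0 < n)%N -> connected_graph e -> 0 < eps < 1 ->
  exists (c : nat) (P : protocol R V n M),
  [/\ c%:R <= 1024 / (eps / 256) ^+ 2 * ln (code_bound C0 k0 n #|V| M (diameter e) eps),
      forall X, 3 / 4 <= coin_prob R
        (fun r => approximates eps (output e P r X o) (moment p X)) &
      forall X (r : (coins P).-tuple bool),
        (total_comm e P r X <= #|V| * c)%N /\ (max_comm e P r X <= c)%N].
Proof.
move=> /andP[p1 p2] C01 H n M V e o eps n0 conn eps01; have /andP[e0 e1] := eps01.
have p12 : 1 <= p <= 2 by rewrite ltW.
set m := #|V|; set D := diameter e.
have tol0 := tol_gt0 eps01; have tol1 := tol_le1 eps01.
have T1 := range_ratio_ge1 m M n0 eps01.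
have B1 := law_bound_ge1 k0 C01 m M n0 eps01.
have [U [xi [kappa [t2 law]]]] := H _ _ (introT andP (conj tol0 tol1)) T1.
rewrite -/(law_bound C0 k0 n m M eps) in law.
set T := range_ratio n m M eps in T1 law.
have hTL0 : T = 64 * (n%:R * (m * M).+1%:R) / tol eps by [].
rewrite /code_bound /magnitude_bits /precision.
move: (law_bound C0 k0 n m M eps) B1 law => B B1 law.
clearbody T.
have k_gt0 := sl_kappa law; have t2_gt0 := sl_t2 law.
have kt0 : 0 < kappa * t2 `^ p by rewrite mulr_gt0 // powR_gt0.
(* The law is accurate at the end [t2] of its window, where [1 - cos] has mean at most 2.
   Consequently the lower bound [x] on [N] already exceeds [4 / tol eps]. *)
have kt4 : kappa * t2 `^ p <= 4.
  have tT : t2 / T <= t2 <= t2 by rewrite lexx andbT ler_pdivrMr ?ler_peMr //; lra.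
  have := sl_cos law tT; rewrite ler_norml => /andP[h _].
  have U0 := law_card_gt0 law.
  have : Ex (fun u => 1 - cos (t2 * (xi u)%:~R)) <= 2 :> R.
    by rewrite -[leRHS](Ex_cst _ U0); apply: ler_Ex => u; apply: oneBcos_le2.
  have tol2 : tol eps <= 1 / 2 by rewrite /tol; lra.
  have := ler_wpM2r (ltW kt0) tol2; lra.
pose x : R := 16 / (tol eps * (kappa * t2 `^ p)).
have xge : 4 / tol eps <= x.
  have kV : 4^-1 <= (kappa * t2 `^ p)^-1 by rewrite lef_pV2 ?posrE.
  have -> : x = 4 / tol eps * (4 * (kappa * t2 `^ p)^-1) by rewrite /x invfM; ring.
  by rewrite ler_peMr ?divr_ge0 ?(ltW tol0) //; lra.
have x1 : 1 <= x.
  by apply: le_trans xge; rewrite ler_pdivlMr //; lra.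
have [iN /andP[hN1 hN2]] := exists_pow2 x1.
pose N := (2 ^ iN)%N; rewrite -natrX -/N in hN1 hN2.
have N1 : 1 <= N%:R :> R by rewrite ler1n expn_gt0.
have NB : N%:R <= 32 * B / tol eps.
  apply: (le_trans hN2); have := sl_scale law => h.
  have -> : 2 * x = 32 / tol eps * (1 / (kappa * t2 `^ p)).
    by rewrite /x; field; rewrite !gt_eqF ?powR_gt0.
  by rewrite [leRHS]mulrAC ler_pM2l ?divr_gt0.
pose W := Num.truncn (expR B).
have hW u : (`|xi u| <= W)%N.
  rewrite /W truncn_ge_nat ?expR_ge0 //; apply: le_trans (sl_bnd law u).
  by rewrite -intr_norm natr_absz.
have [L /andP[hL1 hL2]] := @exists_pow2 R (n * (m * M).+1)%:R ltac:(by rewrite ler1n muln_gt0 n0).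
have [K0 /andP[hK1 hK2]] := @exists_pow2 R (256 / (eps / 256) ^+ 2) ltac:(
  rewrite ler_pdivlMr ?exprn_gt0 ?divr_gt0 // mul1r expr2; nra).
have Y1 : 48 * D.+1%:R <= 32 * (288 * (B * D.+1%:R)) / (eps / 256) ^+ 2.
  have e2 : (eps / 256) ^+ 2 <= 1 by rewrite expr_le1 //; lra.
  have D1 : 1 <= D.+1%:R :> R by rewrite ler1n.
  have BD : D.+1%:R <= B * D.+1%:R by rewrite ler_peMl.
  have e20 : 0 < (eps / 256) ^+ 2 by rewrite exprn_gt0 // divr_gt0.
  rewrite ler_pdivlMr //; have : 48 * D.+1%:R * (eps / 256) ^+ 2 <= 48 * D.+1%:R.
    by rewrite ler_piMr // mulr_ge0.
  lra.
set Y := 32 * (288 * (B * D.+1%:R)) / (eps / 256) ^+ 2 in Y1 *.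
have YE : 32 * (288 * (B * D.+1%:R)) = (eps / 256) ^+ 2 * Y.
  by rewrite /Y [RHS]mulrC divfK // expf_neq0 // gt_eqF // divr_gt0.
clearbody Y.
have D1 : 1 <= D.+1%:R :> R by rewrite ler1n.
have Yge1 : 1 <= Y by lra.
have [s /andP[hs1 hs2]] := exists_pow2 Yge1.
have ln2 := ln2_le R; have ln2' := ln2_ge R.
(* Bounds all partial sums as in [agg_bound]: a factor [2 m + 1] per level, and [n N] terms of size
   at most [M exp B] at each vertex. *)
pose A : R := (2 * m).+1%:R ^+ D.+1 * (n%:R * N%:R * (M.+1%:R * expR B)).
have n1 : 1 <= n%:R :> R by rewrite ler1n.
have M1 : 1 <= M.+1%:R :> R by rewrite ler1n.
have m1 : 1 <= (2 * m).+1%:R :> R by rewrite ler1n.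
have eB1 : 1 <= expR B by rewrite -expR0 ler_expR (le_trans ler01).
have A1 : 1 <= A.
  rewrite -[leLHS]mulr1 ler_pM ?exprn_ege1 // -[leLHS]mulr1 ler_pM //.
    by rewrite -[leLHS]mulr1 ler_pM.
  by rewrite -[leLHS]mulr1 ler_pM.
have [G /andP[hG1 hG2]] := exists_pow2 A1.
have GE : G%:R <= 2 * (1 + D.+1%:R * ln (2 * m).+1%:R + ln n%:R + 32 * B / tol eps + ln M.+1%:R + B).
  have gt0 (y : R) : 1 <= y -> y \is Num.pos by move=> h; rewrite posrE (lt_le_trans ltr01).
  have h : G%:R * ln 2 <= ln (2 * A).
    by rewrite mulr_natl -lnXn // ler_ln // posrE ?exprn_gt0 // mulr_gt0 // (lt_le_trans ltr01 A1).
  have lA : ln (2 * A) = ln 2 + (D.+1%:R * ln (2 * m).+1%:R + (ln n%:R + ln N%:R + (ln M.+1%:R + B))).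
    have p1p1 (a b : R) : 1 <= a -> 1 <= b -> 1 <= a * b.
      by move=> a1 b1; rewrite -[leLHS]mulr1 ler_pM.
    have h2 : 1 <= 2 :> R by rewrite ler1n.
    have hnN := p1p1 _ _ n1 N1; have hMB := p1p1 _ _ M1 eB1.
    rewrite (lnM (gt0 _ h2) (gt0 _ A1)) /A lnM ?gt0 ?exprn_ege1 ?p1p1 //.
    rewrite lnXn ?(lt_le_trans ltr01 m1) // -[ln _ *+ _]mulr_natl.
    rewrite (lnM (gt0 _ hnN) (gt0 _ hMB)) (lnM (gt0 _ n1) (gt0 _ N1)).
    by rewrite (lnM (gt0 _ M1) (gt0 _ eB1)) expRK.
  have lN : ln N%:R <= N%:R :> R by apply/ltW/ln_sublinear/(lt_le_trans ltr01 N1).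
  have lG : G%:R * 2^-1 <= G%:R * ln 2 :> R by rewrite ler_wpM2l.
  by rewrite lA in h; move: lG h lN NB ln2; clear; lra.
have hG : ((2 * m).+1 ^ D.+1 * (n * N * (M * W)) <= 2 ^ G)%N.
  rewrite -(ler_nat R) [leRHS]natrX; apply: le_trans hG1.
  rewrite natrM natrX /A ler_pM2l ?exprn_gt0 ?(lt_le_trans ltr01 m1) //.
  rewrite !natrM; apply: ler_pM; rewrite ?mulr_ge0 //; apply: ler_pM => //.
    by rewrite ler_nat.
  by rewrite /W truncn_le expR_ge0.
pose Gb := 2 * (1 + D.+1%:R * ln (2 * m).+1%:R + ln n%:R + 32 * B / tol eps + ln M.+1%:R + B).
rewrite -/Gb in GE *.
pose card := (G.+1 * (2 ^ s.+2).+1)%N.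
have [l /andP[hl1 hl2]] := @exists_pow2 R card%:R ltac:(by rewrite ler1n muln_gt0).
have hl : (#|{: 'I_G.+1 * 'I_(2 ^ s.+2).+1}| <= 2 ^ l)%N.
  by rewrite card_prod !card_ord -(ler_nat R) natrX.
have hN : 4 / (eps / 256 / 16) <= N%:R := le_trans xge hN1.
have hs : (48 * D.+1 <= 2 ^ s)%N by rewrite -(ler_nat R) natrM natrX (le_trans Y1).
have hsB : 32 * (288 * (B * D.+1%:R)) <= (eps / 256) ^+ 2 * 2 ^+ s.
  by rewrite YE ler_pM2l // exprn_gt0 // divr_gt0.
have hK : 256 / (eps / 256) ^+ 2 <= (2 ^ K0)%N%:R by rewrite natrX.
have hL : (n * (#|V| * M).+1 <= 2 ^ L)%N by rewrite -(ler_nat R) natrX.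
have hTL : 32 * 2 ^+ L / (eps / 256 / 16) <= T.
  rewrite hTL0 ler_pM2r ?invr_gt0 //; rewrite natrM in hL2; move: hL2; clear; lra.
have hN2' : N%:R <= 32 / (eps / 256 / 16 * (kappa * t2 `^ p)).
  by apply: (le_trans hN2); rewrite /x -/(tol eps); clear; lra.
have [P HP] := @moment_protocol R p eps T B U xi kappa t2 p12 eps01 law V e o conn n M N G s W
  (2 ^ K0)%N L hN hW hG hs hsB hK n0 hL hTL hN1 hN2' l hl.
exists (2 ^ K0 * l)%N, P; split; last 2 first.
- by move=> X; case: (HP X).
- by move=> X r; case: (HP X) => _ /(_ r).
have Gb0 : 0 <= Gb by apply: le_trans GE.
have cb : 2 ^+ l <= 32 * ((Gb + 1) * Y).
  apply: (le_trans hl2).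
  have -> : 32 * ((Gb + 1) * Y) = 2 * ((Gb + 1) * (8 * (2 * Y))) by ring.
  rewrite ler_pM2l // /card natrM; apply: ler_pM => //; first by rewrite -natr1 lerD2r.
  have s1 : 1 <= 2 ^+ s :> R by rewrite exprn_ege1 // ler1n.
  by rewrite -natr1 natrX 2!exprS; move: s1 hs2; clear; lra.
have cb0 : 0 < 32 * ((Gb + 1) * Y) by apply: lt_le_trans cb; rewrite exprn_gt0.
have hl3 : l%:R * ln 2 <= ln (32 * ((Gb + 1) * Y)).
  by rewrite mulr_natl -lnXn // ler_ln // posrE ?exprn_gt0.
have hl4 : l%:R <= 2 * ln (32 * ((Gb + 1) * Y)).
  have l2 : l%:R * 2^-1 <= l%:R * ln 2 :> R by rewrite ler_wpM2l.
  by move: hl3 l2; clear; lra.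
rewrite natrM natrX.
have -> : 1024 / (eps / 256) ^+ 2 * ln (32 * ((Gb + 1) * Y)) =
  (2 * (256 / (eps / 256) ^+ 2)) * (2 * ln (32 * ((Gb + 1) * Y))).
  by field; rewrite gt_eqF.
by apply: ler_pM; rewrite ?exprn_ge0.
Qed.

(** * The communication bound *)

Section PolynomialBounds.
Variables (R : realType) (c K : R).

(** The constant of the theorem is chosen before sizes, graph and accuracy. Functions on this type
    let bounds be composed uniformly in all these data. *)
Record instance : Type := Instance {
  inst_n : nat; inst_m : nat; inst_M : nat; inst_D : nat; inst_eps : R;
  inst_n3 : (3 <= inst_n)%N;
  inst_m0 : (0 < inst_m)%N;
  inst_mn : inst_m%:R <= K * inst_n%:R `^ c;
  inst_Mn : inst_M%:R <= K * inst_n%:R `^ c;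
  inst_eps01 : 0 < inst_eps < 1 }.

(* The logarithm of [scale] is the bracket of the theorem; [maxn 1] deals with
   diameter 0, where [ln 0 = 0]. *)
Definition scale (i : instance) : R :=
  ln (inst_n i)%:R * (maxn 1 (inst_D i))%:R / inst_eps i.

Definition poly_bounded (f : instance -> R) : Prop :=
  exists C k, forall i, 0 <= f i <= C * scale i ^+ k.

Lemma expR1_lt3 : expR 1 < 3 :> R.
Proof.
have h : 5 / 6 <= expR (- (1 / 6)) :> R by have := @expR_ge1Dx R (- (1 / 6)); lra.
have h2 : (5 / 6) ^+ 6 <= expR (- 1) :> R.
  have -> : - 1 = 6%:R * (- (1 / 6)) :> R by field.
  by rewrite expRM_natl lerXn2r ?nnegrE ?expR_ge0 //; lra.
rewrite expRN in h2; have e0 := expR_gt0 (1 : R).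
have h3 : (5 / 6) ^+ 6 * expR 1 <= 1 :> R by rewrite -ler_pdivlMr // div1r.
rewrite !exprS expr0 in h3; lra.
Qed.

Lemma ln3_gt1 : 1 < ln 3 :> R.
Proof. by rewrite -[X in X < _]expRK ltr_ln ?posrE ?expR_gt0 ?expR1_lt3. Qed.

Lemma ln_inst_n i : ln 3 <= ln (inst_n i)%:R :> R.
Proof. by rewrite ler_ln ?posrE ?ltr0n ?ler_nat ?inst_n3 // (leq_trans _ (inst_n3 i)). Qed.

Lemma inv_eps_ge1 i : 1 <= (inst_eps i)^-1.
Proof. by have /andP[e0 e1] := inst_eps01 i; rewrite invf_ge1 // ltW. Qed.

Lemma maxn1_ge1 D : 1 <= (maxn 1 D)%:R :> R.
Proof. by rewrite ler1n leq_maxl. Qed.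

Lemma scale_ge i (a : R) : 0 <= a ->
  [\/ a <= ln (inst_n i)%:R, a <= (maxn 1 (inst_D i))%:R | a <= (inst_eps i)^-1] ->
  a <= scale i.
Proof.
move=> a0; have h1 := inv_eps_ge1 i; have h2 := maxn1_ge1 (inst_D i).
have h3 : 1 <= ln (inst_n i)%:R :> R by have := ln3_gt1; have := ln_inst_n i; lra.
rewrite /scale; case=> h.
- rewrite -[leLHS]mulr1; apply: ler_pM => //; rewrite -[leLHS]mulr1; exact: ler_pM.
- rewrite -[leLHS]mulr1 -[a in leLHS]mul1r; apply: ler_pM => //; first by rewrite mul1r.
  exact: ler_pM.
- rewrite -[leLHS]mul1r; apply: ler_pM => //; rewrite -[leLHS]mulr1; exact: ler_pM.
Qed.

Lemma scale_ge1 i : 1 <= scale i.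
Proof. by apply: scale_ge; [lra | constructor 3; apply: inv_eps_ge1]. Qed.

Lemma poly_bounded_le f g : (forall i, 0 <= f i <= g i) -> poly_bounded g -> poly_bounded f.
Proof.
move=> fg [C [k gC]]; exists C, k => i; have /andP[-> h] := fg i.
by have /andP[_ h2] := gC i; apply: le_trans h2.
Qed.

Lemma poly_bounded_cst a : 0 <= a -> poly_bounded (fun=> a).
Proof. by move=> a0; exists a, 0%N => i; rewrite expr0 mulr1 a0 lexx. Qed.

Lemma poly_boundedM f g : poly_bounded f -> poly_bounded g ->
  poly_bounded (fun i => f i * g i).
Proof.
move=> [C [k fC]] [C' [k' gC]]; exists (C * C'), (k + k')%N => i.
have /andP[f0 f1] := fC i; have /andP[g0 g1] := gC i.
by rewrite mulr_ge0 //= exprD mulrACA ler_pM.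
Qed.

Lemma poly_boundedD f g : poly_bounded f -> poly_bounded g ->
  poly_bounded (fun i => f i + g i).
Proof.
move=> [C [k fC]] [C' [k' gC]]; exists (C + C'), (k + k')%N => i.
have /andP[f0 f1] := fC i; have /andP[g0 g1] := gC i.
have s1 := scale_ge1 i.
have sk j : 0 < scale i ^+ j by rewrite exprn_gt0 //; lra.
have Cp : 0 <= C by rewrite -(pmulr_lge0 _ (sk k)); apply: le_trans f1.
have Cp' : 0 <= C' by rewrite -(pmulr_lge0 _ (sk k')); apply: le_trans g1.
rewrite addr_ge0 //= mulrDl lerD //.
  apply: (le_trans f1); rewrite ler_wpM2l // ler_weXn2l // leq_addr //.
by apply: (le_trans g1); rewrite ler_wpM2l // ler_weXn2l // leq_addl.
Qed.

Lemma poly_boundedX f k : poly_bounded f -> poly_bounded (fun i => f i ^+ k).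
Proof.
move=> pf; elim: k => [|k IH]; first exact: poly_bounded_cst.
by apply: poly_bounded_le (poly_boundedM pf IH) => i; rewrite -exprS lexx andbT;
  case: pf => C [j /(_ i)/andP[f0 _]]; rewrite exprn_ge0.
Qed.

Lemma poly_bounded_scale : poly_bounded scale.
Proof. by exists 1, 1%N => i; rewrite expr1 mul1r lexx andbT (le_trans ler01) // scale_ge1. Qed.

(** Turns polynomial size in [n] into a bound linear in [ln n]. Absolute values appear because the
    signs of [c] and [K] are not prescribed. *)
Lemma poly_bounded_ln_size (f : instance -> nat) (a : R) : 0 <= a ->
  (forall i, (0 < f i)%N) ->
  (forall i, (f i)%:R <= a * (1 + K * (inst_n i)%:R `^ c)) -> poly_bounded (fun i => ln (f i)%:R).
Proof.
move=> a0 f0 fa.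
have pn : poly_bounded (fun i => ln (inst_n i)%:R).
  apply: poly_bounded_le poly_bounded_scale => i; rewrite ln_natr_ge0 /=.
  by apply: scale_ge; [exact: ln_natr_ge0 | constructor 1].
apply: (@poly_bounded_le _ (fun i => (a * (1 + `|K|)) + `|c| * ln (inst_n i)%:R)); last first.
  apply: poly_boundedD; first by apply: poly_bounded_cst; rewrite mulr_ge0 // addr_ge0.
  by apply: poly_boundedM => //; apply: poly_bounded_cst.
move=> i; rewrite ln_natr_ge0 /=.
have n0 : 1 <= (inst_n i)%:R :> R by rewrite ler1n (leq_trans _ (inst_n3 i)).
have nn : 0 < (inst_n i)%:R :> R by lra.
have fR : 0 < (f i)%:R :> R by rewrite ltr0n.
set z := (inst_n i)%:R `^ `|c|.
have z1 : 1 <= z by apply: powR_ge1.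
have zc : (inst_n i)%:R `^ c <= z by apply: ler_powR => //; apply: ler_norm.
have b : (f i)%:R <= a * (1 + `|K|) * z.
  apply: (le_trans (fa i)); rewrite -mulrA ler_wpM2l //.
  have h1 : K * (inst_n i)%:R `^ c <= `|K| * z.
    apply: le_trans (ler_norm _) _; rewrite normrM (ger0_norm (powR_ge0 _ _)).
    by rewrite ler_wpM2l.
  lra.
have aK : 0 < a * (1 + `|K|).
  have z0 : 0 < z by lra.
  by rewrite -(pmulr_lgt0 _ z0); apply: lt_le_trans b.
have z0 : 0 < z by lra.
have : ln (f i)%:R <= ln (a * (1 + `|K|) * z) by rewrite ler_ln ?posrE // mulr_gt0.
move=> /le_trans; apply; rewrite lnM ?posrE // ln_powR lerD2r.
exact: ltW (ln_sublinear aK).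
Qed.

Lemma poly_bounded_code (C0 : R) k0 : 1 <= C0 ->
  poly_bounded (fun i => code_bound C0 k0 (inst_n i) (inst_m i) (inst_M i) (inst_D i) (inst_eps i)).
Proof.
move=> C01.
have eV0 i : 0 <= (inst_eps i)^-1 by have := inv_eps_ge1 i; lra.
have n0 i : (0 < inst_n i)%N by rewrite (leq_trans _ (inst_n3 i)).
have pe : poly_bounded (fun i => (inst_eps i)^-1).
  apply: poly_bounded_le poly_bounded_scale => i; rewrite eV0 /=.
  by apply: scale_ge => //; constructor 3.
have pn : poly_bounded (fun i => ln (inst_n i)%:R).
  apply: poly_bounded_le poly_bounded_scale => i; rewrite ln_natr_ge0 /=.
  by apply: scale_ge; [exact: ln_natr_ge0 | constructor 1].
have pD : poly_bounded (fun i => (inst_D i).+1%:R).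
  apply: (@poly_bounded_le _ (fun i => 2 * scale i)); last first.
    by apply: poly_boundedM poly_bounded_scale; apply: poly_bounded_cst.
  move=> i; rewrite ler0n /=; apply: (@le_trans _ _ (2 * (maxn 1 (inst_D i))%:R)).
    by rewrite -natrM ler_nat; lia.
  by rewrite ler_pM2l //; apply: scale_ge => //; constructor 2.
have K0 i : 0 <= K * (inst_n i)%:R `^ c by apply: le_trans (inst_mn i).
have pm : poly_bounded (fun i => ln (2 * inst_m i).+1%:R).
  apply: (@poly_bounded_ln_size (fun i => (2 * inst_m i).+1) 2) => // i.
  by rewrite -natr1 natrM; have := inst_mn i; have := K0 i; lra.
have pM : poly_bounded (fun i => ln (inst_M i).+1%:R).
  apply: (@poly_bounded_ln_size (fun i => (inst_M i).+1) 1) => // i.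
  by rewrite -natr1; have := inst_Mn i; have := K0 i; lra.
have tolE i : (tol (inst_eps i))^-1 = 16 * (256 * (inst_eps i)^-1).
  by have /andP[e0 _] := inst_eps01 i; rewrite /tol; field; rewrite gt_eqF.
have ptol : poly_bounded (fun i => (tol (inst_eps i))^-1).
  apply: (@poly_bounded_le _ (fun i => 16 * (256 * (inst_eps i)^-1))) => [i|].
    by rewrite tolE lexx andbT; apply: mulr_ge0 => //; apply: mulr_ge0.
  by do 2 (apply: poly_boundedM; first exact: poly_bounded_cst).
have pT : poly_bounded (fun i => ln (range_ratio (inst_n i) (inst_m i) (inst_M i) (inst_eps i))).
  apply: (@poly_bounded_le _ (fun i => 64 + (ln (inst_n i)%:R +
      (ln (2 * inst_m i).+1%:R + ln (inst_M i).+1%:R)) + (tol (inst_eps i))^-1)); last first.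
    apply: (poly_boundedD _ ptol); apply: poly_boundedD; first exact: poly_bounded_cst.
    by apply: (poly_boundedD pn); apply: poly_boundedD.
  move=> i; have T1 := range_ratio_ge1 (inst_m i) (inst_M i) (n0 i) (inst_eps01 i).
  rewrite ln_ge0 //=; have t0 := tol_gt0 (inst_eps01 i).
  have tV0 : 0 < (tol (inst_eps i))^-1 by rewrite invr_gt0.
  have nR : 0 < (inst_n i)%:R :> R by rewrite ltr0n.
  have mR : 0 < (2 * inst_m i).+1%:R :> R by [].
  have MR : 0 < (inst_M i).+1%:R :> R by [].
  rewrite /range_ratio lnM ?posrE ?mulr_gt0 // lnM ?posrE ?mulr_gt0 // lnM ?posrE //.
  have l1 : ln 64 <= 64 :> R by apply/ltW/ln_sublinear.
  have l2 := ltW (ln_sublinear tV0).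
  have l3 : ln (inst_m i * inst_M i).+1%:R <= ln (2 * inst_m i).+1%:R + ln (inst_M i).+1%:R :> R.
    by rewrite -lnM ?posrE // ler_ln ?posrE ?mulr_gt0 // -natrM ler_nat; nia.
  lra.
have lnT0 i : 0 <= ln (range_ratio (inst_n i) (inst_m i) (inst_M i) (inst_eps i)).
  by apply/ln_ge0/range_ratio_ge1; [exact: n0 | exact: inst_eps01].
have pB : poly_bounded (fun i => law_bound C0 k0 (inst_n i) (inst_m i) (inst_M i) (inst_eps i)).
  apply: poly_boundedM; first by apply: poly_bounded_cst; lra.
  apply: poly_boundedX; apply: (poly_boundedM _ ptol); apply: (poly_boundedD _ pT).
  exact: poly_bounded_cst.
have pbits : poly_bounded (fun i => magnitude_bits C0 k0 (inst_n i) (inst_m i) (inst_M i) (inst_D i) (inst_eps i)).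
  apply: poly_boundedM; first exact: poly_bounded_cst.
  apply: (poly_boundedD _ pB); apply: (poly_boundedD _ pM).
  apply: poly_boundedD; last first.
    by apply: (poly_boundedM _ ptol); apply: (poly_boundedM _ pB); apply: poly_bounded_cst.
  apply: (poly_boundedD _ pn); apply: poly_boundedD; first exact: poly_bounded_cst.
  exact: poly_boundedM.
have pprec : poly_bounded (fun i => precision C0 k0 (inst_n i) (inst_m i) (inst_M i) (inst_D i) (inst_eps i)).
  apply: poly_boundedM.
    do 2 (apply: poly_boundedM; first exact: poly_bounded_cst).
    exact: poly_boundedM.
  apply: (@poly_bounded_le _ (fun i => (256 * (inst_eps i)^-1) ^+ 2)).
    move=> i; have /andP[e0 _] := inst_eps01 i.
    by rewrite -exprVn invf_div mulrC lexx andbT exprn_ge0 // mulr_ge0.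
  by apply: poly_boundedX; apply: poly_boundedM => //; apply: poly_bounded_cst.
apply: poly_boundedM; first exact: poly_bounded_cst.
apply: (poly_boundedM _ pprec); apply: poly_boundedD => //; exact: poly_bounded_cst.
Qed.

Lemma ln_scale i : ln (scale i) =
  ln (ln (inst_n i)%:R) + ln (inst_D i)%:R + ln (1 / inst_eps i).
Proof.
have h1 := inv_eps_ge1 i; have h2 := maxn1_ge1 (inst_D i).
have h3 : 1 < ln (inst_n i)%:R :> R by have := ln3_gt1; have := ln_inst_n i; lra.
rewrite /scale lnM ?posrE ?mulr_gt0 //; try lra.
rewrite lnM ?posrE //; try lra.
rewrite div1r; congr (_ + _ + _).
by case: (inst_D i) => [|[|d]] //=; rewrite ln1 ln0.
Qed.

(** The additive [ln C] is absorbed into a multiple of [ln (scale i)], which is at least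
    [ln (ln 3) > 0] as [n >= 3]. *)
Lemma poly_bounded_ln f : poly_bounded f ->
  exists C, 0 < C /\ forall i, ln (f i) <= C * ln (scale i).
Proof.
move=> [C [k fC]].
have l3 : 0 < ln (ln 3) :> R by rewrite ln_gt0 // ln3_gt1.
exists (`|C| / ln (ln 3) + k%:R + 1); split.
  by rewrite ltr_wpDl // addr_ge0 // divr_ge0 // ltW.
move=> i; have s1 := scale_ge1 i.
have ls : ln (ln 3) <= ln (scale i).
  have l31 := ln3_gt1; rewrite ler_ln ?posrE; try lra.
  by apply: scale_ge; [lra | constructor 1; exact: ln_inst_n].
have ls0 : 0 < ln (scale i) by lra.
have s0 : 0 < scale i by lra.
have [f0|f0] := leP (f i) 0.
  rewrite ln0 //; apply: mulr_ge0; last exact: ltW.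
  by rewrite !addr_ge0 // divr_ge0 // ltW.
have /andP[_ fi] := fC i.
have sk : 0 < scale i ^+ k by rewrite exprn_gt0.
have C0 : 0 < C by rewrite -(pmulr_lgt0 _ sk); apply: lt_le_trans fi.
have h1 : ln (f i) <= ln C + k%:R * ln (scale i).
  rewrite mulr_natl -lnXn // -lnM ?posrE // ler_ln ?posrE //.
  by rewrite mulr_gt0.
have h2 : ln C <= C := ltW (ln_sublinear C0).
have h3 : C <= `|C| / ln (ln 3) * ln (scale i).
  rewrite mulrAC ler_pdivlMr // ger0_norm ?(ltW C0) // ler_pM2l //.
lra.
Qed.
End PolynomialBounds.

Theorem theorem11 (R : realType) (p c K : R) (hp : 1 < p <= 2) :
  exists C : R, 0 < C /\
  forall (n M : nat) (V : finType) (e : rel V) (o : V) (eps : R),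
    (3 <= n)%N ->
    connected_graph e ->
    #|V|%:R <= K * n%:R `^ c ->
    M%:R <= K * n%:R `^ c ->
    0 < eps < 1 ->
    let bound := eps ^- 2 *
      (ln (ln n%:R) + ln (diameter e)%:R + ln (1 / eps)) in
    exists P : protocol R V n M,
      forall X : V -> input n M,
        3 / 4 <= coin_prob R
          (fun r => approximates eps (output e P r X o) (moment p X)) /\
        forall r : (coins P).-tuple bool,
          (total_comm e P r X)%:R <= C * (#|V|%:R * bound) /\
          (max_comm e P r X)%:R <= C * bound.
Proof.
have [C0 [k0 [C01 law]]] := stable_law_exists hp.
have [C [Cgt0 hC]] := poly_bounded_ln (poly_bounded_code c K k0 C01).
(* [256 ^+ 2] turns the inverse square of [eps / 256] in [moment_protocol_cost] into that of
   [eps]. *)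
exists (1024 * (256 ^+ 2 * C)); split; first by rewrite !mulr_gt0 ?exprn_gt0.
move=> n M V e o eps n3 conn hV hM eps01 bound.
have n0 : (0 < n)%N by apply: leq_trans n3.
have m0 : (0 < #|V|)%N by apply/card_gt0P; exists o.
have [cost [P [hcost hprob hcomm]]] := moment_protocol_cost hp C01 law M o n0 conn eps01.
have := hC (Instance (diameter e) n3 m0 hV hM eps01); rewrite ln_scale /= => hln.
have /andP[e0 _] := eps01.
have costB : cost%:R <= 1024 * (256 ^+ 2 * C) * bound.
  apply: (le_trans hcost).
  have -> : 1024 * (256 ^+ 2 * C) * bound = 1024 / (eps / 256) ^+ 2 *
      (C * (ln (ln n%:R) + ln (diameter e)%:R + ln (1 / eps))).
    by rewrite /bound; field; rewrite gt_eqF.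
  by rewrite ler_wpM2l // divr_ge0 // exprn_ge0 // divr_ge0 // ltW.
exists P => X; split; first exact: hprob.
move=> r; have [h1 h2] := hcomm X r; split.
  rewrite mulrCA; apply: (@le_trans _ _ (#|V| * cost)%:R); first by rewrite ler_nat.
  by rewrite natrM ler_wpM2l.
by apply: le_trans costB; rewrite ler_nat.
Qed.
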